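(* Let $q=p^e$ for a prime $p$ and $e>1$, and let $n\ge2$. Let $G$ be the group generated by $\{\sigma,\tau,\delta,Z,U,V\}$, omitting $V$ if $n=2$, subject to the following relations, where $\Delta=[U,\delta]$, and $U'=UZ^2$ if $q$ is odd, $U'=U$ if $q$ is even. Then $G$ is isomorphic to $\mathrm{Sp}(2n,q)$. (i) Defining relations for $S_n$ on $\{U,V\}$ (on $\{U\}$ if $n=2$), with $U=(1,2)$, $V=(1,2,\dots,n)$; $[Z,U^V]=[\delta,U^V]=1$ if $n>2$; $[Z,VU]=[\delta,VU]=1$ if $n>3$; $[Z,Z^U]=1$; $[Z,\delta^U]=[\delta,\delta^U]=1$. (ii) Relations stating that $\sigma$ is centralised by: $ZUZ^{-1}$; $U^{V^2}$ if $n>3$; $VUU^V$ if $n>4$; $Z^{V^2}$ and $\delta^{V^2}$ if $n>2$; $\delta\delta^U$. Relations stating that $\tau$ is centralised by: $Z^U$; $U^V$ if $n>2$; $VU$ if $n>3$ and $q$ is even; $Z^2$ if $q$ is odd; $\delta^U$. (iii) Relations that present $\mathrm{SL}(2,q)$ on $\{\sigma,\Delta,U'\}$. (iv) Relations that present $\mathrm{SL}(2,q)$ on $\{\tau,\delta,Z\}$. (v) (a) if $n>2$ then $[\sigma,\sigma^V]=\sigma^{VU}$; (b) if $n>2$ then $[\sigma,\sigma^{VU}]=1$; (c) if $n>2$ then $[\sigma,\sigma^{UV}]=1$; (d) if $n>3$ then $[\sigma,\sigma^{V^2}]=1$; (e) if $q$ is odd then $[\sigma,\sigma^Z]=\tau^{2ZU}$,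 else $[\sigma,\sigma^Z]=1$; (f) $[\sigma,\tau]=1$; (g) $[\sigma,\tau^U]=\sigma^{Z^U}\tau^{-1}$; (h) if $n>2$ then $[\sigma,\tau^{V^2}]=1$; (j) $[\tau,\tau^U]=1$.
   Context: Conventions: $x^y=y^{-1}xy$, $[x,y]=x^{-1}y^{-1}xy$, $x^{ky}=(x^k)^y$ and $x^{-y}=(x^{-1})^y$ for $k$ an integer and $x,y$ group elements (so $\tau^{2ZU}=(\tau^2)^{ZU}$). Linear maps act on the right and fix unmentioned basis vectors. Generators of the presented group are denoted by the same symbols as the corresponding matrices. ''Relations that present (defining relations for) a group on given elements $g_1,\dots,g_k$'' means any set of relators in the free group on $k$ letters whose normal closure is the kernel of the natural map onto $\langle g_1,\dots,g_k\rangle$. Matrices: $\omega$ is a primitive element of $\mathrm{GF}(q)$ and $e_1,f_1,\dots,e_n,f_n$ a hyperbolic basis of the natural module for $\mathrm{Sp}(2n,q)$. $Z=(e_1\mapsto f_1,\ f_1\mapsto-e_1)$; $\delta=(e_1\mapsto\omega^{-1}e_1,\ f_1\mapsto\omega f_1)$; $\tau=(e_1\mapsto e_1+f_1)$; $\sigma=(e_1\mapsto e_1+e_2,\ f_2\mapsto f_2-f_1)$; $U$ interchanges $e_1,e_2$ and $f_1,f_2$; $V=(e_1,\dots,e_n)(f_1,\dots,f_n)$ cyclically permutes the $e_i$ and the $f_i$ (if $n>2$). The matrix group $\langle\sigma,\Delta,U'\rangle$ is a copy of $\mathrm{SL}(2,q)$, acting on $\langle e_1,e_2\rangle$ as $\sigma\mapsto\begin{pmatrix}1&1\\0&1\end{pmatrix}$,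 $\Delta\mapsto\begin{pmatrix}\omega^{-1}&0\\0&\omega\end{pmatrix}$, $U'\mapsto\begin{pmatrix}0&1\\-1&0\end{pmatrix}$; and $\tau,\delta,Z$ act by these same three matrices on $\langle e_1,f_1\rangle$. *)

(* Defs.v *)
From HB Require Import structures.
From mathcomp Require Import all_boot all_order all_fingroup all_algebra.
From mathcomp Require Import generic_quotient boolp classical_sets.

Set Implicit Arguments.
Unset Strict Implicit.
Unset Printing Implicit Defensive.

Import GroupScope GRing.Theory.
Local Open Scope quotient_scope.

(* A word in the letters of X; (x, true) stands for x, (x, false) for x^-1. *)
Notation word X := (seq (X * bool)).

Section FreeGroup.
Variable X : choiceType.
Implicit Types u v w : word X.

Inductive free_eq : word X -> word X -> Prop :=
| free_eq_refl u : free_eq u u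
| free_eq_sym u v : free_eq u v -> free_eq v u
| free_eq_trans u v w : free_eq u v -> free_eq v w -> free_eq u w
| free_eq_cancel u v x b :
    free_eq (u ++ [:: (x, b); (x, ~~ b)] ++ v) (u ++ v).

Definition free_rel : rel (word X) := fun u v => `[< free_eq u v >].

Lemma free_rel_refl : reflexive free_rel.
Proof. by move=> u; apply/asboolP; apply: free_eq_refl. Qed.

Lemma free_rel_sym : symmetric free_rel.
Proof.
by move=> u v; apply/asboolP/asboolP => /free_eq_sym.
Qed.

Lemma free_rel_trans : transitive free_rel.
Proof.
move=> v u w /asboolP uv /asboolP vw; apply/asboolP.
exact: free_eq_trans vw.
Qed.

Canonical free_equiv := EquivRel free_rel free_rel_refl free_rel_sym
  free_rel_trans.

Definition free_group : Type := {eq_quot free_equiv}.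
HB.instance Definition _ := Choice.copy free_group {eq_quot free_equiv}.

Definition free_cls : word X -> free_group := \pi_({eq_quot free_equiv}).
Local Notation cls := free_cls.

Lemma free_clsP u v : reflect (free_eq u v) (cls u == cls v).
Proof. by apply: (iffP idP) => [/eqP/eqmodP/asboolP //|h]; apply/eqP/eqmodP/asboolP. Qed.

Lemma free_cls_repr (a : free_group) : cls (generic_quotient.repr a) = a.
Proof. exact: reprK. Qed.

Lemma free_eq_cat u u' v v' :
  free_eq u u' -> free_eq v v' -> free_eq (u ++ v) (u' ++ v').
Proof.
move=> hu hv; apply: (@free_eq_trans _ (u' ++ v)).
  elim: hu v {hv} => {u u'} [u|u u' _ IH|u u' u'' _ IH1 _ IH2|u u' x b] v.
  - exact: free_eq_refl.
  - exact/free_eq_sym.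
  - exact: free_eq_trans (IH1 v) (IH2 v).
  - by rewrite -!catA; apply: free_eq_cancel.
elim: hv u' {hu} => {v v'} [v|v v' _ IH|v v' v'' _ IH1 _ IH2|v v' x b] w.
- exact: free_eq_refl.
- exact/free_eq_sym.
- exact: free_eq_trans (IH1 w) (IH2 w).
- by rewrite !(catA w); apply: free_eq_cancel.
Qed.

Definition word_inv u : word X := rev [seq (a.1, ~~ a.2) | a <- u].

Lemma word_invK : involutive word_inv.
Proof.
move=> u; rewrite /word_inv map_rev revK -map_comp.
by elim: u => //= -[x b] u ->; rewrite negbK.
Qed.

Lemma word_inv_cat u v : word_inv (u ++ v) = word_inv v ++ word_inv u.
Proof. by rewrite /word_inv map_cat rev_cat. Qed.

Lemma free_eq_inv u v : free_eq u v -> free_eq (word_inv u) (word_inv v).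
Proof.
elim=> {u v} [u|u v _ IH|u v w _ IH1 _ IH2|u v x b].
- exact: free_eq_refl.
- exact/free_eq_sym.
- exact: free_eq_trans IH2.
- rewrite !word_inv_cat -catA [word_inv [:: _; _]]/word_inv /= negbK.
  exact: free_eq_cancel.
Qed.

Lemma free_eq_mulV u : free_eq (word_inv u ++ u) [::].
Proof.
elim: u => [|[x b] u IH]; first exact: free_eq_refl.
apply: free_eq_trans IH; rewrite -cat1s word_inv_cat -!catA catA.
have := free_eq_cancel (word_inv u) u x (~~ b).
by rewrite negbK -!catA.
Qed.

Definition free_one : free_group := cls [::].
Definition free_mul (a b : free_group) : free_group :=
  cls (generic_quotient.repr a ++ generic_quotient.repr b).
Definition free_inv (a : free_group) : free_group := cls (word_inv (generic_quotient.repr a)).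

Lemma free_repr u : free_eq (generic_quotient.repr (cls u)) u.
Proof. by apply/free_clsP; rewrite free_cls_repr. Qed.

Lemma free_mul_cls u v : free_mul (cls u) (cls v) = cls (u ++ v).
Proof.
by apply/eqP/free_clsP; apply: free_eq_cat; apply: free_repr.
Qed.

Lemma free_inv_cls u : free_inv (cls u) = cls (word_inv u).
Proof. by apply/eqP/free_clsP/free_eq_inv/free_repr. Qed.

Lemma free_mulA : associative free_mul.
Proof.
move=> a b c; rewrite -(free_cls_repr a) -(free_cls_repr b) -(free_cls_repr c).
by rewrite !free_mul_cls catA.
Qed.

Lemma free_mul1 : left_id free_one free_mul.
Proof. by move=> a; rewrite -(free_cls_repr a) free_mul_cls. Qed.

Lemma free_mulr1 : right_id free_one free_mul.
Proof. by move=> a; rewrite -(free_cls_repr a) free_mul_cls cats0. Qed.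

Lemma free_mulV : left_inverse free_one free_inv free_mul.
Proof.
move=> a; rewrite -(free_cls_repr a) free_inv_cls free_mul_cls.
by apply/eqP/free_clsP/free_eq_mulV.
Qed.

Lemma free_mulrV : right_inverse free_one free_inv free_mul.
Proof.
move=> a; rewrite -(free_cls_repr a) free_inv_cls free_mul_cls.
apply/eqP/free_clsP; rewrite -{1}[generic_quotient.repr a]word_invK.
exact: free_eq_mulV.
Qed.

HB.instance Definition _ := isGroup.Build free_group
  free_mulA free_mul1 free_mulr1 free_mulV free_mulrV.

Definition letter (x : X) : free_group := cls [:: (x, true)].

Section Lift.
Variables (G : groupType) (g : X -> G).

Definition word_val u : G :=
  foldr (fun a y => (if a.2 then g a.1 else (g a.1)^-1) * y) 1 u.

(* The homomorphism from the free group extending g. *)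
Definition free_lift (a : free_group) : G := word_val (generic_quotient.repr a).

Lemma word_val_cat u v : word_val (u ++ v) = word_val u * word_val v.
Proof. by elim: u => [|a u IH] /=; rewrite ?mul1g // IH mulgA. Qed.

Lemma word_val_eq u v : free_eq u v -> word_val u = word_val v.
Proof.
elim=> {u v} [//|u v _ -> //|u v w _ -> _ -> //|u v x b].
by rewrite !word_val_cat; case: b; rewrite /= mulg1 ?mulgV ?mulVg mul1g.
Qed.

Lemma free_lift_cls u : free_lift (cls u) = word_val u.
Proof. exact/word_val_eq/free_repr. Qed.

Lemma free_liftM : {morph free_lift : a b / a * b}.
Proof. by move=> a b; rewrite -word_val_cat -free_lift_cls. Qed.

Lemma free_lift1 : free_lift 1 = 1.
Proof. exact: free_lift_cls. Qed.

HB.instance Definition _ :=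
  isUMagmaMorphism.Build free_group G free_lift (conj free_lift1 free_liftM).

Lemma free_lift_letter x : free_lift (letter x) = g x.
Proof. by rewrite free_lift_cls /= mulg1. Qed.

End Lift.
End FreeGroup.

Section NormalClosure.
Variable G : groupType.

Record normal_subgroup (N : set G) : Prop := NormalSubgroup {
  normal1 : N 1;
  normalM : forall x y, N x -> N y -> N (x * y);
  normalV : forall x, N x -> N x^-1;
  normalJ : forall x y, N x -> N (x ^ y) }.

Definition normal_closure (R : set G) : set G :=
  fun x => forall N : set G, normal_subgroup N -> (R `<=` N)%classic -> N x.

Lemma normal_closure_normal R : normal_subgroup (normal_closure R).
Proof.
split.
- by move=> N hN _; apply: normal1.
- by move=> x y hx hy N hN RN; apply: (normalM hN); [apply: hx | apply: hy].
- by move=> x hx N hN RN; apply: (normalV hN); apply: hx.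
- by move=> x y hx N hN RN; apply: (normalJ hN); apply: hx.
Qed.

Lemma normal_closure_sub R : (R `<=` normal_closure R)%classic.
Proof. by move=> x Rx N _; apply. Qed.

End NormalClosure.

Section Presented.
Variables (X : choiceType) (R : set (free_group X)).
Implicit Types a b c : free_group X.

Let N := normal_closure R.
Let hN : normal_subgroup N := normal_closure_normal R.

Definition pres_rel : rel (free_group X) := fun a b => `[< N (a^-1 * b) >].

Lemma pres_rel_refl : reflexive pres_rel.
Proof. by move=> a; apply/asboolP; rewrite mulVg; apply: normal1. Qed.

Lemma pres_rel_sym : symmetric pres_rel.
Proof.
by move=> a b; apply/asboolP/asboolP => /(normalV hN); rewrite invgM invgK.
Qed.

Lemma pres_rel_trans : transitive pres_rel.
Proof.
move=> b a c /asboolP ab /asboolP bc; apply/asboolP.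
by have := normalM hN ab bc; rewrite mulgA mulgK.
Qed.

Canonical pres_equiv := EquivRel pres_rel pres_rel_refl pres_rel_sym
  pres_rel_trans.

(* The quotient of the free group on X by the normal closure of R. *)
Definition presented : Type := {eq_quot pres_equiv}.
HB.instance Definition _ := Choice.copy presented {eq_quot pres_equiv}.

Definition pres_proj : free_group X -> presented := \pi_({eq_quot pres_equiv}).
Local Notation cls := pres_proj.

Lemma pres_projP a b : reflect (N (a^-1 * b)) (cls a == cls b).
Proof. by apply: (iffP idP) => [/eqP/eqmodP/asboolP //|h]; apply/eqP/eqmodP/asboolP. Qed.

Lemma pres_proj_repr (x : presented) : cls (generic_quotient.repr x) = x.
Proof. exact: reprK. Qed.

Definition pres_one : presented := cls 1.
Definition pres_mul (x y : presented) : presented :=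
  cls (generic_quotient.repr x * generic_quotient.repr y).
Definition pres_inv (x : presented) : presented :=
  cls (generic_quotient.repr x)^-1.

Lemma pres_repr a : N ((generic_quotient.repr (cls a))^-1 * a).
Proof. by apply/pres_projP; rewrite pres_proj_repr. Qed.

Lemma pres_mul_proj a b : pres_mul (cls a) (cls b) = cls (a * b).
Proof.
apply/eqP/pres_projP; have ha := pres_repr a; have hb := pres_repr b.
move: (generic_quotient.repr _) (generic_quotient.repr _) ha hb => a' b' ha hb.
have := normalM hN hb (normalJ hN b ha).
by rewrite conjgE invgM !mulgA mulgK.
Qed.

Lemma pres_inv_proj a : pres_inv (cls a) = cls a^-1.
Proof.
apply/eqP/pres_projP; have ha := normalV hN (pres_repr a).
move: (generic_quotient.repr _) ha => a' ha; rewrite invgK.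
have := normalJ hN (a'^-1) ha.
by rewrite conjgE !invgM !invgK !mulgA mulgK.
Qed.

Lemma pres_mulA : associative pres_mul.
Proof.
move=> x y z; rewrite -(pres_proj_repr x) -(pres_proj_repr y).
by rewrite -(pres_proj_repr z) !pres_mul_proj mulgA.
Qed.

Lemma pres_mul1 : left_id pres_one pres_mul.
Proof. by move=> x; rewrite -(pres_proj_repr x) pres_mul_proj mul1g. Qed.

Lemma pres_mulr1 : right_id pres_one pres_mul.
Proof. by move=> x; rewrite -(pres_proj_repr x) pres_mul_proj mulg1. Qed.

Lemma pres_mulV : left_inverse pres_one pres_inv pres_mul.
Proof.
by move=> x; rewrite -(pres_proj_repr x) pres_inv_proj pres_mul_proj mulVg.
Qed.

Lemma pres_mulrV : right_inverse pres_one pres_inv pres_mul.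
Proof.
by move=> x; rewrite -(pres_proj_repr x) pres_inv_proj pres_mul_proj mulgV.
Qed.

HB.instance Definition _ := isGroup.Build presented
  pres_mulA pres_mul1 pres_mulr1 pres_mulV pres_mulrV.

Lemma pres_projM : {morph pres_proj : a b / a * b}.
Proof. by move=> a b; rewrite -pres_mul_proj. Qed.

End Presented.

(* R is a set of relators presenting, on the elements g x, the subgroup that
   these elements generate. *)
Definition presents (X : choiceType) (G : groupType)
    (R : set (free_group X)) (g : X -> G) : Prop :=
  forall a : free_group X, normal_closure R a <-> free_lift g a = 1.

Definition isomorphic (G H : groupType) : Prop :=
  exists f : {multiplicative G -> H}, bijective f.

Section Symplectic.
Variables (F : finFieldType) (n : nat).
Local Open Scope ring_scope.

(* The hyperbolic basis e_1, ..., e_n, f_1, ..., f_n is the standard basis of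
   row vectors, in this order; matrices act on the right. *)
Definition sp_form : 'M[F]_(n + n) := block_mx 0 1%:M (- 1%:M) 0.

Definition symplectic (A : 'M[F]_(n + n)) : bool :=
  A *m sp_form *m A^T == sp_form.

Record Sp := SpMx { Sp_val :> 'M[F]_(n + n); SpP : symplectic Sp_val }.

HB.instance Definition _ := [isSub for Sp_val].
HB.instance Definition _ := [Finite of Sp by <:].

Lemma sp_form_sqr : sp_form *m sp_form = - 1%:M.
Proof.
rewrite /sp_form mulmx_block !mul0mx !mulmx0 !mul1mx !mulmx1 !addr0 !add0r.
by rewrite [X in _ = - X](@scalar_mx_block _ n n) opp_block_mx !oppr0.
Qed.

Definition sp_inv_mx (A : 'M[F]_(n + n)) : 'M[F]_(n + n) :=
  - (sp_form *m A^T *m sp_form).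

Lemma mul_sp_inv_mx A : symplectic A -> A *m sp_inv_mx A = 1%:M.
Proof.
by move/eqP=> hA; rewrite mulmxN !mulmxA hA sp_form_sqr opprK.
Qed.

Lemma mul_sp_inv_mxl A : symplectic A -> sp_inv_mx A *m A = 1%:M.
Proof. by move=> hA; apply: mulmx1C; apply: mul_sp_inv_mx. Qed.

Lemma symplectic1 : symplectic 1%:M.
Proof. by rewrite /symplectic mul1mx trmx1 mulmx1. Qed.

Lemma symplecticM A B : symplectic A -> symplectic B -> symplectic (A *m B).
Proof.
move=> /eqP hA /eqP hB; rewrite /symplectic trmx_mul.
by rewrite -!mulmxA !(mulmxA B) !(mulmxA (B *m _)) hB mulmxA hA.
Qed.

Lemma symplecticV A : symplectic A -> symplectic (sp_inv_mx A).
Proof.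
move=> hA; have h := mul_sp_inv_mxl hA; rewrite /symplectic.
rewrite -{1}(eqP hA) !mulmxA h mul1mx -!mulmxA.
by rewrite -trmx_mul h trmx1 mulmx1.
Qed.

Definition sp_one := SpMx symplectic1.
Definition sp_mul (A B : Sp) := SpMx (symplecticM (SpP A) (SpP B)).
Definition sp_inv (A : Sp) := SpMx (symplecticV (SpP A)).

Lemma sp_mulA : associative sp_mul.
Proof. by move=> A B C; apply: val_inj; rewrite /= mulmxA. Qed.
Lemma sp_mul1 : left_id sp_one sp_mul.
Proof. by move=> A; apply: val_inj; rewrite /= mul1mx. Qed.
Lemma sp_mulr1 : right_id sp_one sp_mul.
Proof. by move=> A; apply: val_inj; rewrite /= mulmx1. Qed.
Lemma sp_mulV : left_inverse sp_one sp_inv sp_mul.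
Proof. by move=> A; apply: val_inj; apply: mul_sp_inv_mxl (SpP A). Qed.
Lemma sp_mulrV : right_inverse sp_one sp_inv sp_mul.
Proof. by move=> A; apply: val_inj; apply: mul_sp_inv_mx (SpP A). Qed.

HB.instance Definition _ := isGroup.Build Sp
  sp_mulA sp_mul1 sp_mulr1 sp_mulV sp_mulrV.

Definition eidx (i : 'I_n) : 'I_(n + n) := lshift n i.
Definition fidx (i : 'I_n) : 'I_(n + n) := rshift n i.
Definition evec (i : 'I_n) : 'rV[F]_(n + n) := delta_mx 0 (eidx i).
Definition fvec (i : 'I_n) : 'rV[F]_(n + n) := delta_mx 0 (fidx i).

Fixpoint basis_image (s : seq ('I_(n + n) * 'rV[F]_(n + n))) k :=
  if s is (i, v) :: s' then if k == i then v else basis_image s' k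
  else delta_mx 0 k.

(* The linear map sending the i-th basis vector to v for each (i, v) in s, and
   fixing the other basis vectors. *)
Definition basis_map s : 'M[F]_(n + n) :=
  \matrix_(k < n + n) basis_image s k.

Definition sp_bil (u v : 'rV[F]_(n + n)) : F := (u *m sp_form *m v^T) 0 0.

Lemma sp_bilDl u v w : sp_bil (u + v) w = sp_bil u w + sp_bil v w.
Proof. by rewrite /sp_bil !mulmxDl mxE. Qed.
Lemma sp_bilDr u v w : sp_bil w (u + v) = sp_bil w u + sp_bil w v.
Proof. by rewrite /sp_bil linearD /= mulmxDr mxE. Qed.
Lemma sp_bilZl a u w : sp_bil (a *: u) w = a * sp_bil u w.
Proof. by rewrite /sp_bil -!scalemxAl mxE. Qed.
Lemma sp_bilZr a u w : sp_bil w (a *: u) = a * sp_bil w u.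
Proof. by rewrite /sp_bil linearZ /= -scalemxAr mxE. Qed.
Lemma sp_bilNl u w : sp_bil (- u) w = - sp_bil u w.
Proof. by rewrite -scaleN1r sp_bilZl mulN1r. Qed.
Lemma sp_bilNr u w : sp_bil w (- u) = - sp_bil w u.
Proof. by rewrite -scaleN1r sp_bilZr mulN1r. Qed.

Lemma sp_bil_delta k l : sp_bil (delta_mx 0 k) (delta_mx 0 l) = sp_form k l.
Proof. by rewrite /sp_bil -rowE trmx_delta -colE !mxE. Qed.

Lemma sp_bil_ee i j : sp_bil (evec i) (evec j) = 0.
Proof. by rewrite sp_bil_delta block_mxEul mxE. Qed.
Lemma sp_bil_ef i j : sp_bil (evec i) (fvec j) = (i == j)%:R.
Proof. by rewrite sp_bil_delta block_mxEur mxE. Qed.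
Lemma sp_bil_fe i j : sp_bil (fvec i) (evec j) = - (i == j)%:R.
Proof. by rewrite sp_bil_delta block_mxEdl !mxE. Qed.
Lemma sp_bil_ff i j : sp_bil (fvec i) (fvec j) = 0.
Proof. by rewrite sp_bil_delta block_mxEdr mxE. Qed.

Definition sp_bilE := (sp_bilDl, sp_bilDr, sp_bilZl, sp_bilZr, sp_bilNl,
  sp_bilNr, sp_bil_ee, sp_bil_ef, sp_bil_fe, sp_bil_ff).

Lemma symplecticP A :
  (forall k l, sp_bil (row k A) (row l A) =
     sp_bil (delta_mx 0 k) (delta_mx 0 l)) -> symplectic A.
Proof.
move=> h; apply/eqP/matrixP=> k l; rewrite -sp_bil_delta -h /sp_bil -row_mul.
move: (A *m sp_form) => B; rewrite !mxE.
by apply: eq_bigr => j _; rewrite !mxE.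
Qed.

Lemma symplectic_basis_map s :
  (forall i j, [&& sp_bil (basis_image s (eidx i)) (basis_image s (eidx j)) == 0,
     sp_bil (basis_image s (eidx i)) (basis_image s (fidx j)) == (i == j)%:R,
     sp_bil (basis_image s (fidx i)) (basis_image s (eidx j)) == - (i == j)%:R
   & sp_bil (basis_image s (fidx i)) (basis_image s (fidx j)) == 0]) ->
  symplectic (basis_map s).
Proof.
move=> h; apply: symplecticP => k l; rewrite !rowK.
case: (split_ordP k) => i ->; case: (split_ordP l) => j ->;
  have /and4P[/eqP h1 /eqP h2 /eqP h3 /eqP h4] := h i j.
- by rewrite h1 sp_bil_ee.
- by rewrite h2 sp_bil_ef.
- by rewrite h3 sp_bil_fe.
- by rewrite h4 sp_bil_ff.
Qed.

End Symplectic.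

Section Generators.
Variables (F : finFieldType) (w : {unit F}) (n : nat) (hn : (1 < n)%N).
Local Open Scope ring_scope.

Definition ix1 : 'I_n := Ordinal (ltnW hn).
Definition ix2 : 'I_n := Ordinal hn.

Local Notation ie1 := (eidx ix1).
Local Notation ie2 := (eidx ix2).
Local Notation if1 := (fidx ix1).
Local Notation if2 := (fidx ix2).
Local Notation e1 := (evec F ix1).
Local Notation e2 := (evec F ix2).
Local Notation f1 := (fvec F ix1).
Local Notation f2 := (fvec F ix2).

Definition mx_Z := basis_map [:: (ie1, f1); (if1, - e1)].
Definition mx_delta :=
  basis_map [:: (ie1, (val w)^-1 *: e1); (if1, val w *: f1)].
Definition mx_tau := basis_map [:: (ie1, e1 + f1)].
Definition mx_sigma := basis_map [:: (ie1, e1 + e2); (if2, f2 - f1)].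
Definition mx_U :=
  basis_map [:: (ie1, e2); (ie2, e1); (if1, f2); (if2, f1)].

Lemma eix_eq (i j : 'I_n) : (eidx i == eidx j) = (i == j).
Proof. exact/inj_eq/lshift_inj. Qed.
Lemma fix_eq (i j : 'I_n) : (fidx i == fidx j) = (i == j).
Proof. exact/inj_eq/rshift_inj. Qed.
Lemma eix_fix (i j : 'I_n) : (eidx i == fidx j) = false.
Proof. exact: eq_lrshift. Qed.
Lemma fix_eix (i j : 'I_n) : (fidx i == eidx j) = false.
Proof. exact: eq_rlshift. Qed.
Lemma ix12 : (ix1 == ix2) = false. Proof. by []. Qed.
Lemma ix21 : (ix2 == ix1) = false. Proof. by []. Qed.

Lemma w_neq0 : val w != 0 :> F.
Proof. by rewrite -unitfE; apply: (valP w). Qed.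

Definition ixE := (eix_eq, fix_eq, eix_fix, fix_eix).

Fact generators_symplectic :
  [/\ symplectic mx_Z, symplectic mx_delta, symplectic mx_tau,
      symplectic mx_sigma & symplectic mx_U].
Proof.
split; apply: symplectic_basis_map => i j; rewrite /= !ixE;
  rewrite -/(evec F i) -/(fvec F i) -/(evec F j) -/(fvec F j);
  have := w_neq0; have := ix12; have := ix21;
  move: ix1 ix2 => k1 k2 h21 h12 w0;
  case: (eqVneq i k1) => [ei1|/negPf hi1]; try subst i;
  case: (eqVneq j k1) => [ej1|/negPf hj1]; try subst j; rewrite ?h12 ?h21;
  try (case: (eqVneq i k2) => [ei2|/negPf hi2]; try subst i);
  try (case: (eqVneq j k2) => [ej2|/negPf hj2]; try subst j);
  rewrite ?sp_bilE ?eqxx ?h12 ?h21 ?(eq_sym k1) ?(eq_sym k2)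
    ?hi1 ?hj1 ?hi2 ?hj2;
  rewrite ?(oppr0, mulr0, mul0r, addr0, add0r, mulr1, mulrN, subrr, addNr, opprK);
  rewrite ?(mulVf, mulfV) ?oppr0 ?eqxx //.
Qed.

End Generators.

Section SpGenerators.
Variables (F : finFieldType) (w : {unit F}) (n : nat) (hn : (1 < n)%N).

Definition sp_Z : Sp F n :=
  SpMx (let: And5 h _ _ _ _ := generators_symplectic 1 hn in h).
Definition sp_delta : Sp F n :=
  SpMx (let: And5 _ h _ _ _ := generators_symplectic w hn in h).
Definition sp_tau : Sp F n :=
  SpMx (let: And5 _ _ h _ _ := generators_symplectic 1 hn in h).
Definition sp_sigma : Sp F n :=
  SpMx (let: And5 _ _ _ h _ := generators_symplectic 1 hn in h).
Definition sp_U : Sp F n :=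
  SpMx (let: And5 _ _ _ _ h := generators_symplectic 1 hn in h).

End SpGenerators.

(* Delta and U', in the matrix group and in the free group alike. *)
Definition Delta_of (G : groupType) (U delta : G) : G := [~ U, delta].
Definition Uprime_of (G : groupType) (q : nat) (U Z : G) : G :=
  if odd q then U * Z ^+ 2 else U.

(* The generators of S_n and of G; V exists only when n > 2. *)
Inductive sym_gen (n : nat) : Type := SymU | SymV of (2 < n)%N.
HB.instance Definition _ n := gen_eqMixin (sym_gen n).
HB.instance Definition _ n := gen_choiceMixin (sym_gen n).

Inductive sp_gen (n : nat) : Type :=
  GenSigma | GenTau | GenDelta | GenZ | GenU | GenV of (2 < n)%N.
HB.instance Definition _ n := gen_eqMixin (sp_gen n).
HB.instance Definition _ n := gen_choiceMixin (sp_gen n).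

Definition sym_perm (n : nat) (hn : (1 < n)%N) (x : sym_gen n) : 'S_n :=
  match x with
  | SymU => tperm (ix1 hn) (ix2 hn)
  | SymV _ => perm (@ordS_inj n)
  end.

Definition triple (G : Type) (a b c : G) (i : 'I_3) : G := tnth [tuple a; b; c] i.

(* When w is primitive these triples generate copies of SL(2, #|F|): with
   respect to e_1, e_2, respectively e_1, f_1, they act as the matrices
     (1 1; 0 1), (w^-1 0; 0 w), (0 1; -1 0). *)
Definition sl2_sigma (F : finFieldType) (w : {unit F}) n (hn : (1 < n)%N) :
    'I_3 -> Sp F n :=
  triple (sp_sigma F hn) (Delta_of (sp_U F hn) (sp_delta w hn))
    (Uprime_of #|F| (sp_U F hn) (sp_Z F hn)).

Definition sl2_tau (F : finFieldType) (w : {unit F}) n (hn : (1 < n)%N) :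
    'I_3 -> Sp F n :=
  triple (sp_tau F hn) (sp_delta w hn) (sp_Z F hn).

Section Relators.
Variables (n q : nat).
Variables (Rsym : set (free_group (sym_gen n))) (Rsigma Rtau : set (free_group 'I_3)).

Local Notation s := (letter (GenSigma n)).
Local Notation t := (letter (GenTau n)).
Local Notation d := (letter (GenDelta n)).
Local Notation Z := (letter (GenZ n)).
Local Notation U := (letter (GenU n)).
Local Notation V h := (letter (GenV h)).

Definition sym_letter (x : sym_gen n) : free_group (sp_gen n) :=
  match x with SymU => U | SymV h => V h end.

(* A relation x = y is the relator x * y^-1, and "x is centralised by y" is the
   relator [~ x, y]. *)
Inductive relators : set (free_group (sp_gen n)) :=
| rel_i_sym r of Rsym r : relators (free_lift sym_letter r)
| rel_i_Z_UV (h : (2 < n)%N) : relators [~ Z, U ^ V h]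
| rel_i_d_UV (h : (2 < n)%N) : relators [~ d, U ^ V h]
| rel_i_Z_VU (h : (2 < n)%N) of (3 < n)%N : relators [~ Z, V h * U]
| rel_i_d_VU (h : (2 < n)%N) of (3 < n)%N : relators [~ d, V h * U]
| rel_i_Z_ZU : relators [~ Z, Z ^ U]
| rel_i_Z_dU : relators [~ Z, d ^ U]
| rel_i_d_dU : relators [~ d, d ^ U]

| rel_ii_s_ZU : relators [~ s, Z * U * Z^-1]
| rel_ii_s_UV2 (h : (2 < n)%N) of (3 < n)%N : relators [~ s, U ^ (V h ^+ 2)]
| rel_ii_s_VUUV (h : (2 < n)%N) of (4 < n)%N :
    relators [~ s, V h * U * U ^ V h]
| rel_ii_s_ZV2 (h : (2 < n)%N) : relators [~ s, Z ^ (V h ^+ 2)]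
| rel_ii_s_dV2 (h : (2 < n)%N) : relators [~ s, d ^ (V h ^+ 2)]
| rel_ii_s_ddU : relators [~ s, d * d ^ U]
| rel_ii_t_ZU : relators [~ t, Z ^ U]
| rel_ii_t_UV (h : (2 < n)%N) : relators [~ t, U ^ V h]
| rel_ii_t_VU (h : (2 < n)%N) of (3 < n)%N & ~~ odd q :
    relators [~ t, V h * U]
| rel_ii_t_Z2 of odd q : relators [~ t, Z ^+ 2]
| rel_ii_t_dU : relators [~ t, d ^ U]

| rel_iii r of Rsigma r :
    relators (free_lift (triple s (Delta_of U d) (Uprime_of q U Z)) r)
| rel_iv r of Rtau r : relators (free_lift (triple t d Z) r)

| rel_v_a (h : (2 < n)%N) : relators ([~ s, s ^ V h] * (s ^ (V h * U))^-1)
| rel_v_b (h : (2 < n)%N) : relators [~ s, s ^ (V h * U)]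
| rel_v_c (h : (2 < n)%N) : relators [~ s, s ^ (U * V h)]
| rel_v_d (h : (2 < n)%N) of (3 < n)%N : relators [~ s, s ^ (V h ^+ 2)]
| rel_v_e_odd of odd q : relators ([~ s, s ^ Z] * ((t ^+ 2) ^ (Z * U))^-1)
| rel_v_e_even of ~~ odd q : relators [~ s, s ^ Z]
| rel_v_f : relators [~ s, t]
| rel_v_g : relators ([~ s, t ^ U] * (s ^ (Z ^ U) * t^-1)^-1)
| rel_v_h (h : (2 < n)%N) : relators [~ s, t ^ (V h ^+ 2)]
| rel_v_j : relators [~ t, t ^ U].

End Relators.

(* Main.v *)
Require Import Defs.
From HB Require Import structures.
From mathcomp Require Import all_boot all_order all_fingroup all_algebra.
From mathcomp Require Import boolp classical_sets.
From mathcomp Require Import ring.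
From mathcomp Require Import finfield.

Set Implicit Arguments.
Unset Strict Implicit.
Unset Printing Implicit Defensive.

Import GroupScope.
Import GRing.Theory.

(** The relators hold in Sp(2n,q), so the presented group G maps to it; write phi
for this map.  It has to be shown that phi is bijective, for a group G that
might a priori be infinite.

Permutations.  Words in U and V that give the same permutation are equal in
G, so G contains a copy of S_n.  The relations say that Z, delta and tau
commute with generators of the stabiliser of the first index, and sigma with
generators of the stabiliser of the first two.  Conjugation by S_n therefore
gives well-defined elements z_i, d_i, t_i and x_ij of G (gz, gd, gt, gx
below), and each relation between a few indices holds for all indices.  The
exception is tau for odd q, which is only assumed to commute with U^V: but
tau^2 is a commutator of elements that commute with the stabiliser of the
first two indices, and tau is a power of tau^2 because tau has odd order
(t_fix).  All that is used of G from there on is collected in the record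
sp_system, built for G in presented_system.

Root subgroups.  The two presentations of SL(2,q) provide subgroups of G on
which phi is faithful.  The long root subgroups R i lie in one of them.  For
the short roots put y_ij = x_ij^(z_j).  In SL(2,q) one has z = t t^z t;
conjugating x_ij by both sides for the index j leads to y_ij^(z_j) = x_ij^-1
(yz).  Then the conjugates of x_ij and y_ij by even powers of d_j
generate, with R i as a central subgroup, a group that is normalised by z_j and
by the conjugates of t_j under powers of d_j.  As d_j is a product of such
elements, it normalises this group too; this puts x_ij^(d_j) into the group
generated by the conjugates of x_ij by even powers (M0_xd).  Hence there are
short root subgroups M i j of order q, with Steinberg's commutator relations.

Induction.  For a set J of indices let L J be the subgroup of G that belongs
to the indices in J, and for i outside J let Q i J J be generated by the
root elements that involve i and fix the vector f_i.  The commutator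
relations give a normal form in Q i J J, so phi is faithful there, and an
element of it is determined by its image of e_i (Q_faithful).  If j is in J,
and K is the product of <d_i> and L J, then the product set K Q Q^(z_i) Q is
closed under right multiplication by the generators of L (i |: J): the only
one that needs an argument exchanges the indices i and j up to sign, and is
dealt with by the Bruhat decomposition of a short root SL(2,q) (cells_U).
An element k q1 v q2 of this set in the kernel of phi fixes f_i, which
forces v = 1 and the torus part of k to be trivial; it fixes e_i, which
forces q1 q2 = 1; and then it lies in L J (step_faithful).  So phi is
injective on L J for every J, in particular on G.

Surjectivity follows from the same subgroups: L J is transitive on the
non-zero vectors with support in J (L_trans) and Q on the candidates for the
image of e_i when f_i is fixed (Q_trans), so that every symplectic matrix can
be multiplied into one that fixes e_i and f_i as well (supported_onto). *)

(** * Homomorphisms and subgroups of possibly infinite groups *)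

Section Homomorphisms.
Variables (G H : groupType) (f : G -> H).
Hypothesis fM : {morph f : x y / x * y}.

Lemma hom1 : f 1 = 1.
Proof. by apply: (mulgI (f 1)); rewrite -fM !mulg1. Qed.
Lemma homV x : f x^-1 = (f x)^-1.
Proof. by apply: (mulgI (f x)); rewrite -fM !mulgV hom1. Qed.
Lemma homJ x y : f (x ^ y) = f x ^ f y.
Proof. by rewrite !conjgE !fM homV. Qed.
Lemma homR x y : f [~ x, y] = [~ f x, f y].
Proof. by rewrite !commgEl fM homV homJ. Qed.
Lemma homX x m : f (x ^+ m) = f x ^+ m.
Proof. by elim: m => [|m IH]; rewrite ?expg0 ?hom1 // !expgS fM IH. Qed.

End Homomorphisms.

Section Subgroups.
Variable G : groupType.
Implicit Types (H K A B : G -> Prop) (x y g h : G).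

Definition subgrp H :=
  [/\ H 1, forall x y, H x -> H y -> H (x * y) & forall x, H x -> H x^-1].

Inductive gen A : G -> Prop :=
| gen_one : gen A 1
| gen_in a of A a : gen A a
| gen_mul x y of gen A x & gen A y : gen A (x * y)
| gen_inv x of gen A x : gen A x^-1.

(** Both inclusions are asked for, because the groups may be infinite; for an
   element of finite order the first one suffices, see nrm_torsion. *)
Definition nrm H g :=
  (forall h, H h -> H (h ^ g)) /\ (forall h, H h -> H (h ^ g^-1)).

Definition prodS H K x := exists h k, [/\ H h, K k & x = h * k].

Definition torsion g := exists2 N, (0 < N)%N & g ^+ N = 1.

Lemma sub1 H : subgrp H -> H 1. Proof. by case. Qed.
Lemma subM H : subgrp H -> forall x y, H x -> H y -> H (x * y).
Proof. by case. Qed.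
Lemma subV H : subgrp H -> forall x, H x -> H x^-1.
Proof. by case. Qed.
Lemma subJ H : subgrp H -> forall x y, H x -> H y -> H (x ^ y).
Proof. by case=> h1 hM hV x y hx hy; exact: hM (hV _ hy) (hM _ _ hx hy). Qed.
Lemma subX H : subgrp H -> forall k x, H x -> H (x ^+ k).
Proof.
move=> hH k x hx; elim: k => [|k IH]; first exact: sub1.
by rewrite expgS; apply: subM.
Qed.

Lemma gen_sub A : subgrp (gen A).
Proof. by split; [exact: gen_one | exact: gen_mul | exact: gen_inv]. Qed.

Lemma gen_min A H : subgrp H -> (forall a, A a -> H a) -> forall x, gen A x -> H x.
Proof. by move=> [h1 hM hV] hA x; elim=> *; auto. Qed.

Lemma genS A B x : (forall a, A a -> gen B a) -> gen A x -> gen B x.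
Proof. by move=> h; apply: gen_min => //; apply: gen_sub. Qed.

Lemma subgrpJ H g : subgrp H -> subgrp (fun x => H (x ^ g)).
Proof.
case=> h1 hM hV; split=> [|x y hx hy|x hx]; rewrite ?conj1g ?conjMg ?conjVg //.
- exact: hM.
- exact: hV.
Qed.

Lemma gen_conj A H g : subgrp H -> (forall a, A a -> H (a ^ g)) ->
  forall x, gen A x -> H (x ^ g).
Proof. by move=> hH hA; apply: gen_min => //; apply: subgrpJ. Qed.

Lemma nrmJ H g h : nrm H g -> H h -> H (h ^ g).
Proof. by case=> ng _ /ng. Qed.
Lemma nrmJV H g h : nrm H g -> H h -> H (h ^ g^-1).
Proof. by case=> _ ng /ng. Qed.

Lemma nrm_sub H : subgrp (nrm H).
Proof.
split=> [|g1 g2 n1 n2|g1 n1].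
- by split=> h hh; rewrite ?invg1 conjg1.
- split=> h hh; rewrite ?invgM conjgM.
    by apply: (nrmJ n2); apply: (nrmJ n1).
  by apply: (nrmJV n1); apply: (nrmJV n2).
- split=> h hh; last by rewrite invgK; apply: nrmJ.
  exact: nrmJV.
Qed.

Lemma nrm_in H g : subgrp H -> H g -> nrm H g.
Proof.
by move=> hH hg; split=> h hh; apply: subJ => //; apply: subV.
Qed.

Lemma nrm_torsion H g : torsion g -> (forall h, H h -> H (h ^ g)) -> nrm H g.
Proof.
case=> -[//|N] _ gN hg; split=> // h hh.
have -> : g^-1 = g ^+ N.
  by apply: (mulgI g); rewrite mulgV -expgS gN.
elim: N {gN} => [|N IH]; first by rewrite expg0 conjg1.
by rewrite expgSr conjgM; apply: hg.
Qed.

Lemma nrm_gen A g : torsion g -> (forall a, A a -> gen A (a ^ g)) ->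
  nrm (gen A) g.
Proof.
move=> tg hA; apply: nrm_torsion => // h; apply: gen_conj => //.
exact: gen_sub.
Qed.

Lemma torsionJ g h : torsion g -> torsion (g ^ h).
Proof. by case=> N N0 gN; exists N => //; rewrite -conjXg gN conj1g. Qed.

Lemma prodS_sub H K : subgrp H -> subgrp K -> (forall h, H h -> nrm K h) ->
  subgrp (prodS H K).
Proof.
move=> hH hK hn; split.
- by exists 1, 1; rewrite mulg1; split=> //; apply: sub1.
- move=> _ _ [h [k [hh hk ->]]] [h' [k' [hh' hk' ->]]].
  exists (h * h'), (k ^ h' * k'); split; first exact: subM.
    by apply: subM => //; apply: nrmJ => //; apply: hn.
  by rewrite conjgE !mulgA mulgK.
- move=> _ [h [k [hh hk ->]]]; exists h^-1, (k^-1 ^ h^-1); split.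
  + exact: subV.
  + by apply: nrmJV; [apply: hn | apply: subV].
  + by rewrite conjgE invgK invgM !mulgA mulVg mul1g.
Qed.

Lemma prodS_l H K h : subgrp K -> H h -> prodS H K h.
Proof. by move=> hK hh; exists h, 1; rewrite mulg1; split=> //; apply: sub1. Qed.
Lemma prodS_r H K k : subgrp H -> K k -> prodS H K k.
Proof. by move=> hH hk; exists 1, k; rewrite mul1g; split=> //; apply: sub1. Qed.

Lemma nrm_prodS H K g : nrm H g -> nrm K g -> nrm (prodS H K) g.
Proof.
move=> nH nK; split=> _ [h [k [hh hk ->]]]; rewrite conjMg.
  by exists (h ^ g), (k ^ g); split=> //; apply: nrmJ.
by exists (h ^ g^-1), (k ^ g^-1); split=> //; apply: nrmJV.
Qed.

(* Centralisers, written in the form in which they are used for rewriting. *)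
Lemma cent_sub x : subgrp (fun g => x ^ g = x).
Proof.
split=> [|g h hg hh|g hg]; first exact: conjg1.
- by rewrite conjgM hg.
- by rewrite -{1}hg conjgK.
Qed.

Lemma fix_sub g : subgrp (fun x => x ^ g = x).
Proof.
split=> [|x y hx hy|x hx]; first exact: conj1g.
- by rewrite conjMg hx hy.
- by rewrite conjVg hx.
Qed.

Lemma conj_comm x y : x * y = y * x -> x ^ y = x.
Proof. by move=> h; rewrite conjgE h mulKg. Qed.
Lemma comm_conj x y : x ^ y = x -> x * y = y * x.
Proof. by move=> h; rewrite conjgC h. Qed.
Lemma conj_sym x y : x ^ y = x -> y ^ x = y.
Proof. by move=> h; apply: conj_comm; rewrite (comm_conj h). Qed.
Lemma conjV_fix x y : x ^ y = x -> x ^ y^-1 = x.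
Proof. by move=> h; rewrite -{1}h conjgK. Qed.
Lemma conjX_fix x y k : x ^ y = x -> x ^ (y ^+ k) = x.
Proof.
move=> h; elim: k => [|k IH]; first by rewrite conjg1.
by rewrite expgSr conjgM IH.
Qed.
Lemma commg_fix x y : [~ x, y] = 1 <-> x ^ y = x.
Proof.
rewrite commgEl; split=> [h|->]; last by rewrite mulVg.
by rewrite -[LHS](mulKg x^-1) invgK h mulg1.
Qed.
Lemma commg_conj x y c : [~ x, y] = c <-> x ^ y = x * c.
Proof. by rewrite commgEl; split=> [<-|->]; rewrite ?mulKg ?mulKVg ?mulVKg. Qed.

(** If the commutators of A and B are in K and A, B centralise K, then the
   commutator is multiplicative in each argument, so that generators suffice. *)
Lemma comm_gen A B K : subgrp K -> (forall a k, A a -> K k -> k ^ a = k) ->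
  (forall b k, B b -> K k -> k ^ b = k) ->
  (forall a b, A a -> B b -> exists2 h, K h & b ^ a = b * h) ->
  forall a b, gen A a -> gen B b -> exists2 h, K h & b ^ a = b * h.
Proof.
move=> hK hA hB hAB.
pose cK g := forall k, K k -> k ^ g = k.
have step1 a b : A a -> gen B b -> cK b /\ exists2 h, K h & b ^ a = b * h.
  move=> ha; move: b; apply: gen_min => [|b hb]; last first.
    by split; [move=> k; apply: hB | apply: hAB].
  split=> [|x y [cx [h hh e]] [cy [h' hh' e']]|x [cx [h hh e]]].
  - split=> [k _|]; first exact: conjg1.
    by exists 1; [exact: sub1 | rewrite conj1g mulg1].
  - split=> [k hk|]; first by rewrite conjgM cx ?cy.
    exists (h * h'); first exact: subM.
    by rewrite conjMg e e' !mulgA -[x * h * y]mulgA [h * y]conjgC cy // !mulgA.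
  - split=> [k hk|]; first by apply: conjV_fix; apply: cx.
    exists h^-1; first exact: subV.
    by rewrite conjVg e invgM conjgCV invgK -{1}(cx h^-1) ?conjgK //; apply: subV.
move=> a b ha hb; suff [_] : cK a /\ exists2 h, K h & b ^ a = b * h by [].
move: a ha; apply: gen_min => [|a ha]; last first.
  by split; [move=> k; apply: hA | have [] := step1 a b ha hb].
split=> [|x y [cx [h hh e]] [cy [h' hh' e']]|x [cx [h hh e]]].
- split=> [k _|]; first exact: conjg1.
  by exists 1; [exact: sub1 | rewrite conjg1 mulg1].
- split=> [k hk|]; first by rewrite conjgM cx ?cy.
  exists (h' * h); first exact: subM.
  by rewrite conjgM e conjMg e' cy // mulgA.
- split=> [k hk|]; first by apply: conjV_fix; apply: cx.
  exists h^-1; first exact: subV.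
  have hV : h ^ x^-1 = h by apply: conjV_fix; apply: cx.
  by rewrite -[in RHS](conjgK x b) e conjMg hV mulgK.
Qed.

Lemma swap_comm (a b c : G) : a ^ b = a * c -> b ^ a = b * c^-1.
Proof.
move=> e; have ba : b * a = a * b * c^-1 by rewrite [a * b]conjgC e !mulgA mulgK.
by apply: (mulgI a); rewrite -(conjgC b a) ba -mulgA.
Qed.

End Subgroups.

(** * Symplectic matrices in coordinates *)

(** Matrices are compared through the coordinates of the images of an arbitrary
   row vector: identities between words in the generators become polynomial
   identities, once the equalities between indices have been decided. *)

Section Coordinates.
Variables (F : finFieldType) (n : nat).
Local Open Scope ring_scope.
Implicit Types (v u : 'rV[F]_(n + n)) (g h : Sp F n) (i j k : 'I_n).

Definition ec v k := v 0 (eidx k).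
Definition fc v k := v 0 (fidx k).
Definition vact v g := v *m (g : 'M_(n + n)).

Lemma actM v g h : vact v (g * h)%g = vact (vact v g) h.
Proof. exact: mulmxA. Qed.
Lemma act1 v : vact v 1%g = v.
Proof. exact: mulmx1. Qed.
Lemma actK v g : vact (vact v g) g^-1%g = v.
Proof. by rewrite -actM mulgV act1. Qed.
Lemma actKV v g : vact (vact v g^-1%g) g = v.
Proof. by rewrite -actM mulVg act1. Qed.

Lemma coordP u v : (forall k, ec u k = ec v k /\ fc u k = fc v k) -> u = v.
Proof.
move=> h; apply/rowP=> k.
by case: (split_ordP k) => i ->; have [] := h i.
Qed.

Lemma act_inj g h : (forall v, vact v g = vact v h) -> g = h.
Proof.
move=> e; apply: val_inj; apply/row_matrixP => k.
by rewrite !rowE; apply: e.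
Qed.

Lemma spP g h : (forall v k, ec (vact v g) k = ec (vact v h) k
  /\ fc (vact v g) k = fc (vact v h) k) -> g = h.
Proof. by move=> e; apply: act_inj => v; apply: coordP. Qed.

(** basis_map s is the identity plus a sum of matrices of rank one. *)
Lemma mul_basis_map (s : seq ('I_(n + n) * 'rV[F]_(n + n))) v :
  uniq (unzip1 s) ->
  v *m basis_map s = v + \sum_(x <- s) v 0 x.1 *: (x.2 - delta_mx 0 x.1).
Proof.
elim: s => [|[i y] s IH] /= => [_|/andP[si us]].
  rewrite big_nil addr0; have -> : basis_map [::] = 1%:M :> 'M[F]_(n + n).
    by apply/row_matrixP => k; rewrite rowK row1.
  by rewrite mulmx1.
rewrite big_cons /= addrCA -IH // addrC.
have -> : basis_map ((i, y) :: s) = basis_map s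
    + delta_mx i 0 *m (y - delta_mx 0 i) :> 'M[F]_(n + n).
  apply/row_matrixP => k; rewrite linearD /= !rowK row_mul rowE.
  rewrite mul_delta_mx_cond; case: (eqVneq k i) => [->|ki] /=.
    have -> : basis_image s i = delta_mx 0 i.
      elim: s si {IH us} => //= -[i' y'] s IH.
      by rewrite inE negb_or => /andP[/negPf -> /IH ->].
    rewrite eqxx mulr1n; have -> : delta_mx 0 0 = 1%:M :> 'M[F]_1.
      by apply/matrixP => a b; rewrite !ord1 !mxE.
    by rewrite mul1mx addrC subrK.
  by rewrite (negPf ki) mulr0n mul0mx addr0.
rewrite mulmxDr; congr (_ + _); rewrite mulmxA -colE.
apply/rowP => l; rewrite !mxE big_ord_recl big_ord0 addr0.
by rewrite !mxE.
Qed.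

Lemma ecD u v k : ec (u + v) k = ec u k + ec v k. Proof. exact: mxE. Qed.
Lemma fcD u v k : fc (u + v) k = fc u k + fc v k. Proof. exact: mxE. Qed.
Lemma ecN v k : ec (- v) k = - ec v k. Proof. exact: mxE. Qed.
Lemma fcN v k : fc (- v) k = - fc v k. Proof. exact: mxE. Qed.
Lemma ecZ a v k : ec (a *: v) k = a * ec v k. Proof. exact: mxE. Qed.
Lemma fcZ a v k : fc (a *: v) k = a * fc v k. Proof. exact: mxE. Qed.
Lemma ec_e i k : ec (evec F i) k = (k == i)%:R.
Proof. by rewrite /ec mxE eqxx eix_eq. Qed.
Lemma ec_f i k : ec (fvec F i) k = 0.
Proof. by rewrite /ec mxE eqxx eix_fix. Qed.
Lemma fc_e i k : fc (evec F i) k = 0.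
Proof. by rewrite /fc mxE eqxx fix_eix. Qed.
Lemma fc_f i k : fc (fvec F i) k = (k == i)%:R.
Proof. by rewrite /fc mxE eqxx fix_eq. Qed.
Lemma ec0 k : ec (0 : 'rV[F]_(n + n)) k = 0. Proof. exact: mxE. Qed.
Lemma fc0 k : fc (0 : 'rV[F]_(n + n)) k = 0. Proof. exact: mxE. Qed.
Definition coordE :=
  (ec0, fc0, ecD, fcD, ecN, fcN, ecZ, fcZ, ec_e, ec_f, fc_e, fc_f).

(** The root elements e_i -> e_i + a e_j (isX), e_i -> e_i + a f_j (isY) and
   e_i -> e_i + a f_i (isT), with the images of f_j and of e_j that the form
   dictates, and the monomial elements of Z, delta and S_n. *)
Definition isX i j a g := forall v k,
  (ec (vact v g) k = ec v k + (k == j)%:R * a * ec v i) *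
  (fc (vact v g) k = fc v k - (k == i)%:R * a * fc v j).
Definition isY i j a g := forall v k,
  (ec (vact v g) k = ec v k) *
  (fc (vact v g) k = fc v k + (k == j)%:R * a * ec v i + (k == i)%:R * a * ec v j).
Definition isT i a g := forall v k,
  (ec (vact v g) k = ec v k) *
  (fc (vact v g) k = fc v k + (k == i)%:R * a * ec v i).
Definition isZ i g := forall v k,
  (ec (vact v g) k = if k == i then - fc v i else ec v k) *
  (fc (vact v g) k = if k == i then ec v i else fc v k).
Definition isD i c g := forall v k,
  (ec (vact v g) k = (if k == i then c^-1 else 1) * ec v k) *
  (fc (vact v g) k = (if k == i then c else 1) * fc v k).
Definition isP (p : 'S_n) g := forall v k,
  (ec (vact v g) k = ec v ((p^-1)%g k)) * (fc (vact v g) k = fc v ((p^-1)%g k)).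

End Coordinates.

Section StandardGenerators.
Variables (F : finFieldType) (w : {unit F}) (n : nat) (hn : (1 < n)%N).
Local Open Scope ring_scope.
Local Notation i0 := (ix1 hn).
Local Notation i1 := (ix2 hn).

Ltac coord_basis :=
  move=> v k; rewrite /ec /fc /vact /= /mx_Z /mx_delta /mx_tau /mx_sigma /mx_U
    mul_basis_map /= ?inE ?ixE //= !big_cons big_nil -!/(evec F _) -!/(fvec F _)
    -!/(ec _ _) -!/(fc _ _) ?coordE.

Lemma isZ_sp : isZ i0 (sp_Z F hn).
Proof.
coord_basis; split; case: eqP => [->|_]; rewrite /= ?mulr0n ?mulr1n -/(ec v _) -/(fc v _); ring.
Qed.

Lemma isD_sp : isD i0 (val w) (sp_delta w hn).
Proof.
coord_basis; split; case: eqP => [->|_]; rewrite /= ?mulr0n ?mulr1n -/(ec v _) -/(fc v _); ring.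
Qed.

Lemma isT_sp : isT i0 1 (sp_tau F hn).
Proof.
coord_basis; split; rewrite ?coordE -/(ec v _) -/(fc v _); ring.
Qed.

Lemma isX_sp : isX i0 i1 1 (sp_sigma F hn).
Proof.
coord_basis; split; rewrite ?coordE -/(ec v _) -/(fc v _); ring.
Qed.

Definition perm_mx2 (p : 'S_n) : 'M[F]_(n + n) :=
  block_mx (perm_mx p) 0 0 (perm_mx p).

Lemma symplectic_perm p : symplectic (perm_mx2 p).
Proof.
apply/eqP; rewrite /perm_mx2 /sp_form tr_block_mx !mulmx_block.
rewrite !(mulmx0, mul0mx, addr0, add0r, trmx0, mulmxN, mulmx1, mulNmx).
by rewrite tr_perm_mx -perm_mxM mulgV perm_mx1.
Qed.

Definition sp_perm (p : 'S_n) : Sp F n := SpMx (symplectic_perm p).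

Lemma isP_sp p : isP p (sp_perm p).
Proof.
move=> v k; rewrite /ec /fc /vact /= /perm_mx2.
rewrite -[v]hsubmxK mul_row_block !mulmx0 addr0 add0r.
rewrite !row_mxEl !row_mxEr -[p in perm_mx p]invgK -tr_perm_mx.
by split; rewrite !mxE (bigD1 ((p^-1)%g k)) //= !mxE eqxx mulr1 big1 ?addr0 // => l lk;
  rewrite !mxE eq_sym (negPf lk) mulr0.
Qed.

Lemma sp_permM : {morph sp_perm : p q / (p * q)%g}.
Proof.
move=> p q; apply: spP => v k; rewrite actM !isP_sp invMg /=.
by rewrite !permM.
Qed.

Lemma sp_U_perm : sp_U F hn = sp_perm (tperm i0 i1).
Proof.
apply: spP; coord_basis; rewrite !(isP_sp _ v k).1 !(isP_sp _ v k).2 tpermV.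
split; rewrite -/(ec v _) -/(fc v _); case: tpermP => [->|->|/eqP/negPf -> /eqP/negPf ->];
  rewrite ?eqxx ?ix12 ?ix21; rewrite /= ?mulr0n ?mulr1n; ring.
Qed.

End StandardGenerators.

(** Decides all equality tests between indices in the goal; [ring] or [field]
   then closes the remaining identities of coordinates. *)
Ltac eqcases := repeat match goal with
  | H : is_true (?a != ?a) |- _ => by rewrite eqxx in H
  | |- context [?a == ?a] => rewrite (eqxx a)
  | H : is_true (?a != ?b) |- context [?a == ?b] => rewrite (negPf H)
  | H : is_true (?a != ?b) |- context [?b == ?a] => rewrite [b == a]eq_sym (negPf H)
  | |- context [?a == ?b] =>
      let E := fresh in case: (eqVneq a b) => E; [first [subst a | subst b]|]
  end.
Ltac coord_ring := split; eqcases; rewrite /= ?mulr0n ?mulr1n; ring.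
Ltac coord_field := split; eqcases; rewrite /= ?mulr0n ?mulr1n; field; by rewrite ?andbT.

Section Conjugation.
Variables (F : finFieldType) (n : nat).
Local Open Scope ring_scope.
Implicit Types (v u : 'rV[F]_(n + n)) (g h : Sp F n) (i j k : 'I_n) (a b c : F).

(* h is invertible, so g ^ h only has to be tested on vectors of the form u h. *)
Lemma act_conj u g h : vact (vact u h) (g ^ h)%g = vact (vact u g) h.
Proof. by rewrite -!actM conjgE mulKVg. Qed.

Lemma conj_coord g h (a1 a2 : 'rV[F]_(n + n) -> 'I_n -> F) :
  (forall u k, (ec (vact (vact u g) h) k = a1 (vact u h) k) *
               (fc (vact (vact u g) h) k = a2 (vact u h) k)) ->
  forall v k, (ec (vact v (g ^ h)%g) k = a1 v k) * (fc (vact v (g ^ h)%g) k = a2 v k).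
Proof. by move=> H v k; rewrite -(actKV v h) act_conj. Qed.

Lemma isX_P p g h i j a : isX i j a g -> isP p h -> isX (p i) (p j) a (g ^ h)%g.
Proof.
move=> hg hh; apply: conj_coord => u k; rewrite !hh !hg !permK.
by rewrite !(can2_eq (permKV p) (permK p)).
Qed.

Lemma isZ_P p g h i : isZ i g -> isP p h -> isZ (p i) (g ^ h)%g.
Proof.
move=> hg hh; apply: conj_coord => u k; rewrite !hh !hg !permK.
by rewrite !(can2_eq (permKV p) (permK p)).
Qed.

Lemma isD_P p g h i c : isD i c g -> isP p h -> isD (p i) c (g ^ h)%g.
Proof.
move=> hg hh; apply: conj_coord => u k; rewrite !hh !hg.
by rewrite !(can2_eq (permKV p) (permK p)).
Qed.

Lemma isT_P p g h i a : isT i a g -> isP p h -> isT (p i) a (g ^ h)%g.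
Proof.
move=> hg hh; apply: conj_coord => u k; rewrite !hh !hg !permK.
by rewrite !(can2_eq (permKV p) (permK p)).
Qed.

Lemma isX_Z g h i j a : i != j -> isX i j a g -> isZ j h -> isY i j a (g ^ h)%g.
Proof. by move=> ij hg hh; apply: conj_coord => u k; rewrite !hh !hg; coord_ring. Qed.

Lemma isX_Di g h i j a c : i != j -> c != 0 -> isX i j a g -> isD i c h ->
  isX i j (a * c) (g ^ h)%g.
Proof. by move=> ij c0 hg hh; apply: conj_coord => u k; rewrite !hh !hg; coord_field. Qed.

Lemma isX_Dj g h i j a c : i != j -> c != 0 -> isX i j a g -> isD j c h ->
  isX i j (a / c) (g ^ h)%g.
Proof. by move=> ij c0 hg hh; apply: conj_coord => u k; rewrite !hh !hg; coord_field. Qed.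

Lemma isT_D g h i a c : c != 0 -> isT i a g -> isD i c h ->
  isT i (a * c ^+ 2) (g ^ h)%g.
Proof. by move=> c0 hg hh; apply: conj_coord => u k; rewrite !hh !hg; coord_field. Qed.

Lemma isXM g h i j a b : i != j -> isX i j a g -> isX i j b h ->
  isX i j (a + b) (g * h)%g.
Proof. by move=> ij hg hh v k; rewrite !actM !hh !hg; coord_ring. Qed.

Lemma isTM g h i a b : isT i a g -> isT i b h -> isT i (a + b) (g * h)%g.
Proof. by move=> hg hh v k; rewrite !actM !hh !hg; coord_ring. Qed.

Lemma coord_inv g (a1 a2 : 'rV[F]_(n + n) -> 'I_n -> F) :
  (forall u k, (ec u k = a1 (vact u g) k) * (fc u k = a2 (vact u g) k)) ->
  forall v k, (ec (vact v g^-1%g) k = a1 v k) * (fc (vact v g^-1%g) k = a2 v k).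
Proof. by move=> H v k; rewrite -(actKV v g) actK. Qed.

Lemma isXV g i j a : i != j -> isX i j a g -> isX i j (- a) g^-1%g.
Proof. by move=> ij hg; apply: coord_inv => v k; rewrite !hg; coord_ring. Qed.

Lemma isTV g i a : isT i a g -> isT i (- a) g^-1%g.
Proof. by move=> hg; apply: coord_inv => v k; rewrite !hg; coord_ring. Qed.

Lemma isX1 i j : isX i j 0 (1 : Sp F n)%g.
Proof. by move=> v k; rewrite !act1; coord_ring. Qed.
Lemma isT1 i : isT i 0 (1 : Sp F n)%g.
Proof. by move=> v k; rewrite !act1; coord_ring. Qed.

Lemma isX_eq1 i j g : isX i j 0 g -> g = 1%g.
Proof. by move=> hg; apply: spP => v k; rewrite !hg !act1; coord_ring. Qed.
Lemma isT_eq1 i g : isT i 0 g -> g = 1%g.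
Proof. by move=> hg; apply: spP => v k; rewrite !hg !act1; coord_ring. Qed.

(** The matrix (a b; c d) of SL(2) acting on e_i, f_i. *)
Definition isS i a b c d g := forall v k,
  (ec (vact v g) k = if k == i then a * ec v i + c * fc v i else ec v k) *
  (fc (vact v g) k = if k == i then b * ec v i + d * fc v i else fc v k).

Lemma isSM i a b c d a' b' c' d' g h :
  isS i a b c d g -> isS i a' b' c' d' h ->
  isS i (a * a' + b * c') (a * b' + b * d') (c * a' + d * c') (c * b' + d * d')
    (g * h)%g.
Proof. by move=> hg hh v k; rewrite !actM !hh !hg; coord_ring. Qed.

Lemma isSV i a b c d g : a * d - b * c = 1 -> isS i a b c d g ->
  isS i d (- b) (- c) a g^-1%g.
Proof.
move=> e hg; apply: coord_inv => v k; rewrite !hg; split; eqcases => //.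
- by rewrite -[LHS]mul1r -e; ring.
- by rewrite -[LHS]mul1r -e; ring.
Qed.

Lemma isS_eq i a b c d a' b' c' d' g h :
  isS i a b c d g -> isS i a' b' c' d' h ->
  a = a' -> b = b' -> c = c' -> d = d' -> g = h.
Proof. by move=> hg hh ? ? ? ?; subst; apply: spP => v k; rewrite !hg !hh. Qed.

Lemma isT_S i a g : isT i a g -> isS i 1 a 0 1 g.
Proof. by move=> hg v k; rewrite !hg; coord_ring. Qed.
Lemma isZ_S i g : isZ i g -> isS i 0 1 (- 1) 0 g.
Proof. by move=> hg v k; rewrite !hg; coord_ring. Qed.
Lemma isD_S i c g : isD i c g -> isS i c^-1 0 0 c g.
Proof. by move=> hg v k; rewrite !hg; coord_ring. Qed.

(** The matrix (a b; c d) of SL(2) acting on e_i, e_j, and dually on f_i, f_j. *)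
Definition isB i j a b c d g := forall v k,
  (ec (vact v g) k = if k == i then a * ec v i + c * ec v j
                    else if k == j then b * ec v i + d * ec v j else ec v k) *
  (fc (vact v g) k = if k == i then d * fc v i - b * fc v j
                    else if k == j then - (c * fc v i) + a * fc v j else fc v k).

Lemma isBM i j a b c d a' b' c' d' g h : i != j ->
  isB i j a b c d g -> isB i j a' b' c' d' h ->
  isB i j (a * a' + b * c') (a * b' + b * d') (c * a' + d * c') (c * b' + d * d')
    (g * h)%g.
Proof. by move=> ij hg hh v k; rewrite !actM !hh !hg; coord_ring. Qed.

Lemma isB_eq i j a b c d a' b' c' d' g h :
  isB i j a b c d g -> isB i j a' b' c' d' h ->
  a = a' -> b = b' -> c = c' -> d = d' -> g = h.
Proof. by move=> hg hh ? ? ? ?; subst; apply: spP => v k; rewrite !hg !hh. Qed.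

Lemma isX_B i j a g : i != j -> isX i j a g -> isB i j 1 a 0 1 g.
Proof. by move=> ij hg v k; rewrite !hg; coord_ring. Qed.
Lemma isX_Bt i j a g : i != j -> isX j i a g -> isB i j 1 0 a 1 g.
Proof. by move=> ij hg v k; rewrite !hg; coord_ring. Qed.

End Conjugation.

Arguments isX {F n} i j a%_R g%_g.
Arguments isY {F n} i j a%_R g%_g.
Arguments isT {F n} i a%_R g%_g.
Arguments isD {F n} i c%_R g%_g.
Arguments isS {F n} i (a b c d)%_R g%_g.
Arguments isB {F n} i j (a b c d)%_R g%_g.

(** * Groups satisfying the relations *)

Section System.
Variables (F : finFieldType) (w : {unit F}) (n : nat) (hn : (1 < n)%N).
Local Notation i0 := (ix1 hn).
Local Notation i1 := (ix2 hn).

(** What the proof uses of the presented group.  The symmetric group enters as a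
   homomorphism on all of S_n, and relations between distant indices are stated
   for all permutations with the given effect on the first two indices; this
   removes every case distinction on n.  The relators of SL(2,q) enter only as
   faithfulness on the two subgroups that they present. *)
Record sp_system (G : groupType) := SpSystem {
  sphi : G -> Sp F n;
  sphiM : {morph sphi : g h / g * h};
  spi : 'S_n -> G;
  spiM : {morph spi : p q / p * q};
  ss : G; st : G; sd : G; sz : G;
  su := spi (tperm i0 i1);
  sphi_s : sphi ss = sp_sigma F hn;
  sphi_t : sphi st = sp_tau F hn;
  sphi_d : sphi sd = sp_delta w hn;
  sphi_z : sphi sz = sp_Z F hn;
  sphi_pi : forall p : 'S_n, sphi (spi p) = sp_perm F p;
  ss_gen : forall g, gen (fun x => (exists p, x = spi p) \/
             [\/ x = ss, x = st, x = sd | x = sz]) g;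
  sr_z : forall p : 'S_n, p i0 = i0 -> sz ^ spi p = sz;
  sr_d : forall p : 'S_n, p i0 = i0 -> sd ^ spi p = sd;
  sr_zz : sz ^ (sz ^ su) = sz;
  sr_zd : sz ^ (sd ^ su) = sz;
  sr_dd : sd ^ (sd ^ su) = sd;
  sr_su : ss ^ (sz * su * sz^-1) = ss;
  sr_s : forall p : 'S_n, p i0 = i0 -> p i1 = i1 -> ss ^ spi p = ss;
  sr_sz : forall p : 'S_n, p i0 != i0 -> p i0 != i1 -> ss ^ (sz ^ spi p) = ss;
  sr_sd : forall p : 'S_n, p i0 != i0 -> p i0 != i1 -> ss ^ (sd ^ spi p) = ss;
  sr_sdd : ss ^ (sd * sd ^ su) = ss;
  sr_tz : st ^ (sz ^ su) = st;
  sr_t : forall p : 'S_n, p i0 = i0 -> st ^ spi p = st;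
  sr_td : st ^ (sd ^ su) = st;
  sr_S1 : forall g, gen (fun x => [\/ x = ss, x = Delta_of su sd | x = su * sz ^+ 2]) g ->
    sphi g = 1 -> g = 1;
  sr_S2 : forall g, gen (fun x => [\/ x = st, x = sd | x = sz]) g ->
    sphi g = 1 -> g = 1;
  sr_a : forall p q : 'S_n, p i0 = i1 -> p i1 != i0 -> q i0 = i0 -> q i1 = p i1 ->
    ss ^ (ss ^ spi p) = ss * ss ^ spi q;
  sr_b : forall p : 'S_n, p i0 = i0 -> p i1 != i1 -> ss ^ (ss ^ spi p) = ss;
  sr_c : forall p : 'S_n, p i1 = i1 -> p i0 != i0 -> ss ^ (ss ^ spi p) = ss;
  sr_d4 : forall p : 'S_n, [&& p i0 != i0, p i0 != i1, p i1 != i0 & p i1 != i1] ->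
    ss ^ (ss ^ spi p) = ss;
  sr_e : ss ^ (ss ^ sz) = ss * (st ^+ 2) ^ (sz * su);
  sr_f : ss ^ st = ss;
  sr_g : ss ^ (st ^ su) = ss * (ss ^ (sz ^ su) * st^-1);
  sr_h : forall p : 'S_n, p i0 != i0 -> p i0 != i1 -> ss ^ (st ^ spi p) = ss;
  sr_j : st ^ (st ^ su) = st
}.

Variables (G : groupType) (S : sp_system G).
Local Notation phi := (sphi S).
Local Notation pi := (spi S).
Implicit Types (i j k l : 'I_n) (p q : 'S_n) (g h : G).

Lemma phi1 : phi 1 = 1.
Proof. exact: hom1 (sphiM S). Qed.
Lemma phiV g : phi g^-1 = (phi g)^-1.
Proof. exact: homV (sphiM S) g. Qed.
Lemma phiJ g h : phi (g ^ h) = phi g ^ phi h.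
Proof. exact: homJ (sphiM S) g h. Qed.
Lemma phiX g (m : nat) : phi (g ^+ m) = phi g ^+ m.
Proof. exact: homX (sphiM S) g m. Qed.
Lemma pi1 : pi 1 = 1.
Proof. exact: hom1 (spiM S). Qed.
Lemma piV p : pi p^-1 = (pi p)^-1.
Proof. exact: homV (spiM S) p. Qed.
Lemma piJ p q : pi (p ^ q) = pi p ^ pi q.
Proof. exact: homJ (spiM S) p q. Qed.

Definition pm i j : 'S_n := tperm i0 i * tperm (tperm i0 i i1) j.

Lemma pm0 i j : i != j -> pm i j i0 = i.
Proof.
move=> ij; rewrite permM tpermL; apply: tpermD; last by rewrite eq_sym.
by rewrite -[X in _ != X](tpermL i0 i) (inj_eq perm_inj).
Qed.
Lemma pm1 i j : pm i j i1 = j.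
Proof. by rewrite permM tpermL. Qed.

Lemma two_trans i j : i != j -> exists p : 'S_n, p i0 = i /\ p i1 = j.
Proof. by exists (pm i j); rewrite pm0 ?pm1. Qed.

(** The conjugates of the generators under S_n are locked, because [rewrite]
   would otherwise match patterns inside the conjugating elements. *)
Definition gx i j := locked (ss S ^ pi (pm i j)).
Definition gz i := locked (sz S ^ pi (tperm i0 i)).
Definition gd i := locked (sd S ^ pi (tperm i0 i)).
Definition gt i := locked (st S ^ pi (tperm i0 i)).
Definition gy i j := locked (gx i j ^ gz j).
Definition gu i j := pi (tperm i j).

Lemma gxE i j : gx i j = ss S ^ pi (pm i j). Proof. by rewrite /gx -lock. Qed.
Lemma gyE i j : gy i j = gx i j ^ gz j. Proof. by rewrite /gy -lock. Qed.
Lemma gzE i : gz i = sz S ^ pi (tperm i0 i). Proof. by rewrite /gz -lock. Qed.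
Lemma gdE i : gd i = sd S ^ pi (tperm i0 i). Proof. by rewrite /gd -lock. Qed.
Lemma gtE i : gt i = st S ^ pi (tperm i0 i). Proof. by rewrite /gt -lock. Qed.

Lemma fix_conj (a : G) p q : (forall p : 'S_n, p i0 = i0 -> a ^ pi p = a) ->
  p i0 = q i0 -> a ^ pi p = a ^ pi q.
Proof.
move=> h pq; rewrite -{1}(mulgKV q p) spiM conjgM h //.
by rewrite permM pq permK.
Qed.

Lemma xE p : ss S ^ pi p = gx (p i0) (p i1).
Proof.
have q0 : pm (p i0) (p i1) i0 = p i0 by rewrite pm0 ?(inj_eq perm_inj).
have q1 := pm1 (p i0) (p i1); rewrite gxE; move: (pm _ _) q0 q1 => q q0 q1.
rewrite -{1}(mulgKV q p) spiM conjgM sr_s // permM.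
  by rewrite -q0 permK.
by rewrite -q1 permK.
Qed.
Lemma zE p : sz S ^ pi p = gz (p i0).
Proof. by rewrite gzE; apply: fix_conj; [exact: sr_z | rewrite tpermL]. Qed.
Lemma dE p : sd S ^ pi p = gd (p i0).
Proof. by rewrite gdE; apply: fix_conj; [exact: sr_d | rewrite tpermL]. Qed.
Lemma tE p : st S ^ pi p = gt (p i0).
Proof. by rewrite gtE; apply: fix_conj; [exact: sr_t | rewrite tpermL]. Qed.

Lemma xJ i j p : i != j -> gx i j ^ pi p = gx (p i) (p j).
Proof. by move=> ij; rewrite {1}gxE -conjgM -spiM xE ![(_ * p) _]permM pm0 ?pm1. Qed.
Lemma zJ i p : gz i ^ pi p = gz (p i).
Proof. by rewrite {1}gzE -conjgM -spiM zE permM tpermL. Qed.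
Lemma dJ i p : gd i ^ pi p = gd (p i).
Proof. by rewrite {1}gdE -conjgM -spiM dE permM tpermL. Qed.
Lemma tJ i p : gt i ^ pi p = gt (p i).
Proof. by rewrite {1}gtE -conjgM -spiM tE permM tpermL. Qed.
Lemma yJ i j p : i != j -> gy i j ^ pi p = gy (p i) (p j).
Proof. by move=> ij; rewrite !gyE conjJg xJ // zJ. Qed.

Lemma x01 : gx i0 i1 = ss S. Proof. by rewrite -[RHS]conjg1 -pi1 xE !perm1. Qed.
Lemma z0 : gz i0 = sz S. Proof. by rewrite -[RHS]conjg1 -pi1 zE !perm1. Qed.
Lemma d0 : gd i0 = sd S. Proof. by rewrite -[RHS]conjg1 -pi1 dE !perm1. Qed.
Lemma t0 : gt i0 = st S. Proof. by rewrite -[RHS]conjg1 -pi1 tE !perm1. Qed.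
Lemma su0 : su S = gu i0 i1. Proof. by []. Qed.
Lemma z1 : sz S ^ su S = gz i1. Proof. by rewrite zE tpermL. Qed.
Lemma d1 : sd S ^ su S = gd i1. Proof. by rewrite dE tpermL. Qed.
Lemma t1 : st S ^ su S = gt i1. Proof. by rewrite tE tpermL. Qed.
Lemma uV i j : (gu i j)^-1 = gu i j. Proof. by rewrite -piV tpermV. Qed.

(* Relations at the indices i0, i1 are moved to i, j by a permutation. *)
Ltac transport ij := case/two_trans: ij => p [<- <-].

Lemma zz i j : i != j -> gz i ^ gz j = gz i.
Proof. by move=> ij; transport ij; rewrite -!zJ -conjJg z0 -z1 sr_zz. Qed.
Lemma zd i j : i != j -> gz i ^ gd j = gz i.
Proof. by move=> ij; transport ij; rewrite -zJ -dJ -conjJg z0 -d1 sr_zd. Qed.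
Lemma dd i j : i != j -> gd i ^ gd j = gd i.
Proof. by move=> ij; transport ij; rewrite -!dJ -conjJg d0 -d1 sr_dd. Qed.
Lemma tz i j : i != j -> gt i ^ gz j = gt i.
Proof. by move=> ij; transport ij; rewrite -zJ -tJ -conjJg t0 -z1 sr_tz. Qed.
Lemma td i j : i != j -> gt i ^ gd j = gt i.
Proof. by move=> ij; transport ij; rewrite -dJ -tJ -conjJg t0 -d1 sr_td. Qed.
Lemma tt i j : i != j -> gt i ^ gt j = gt i.
Proof. by move=> ij; transport ij; rewrite -!tJ -conjJg t0 -t1 sr_j. Qed.
Lemma xt i j : i != j -> gx i j ^ gt i = gx i j.
Proof. by move=> ij; transport ij; rewrite -xJ // -tJ -conjJg x01 t0 sr_f. Qed.
Lemma xtj i j : i != j -> gx i j ^ gt j = gx i j * (gy i j * (gt i)^-1).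
Proof.
move=> ij; transport ij; rewrite -yJ // -xJ // -!tJ -conjJg -conjVg -!conjMg.
by rewrite gyE x01 t0 -t1 sr_g z1.
Qed.
Lemma xdd i j : i != j -> gx i j ^ (gd i * gd j) = gx i j.
Proof. by move=> ij; transport ij; rewrite -xJ // -!dJ -conjMg -conjJg x01 d0 -d1 sr_sdd. Qed.
(* The relation between sigma and Z U Z^-1. *)
Lemma xU i j : i != j -> gx j i = gx i j ^ (gz i * (gz j)^-1).
Proof.
move=> ij; transport ij; rewrite -!zJ -!xJ // -conjVg -conjMg -conjJg; congr (_ ^ _).
have -> : gx i1 i0 = ss S ^ su S by rewrite -x01 xJ // tpermL tpermR.
rewrite x01 z0 -z1.
rewrite -{1}(sr_su S) -conjgM; congr (_ ^ _).
by rewrite conjgE !invgM invgK !mulgA su0 uV.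
Qed.
Lemma xe i j : i != j -> gx i j ^ (gx i j ^ gz i) = gx i j * (gt j ^+ 2) ^ gz j.
Proof.
move=> ij; transport ij; rewrite -!zJ -tJ -xJ // -!conjXg -!conjJg -!conjMg.
by congr (_ ^ _); rewrite x01 z0 sr_e -t1 -z1 -conjXg -conjJg -conjgM.
Qed.

(* An index outside {i, j} is the image of one outside the first two indices. *)
Ltac third k k' p ki kj := move: ki kj;
  rewrite -[k](permKV p) !(inj_eq perm_inj); move: (p^-1 k) => k' ki kj.

Lemma xz i j k : i != j -> k != i -> k != j -> gx i j ^ gz k = gx i j.
Proof.
move=> ij ki kj; move: ij ki kj; case/two_trans => p [<- <-] ki kj.
third k k' p ki kj.
by rewrite -xJ // -zJ -conjJg x01 gzE sr_sz ?tpermL.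
Qed.
Lemma xd i j k : i != j -> k != i -> k != j -> gx i j ^ gd k = gx i j.
Proof.
case/two_trans => p [<- <-] ki kj; third k k' p ki kj.
by rewrite -xJ // -dJ -conjJg x01 gdE sr_sd ?tpermL.
Qed.
Lemma xtk i j k : i != j -> k != i -> k != j -> gx i j ^ gt k = gx i j.
Proof.
case/two_trans => p [<- <-] ki kj; third k k' p ki kj.
by rewrite -xJ // -tJ -conjJg x01 gtE sr_h ?tpermL.
Qed.
Lemma xxa i j k : i != j -> k != i -> k != j -> gx i j ^ gx j k = gx i j * gx i k.
Proof.
case/two_trans => p [<- <-] ki kj; third k k' p ki kj.
rewrite -!xJ 1?eq_sym // -conjJg -conjMg; congr (_ ^ _).
by rewrite x01 !gxE (@sr_a G S _ (pm i0 k')) ?pm0 ?pm1 // eq_sym.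
Qed.
Lemma xxb i j k : i != j -> k != i -> k != j -> gx i j ^ gx i k = gx i j.
Proof.
case/two_trans => p [<- <-] ki kj; third k k' p ki kj.
rewrite -!xJ 1?eq_sym // -conjJg; congr (_ ^ _).
by rewrite x01 gxE sr_b ?pm0 ?pm1 // eq_sym.
Qed.
Lemma xxc i j k : i != j -> k != i -> k != j -> gx i j ^ gx k j = gx i j.
Proof.
case/two_trans => p [<- <-] ki kj; third k k' p ki kj.
rewrite -!xJ // -conjJg; congr (_ ^ _).
by rewrite x01 gxE sr_c ?pm0 ?pm1.
Qed.
Lemma xxd i j k l : i != j -> k != i -> k != j -> l != i -> l != j -> k != l ->
  gx i j ^ gx k l = gx i j.
Proof.
case/two_trans => p [<- <-] ki kj li lj; third k k' p ki kj; third l l' p li lj.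
move=> kl; rewrite -!xJ // -conjJg; congr (_ ^ _).
by rewrite x01 gxE sr_d4 // pm0 // pm1 ki kj li lj.
Qed.

End System.

(** * The subgroups of long roots *)

(** Two computations for yz with a central element c.  The hypothesis of
   class2_relation comes from conjugating x by both sides of z = t t^z t, and the
   second hypothesis of class2_inverse from conjugating the first one by t. *)
Section ClassTwo.
Variable G : groupType.
Variables x y e v c : G.
Hypotheses (cx : x ^ c = x) (cy : y ^ c = y) (ce : e ^ c = e) (cv : v ^ c = v).
Hypothesis xy : x ^ y = x * c ^+ 2.

Let kc g : g ^ c = g -> g * c^-1 = c^-1 * g.
Proof. by move=> h; apply/comm_conj/conjV_fix. Qed.
Let kc' g h : g ^ c = g -> g * (c^-1 * h) = c^-1 * (g * h).
Proof. by move=> hg; rewrite mulgA kc // mulgA. Qed.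
Let xyE : x * y = c * c * (y * x).
Proof.
rewrite conjgC xy mulgA -expg2; apply/esym/comm_conj/conj_sym.
by apply: conjX_fix; rewrite conjMg cy cx.
Qed.

Lemma class2_relation :
  y = x * (y * c^-1) * (y * (e * (v * c^-1) * c^-1) * c^-1) ->
  x * y * e * v = c ^+ 2.
Proof.
rewrite -!mulgA !(kc cx, kc cy, kc ce, kc cv, kc' _ cx, kc' _ cy, kc' _ ce, kc' _ cv).
move=> E; have {E} : c * c * (c * c) * y = x * (y * (y * (e * v))).
  by rewrite {1}E -!mulgA !mulKVg.
rewrite [x * _]mulgA xyE -!mulgA => /mulgI /mulgI E.
have : y * (c * c) = y * (x * (y * (e * v))).
  by rewrite -E !mulgA (comm_conj cy) -[c * y * c]mulgA (comm_conj cy) mulgA.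
by move/mulgI => <-.
Qed.

Lemma class2_inverse : x * y * e * v = c ^+ 2 ->
  x * (y * c^-1) * y * (e * (v * c^-1)) * v = c ^+ 2 -> v = y^-1.
Proof.
rewrite -!mulgA !(kc cx, kc cy, kc ce, kc cv, kc' _ cx, kc' _ cy, kc' _ ce, kc' _ cv).
move=> E2 E3; apply: (mulgI y); rewrite mulgV.
have {}E3 : x * (y * (y * (e * (v * v)))) = c * (c * (c * c)).
  by move: E3; rewrite expg2 => <-; rewrite !mulKVg.
have E4 : y * (e * v) = x^-1 * (c * c) by rewrite -(mulKg x (y * _)) E2.
move: E3; have -> : y * (e * (v * v)) = y * (e * v) * v by rewrite !mulgA.
rewrite E4 [x * (y * _)]mulgA xyE -!mulgA => /mulgI /mulgI.
rewrite mulKVg => E5; apply: (mulgI (c * c)); rewrite mulg1 -[RHS]E5.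
by rewrite !mulgA (comm_conj cy) -[c * y * c]mulgA (comm_conj cy) mulgA.
Qed.

End ClassTwo.

Section Rank1.
Variables (F : finFieldType) (w : {unit F}) (n : nat) (hn : (1 < n)%N).
Hypothesis hw : (#|F|.-1.-primitive_root (val w))%R.
Variables (G : groupType) (S : sp_system w hn G).
Local Notation i0 := (ix1 hn).
Local Notation phi := (sphi S).
Local Notation pi := (spi S).
Local Notation gx := (gx S).
Local Notation gz := (gz S).
Local Notation gd := (gd S).
Local Notation gt := (gt S).
Implicit Types (i j k l : 'I_n) (p q : 'S_n) (g h : G) (m r : nat) (a b c : F).

Lemma isXx i j : i != j -> isX i j 1 (phi (gx i j)).
Proof.
move=> ij; have := isX_P (@isX_sp F n hn) (@isP_sp F n (pm hn i j)).
by rewrite pm0 // pm1 gxE phiJ sphi_s sphi_pi.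
Qed.
Lemma isZz i : isZ i (phi (gz i)).
Proof.
by have := isZ_P (@isZ_sp F n hn) (@isP_sp F n (tperm i0 i)); rewrite tpermL gzE phiJ sphi_z sphi_pi.
Qed.
Lemma isDd i : isD i (val w) (phi (gd i)).
Proof.
by have := isD_P (@isD_sp F w n hn) (@isP_sp F n (tperm i0 i)); rewrite tpermL gdE phiJ sphi_d sphi_pi.
Qed.
Lemma isTt i : isT i 1 (phi (gt i)).
Proof.
by have := isT_P (@isT_sp F n hn) (@isP_sp F n (tperm i0 i)); rewrite tpermL gtE phiJ sphi_t sphi_pi.
Qed.

Definition faithful (H : G -> Prop) := forall g, H g -> phi g = 1 -> g = 1.

Lemma faithful_eq H g h : subgrp H -> faithful H -> H g -> H h ->
  phi g = phi h -> g = h.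
Proof.
move=> hH fH hg hh e; apply: (mulIg h^-1); rewrite mulgV.
apply: fH; last by rewrite sphiM phiV e mulgV.
by apply: subM => //; apply: subV.
Qed.

Lemma faithfulJ H g : faithful H -> faithful (fun h => H (h ^ g)).
Proof.
move=> fH h hh e; apply: (conjg_inj g); rewrite conj1g; apply: fH => //.
by rewrite phiJ e conj1g.
Qed.

Lemma sp_torsion (A : Sp F n) : torsion A.
Proof.
pose f (m : 'I_(#|{: Sp F n}|.+1)) := A ^+ m.
have /injectivePn[k [l kl e]] : ~~ injectiveb f.
  by apply/injectiveP => /leq_card; rewrite card_ord ltnn.
wlog lt : k l kl e / (k < l)%N.
  move=> H; case: (ltngtP k l) => h; [exact: (H k l) | | by rewrite (ord_inj h) eqxx in kl].
  by apply: (H l k) => //; rewrite eq_sym.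
exists (l - k)%N; first by rewrite subn_gt0.
apply: (mulgI (A ^+ k)); rewrite -expgnDr subnKC; last exact: ltnW.
by rewrite mulg1 -/(f l) -e.
Qed.

(** Finite order is inherited from Sp(2n,q) by the subgroups on which phi is
   known to be faithful; it is what nrm_torsion needs. *)
Lemma faithful_torsion H g : subgrp H -> faithful H -> H g -> torsion g.
Proof.
move=> hH fH hg; have [N N0 e] := sp_torsion (phi g); exists N => //.
by apply: fH; [apply: subX | rewrite phiX].
Qed.

(** The copy of SL(2,q) that acts on e_i, f_i. *)
Definition S2 i := gen (fun g => [\/ g = gt i, g = gd i | g = gz i]).

Lemma S2_sub i : subgrp (S2 i). Proof. exact: gen_sub. Qed.
Lemma S2_t i : S2 i (gt i). Proof. by apply: gen_in; apply: Or31. Qed.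
Lemma S2_d i : S2 i (gd i). Proof. by apply: gen_in; apply: Or32. Qed.
Lemma S2_z i : S2 i (gz i). Proof. by apply: gen_in; apply: Or33. Qed.

Lemma S2_faithful i : faithful (S2 i).
Proof.
have h : faithful (fun g => S2 i0 (g ^ pi (tperm i0 i))).
  apply: faithfulJ => g hg; apply: (sr_S2 (s := S)); move: g hg.
  by apply: gen_min; [exact: gen_sub|] => g []->; rewrite ?t0 ?d0 ?z0; apply: gen_in;
    [apply: Or31|apply: Or32|apply: Or33].
move=> g hg; apply: h; move: g hg; apply: gen_conj; first exact: S2_sub.
move=> _ []->; rewrite ?tJ ?dJ ?zJ tpermR; [exact: S2_t|exact: S2_d|exact: S2_z].
Qed.

Lemma S2_eq i g h : S2 i g -> S2 i h -> phi g = phi h -> g = h.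
Proof. exact: faithful_eq (S2_sub i) (@S2_faithful i). Qed.

Lemma torsion_t i : torsion (gt i).
Proof. exact: faithful_torsion (S2_sub i) (@S2_faithful i) (S2_t i). Qed.
Lemma torsion_d i : torsion (gd i).
Proof. exact: faithful_torsion (S2_sub i) (@S2_faithful i) (S2_d i). Qed.
Lemma torsion_z i : torsion (gz i).
Proof. exact: faithful_torsion (S2_sub i) (@S2_faithful i) (S2_z i). Qed.

Lemma w0 : (val w != 0 :> F)%R. Proof. exact: w_neq0. Qed.

Lemma w_pow a : (a != 0)%R -> exists m, a = (val w ^+ m)%R.
Proof.
move=> a0; have : (a ^+ #|F|.-1 = 1)%R.
  apply: (mulfI a0); rewrite -exprS prednK ?mulr1 ?expf_card //.
  exact: (ltn_trans _ (card_finNzRing_gt1 F)).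
by case/(prim_rootP hw) => m ->; exists m.
Qed.

Lemma isS_t i : isS i 1 1 0 1 (phi (gt i)). Proof. exact/isT_S/isTt. Qed.
Lemma isS_z i : isS i 0 1 (-1) 0 (phi (gz i)). Proof. exact/isZ_S/isZz. Qed.
Lemma isS_d i : isS i (val w)^-1 0 0 (val w) (phi (gd i)). Proof. exact/isD_S/isDd. Qed.
Lemma isS_zV i : isS i 0 (-1) 1 0 (phi (gz i)^-1).
Proof. by rewrite phiV; have := isSV _ (isS_z i); rewrite opprK; apply; ring. Qed.
Lemma isS_dV i : isS i (val w) 0 0 (val w)^-1 (phi (gd i)^-1).
Proof.
rewrite phiV; have := isSV _ (isS_d i); rewrite oppr0; apply.
by rewrite mulVf ?w0 //; ring.
Qed.

Lemma dz i : gd i ^ gz i = (gd i)^-1.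
Proof.
have [hd hz] := (S2_d i, S2_z i); have hS := S2_sub i.
apply: (S2_eq (i := i)); [exact: subJ | exact: subV|].
rewrite conjgE !sphiM; have h1 := isSM (isS_d i) (isS_z i).
by apply: isS_eq (isSM (isS_zV i) h1) (isS_dV i) _ _ _ _; ring.
Qed.

Lemma tzz i : gt i ^ (gz i * gz i) = gt i.
Proof.
have [ht hz] := (S2_t i, S2_z i); have hS := S2_sub i.
apply: (S2_eq (i := i)) => //; first by apply: subJ => //; apply: subM.
have h2 := isSM (isS_z i) (isS_z i).
rewrite phiJ; apply: conj_comm; rewrite sphiM.
by apply: isS_eq (isSM (isS_t i) h2) (isSM h2 (isS_t i)) _ _ _ _; ring.
Qed.

Lemma z_ttt i : gz i = gt i * gt i ^ gz i * gt i.
Proof.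
have [ht hz] := (S2_t i, S2_z i); have hS := S2_sub i.
apply: (S2_eq (i := i)) => //; first by apply: subM => //; apply: subM => //; apply: subJ.
rewrite conjgE !sphiM; have h1 := isSM (isS_zV i) (isSM (isS_t i) (isS_z i)).
by apply: isS_eq (isS_z i) (isSM (isSM (isS_t i) h1) (isS_t i)) _ _ _ _; ring.
Qed.

Lemma zz_d i : exists m, gz i ^+ 2 = gd i ^+ m.
Proof.
have [m hm] : exists m, (- 1 = val w ^+ m :> F)%R.
  by apply: w_pow; rewrite oppr_eq0 oner_eq0.
have [hd hz] := (S2_d i, S2_z i); have hS := S2_sub i.
exists m; apply: (S2_eq (i := i)); [exact: subX | exact: subX|].
have hp r : isS i (val w ^- r)%R 0 0 (val w ^+ r)%R (phi (gd i ^+ r)).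
  elim: r => [|r IH]; first by rewrite expg0 phi1 invr1 => v k; rewrite !act1; coord_ring.
  rewrite expgSr sphiM; have := isSM IH (isS_d i).
  by rewrite !(mulr0, mul0r, addr0, add0r) -invfM exprSr mulrC.
rewrite expgS expg1 sphiM.
apply: isS_eq (isSM (isS_z i) (isS_z i)) (hp m) _ _ _ _; rewrite -?hm ?invrN ?invr1; ring.
Qed.

Lemma dzz i : gd i ^ (gz i * gz i) = gd i.
Proof. by have [m e] := zz_d i; rewrite -expg2 e; apply: conjX_fix; rewrite conjgE mulKg. Qed.

Lemma d_inv : exists r, forall i, (gd i)^-1 = gd i ^+ r.
Proof.
have [[//|N] _ dN] := torsion_d i0; exists N => i.
apply: (mulgI (gd i)); rewrite mulgV -expgS -(tpermL i0 i) -(dJ S).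
by rewrite -conjXg dN conj1g.
Qed.

(** The conjugates of t_i by powers of d_i have the parameters that are squares;
   the other parameters need products and inverses. *)
Definition Rgen i g := exists m, g = gt i ^ (gd i ^+ m).
Definition R i := gen (Rgen i).

Lemma R_sub i : subgrp (R i). Proof. exact: gen_sub. Qed.
Lemma R_S2 i g : R i g -> S2 i g.
Proof.
apply: gen_min => [|_ [m ->]]; first exact: S2_sub.
apply: subJ; [exact: S2_sub|exact: S2_t|].
by apply: subX; [exact: S2_sub | exact: S2_d].
Qed.
Lemma isT_gen i m : isT i (val w ^+ m.*2)%R (phi (gt i ^ (gd i ^+ m))).
Proof.
elim: m => [|m IH]; first by rewrite conjg1; apply: isTt.
rewrite expgSr conjgM phiJ doubleS; have := isT_D w0 IH (isDd i).
by rewrite -exprD addn2.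
Qed.
Lemma R_isT i g : R i g -> exists a, isT i a (phi g).
Proof.
move: g; apply: gen_min => [|_ [m ->]]; last by eexists; apply: isT_gen.
split=> [|g h [a ha] [b hb]|g [a ha]].
- by exists 0%R; rewrite phi1; apply: isT1.
- by exists (a + b)%R; rewrite sphiM; apply: isTM.
- by exists (- a)%R; rewrite phiV; apply: isTV.
Qed.
Lemma R_eq1 i g : R i g -> isT i 0 (phi g) -> g = 1.
Proof. by move=> hg /isT_eq1; apply: S2_faithful (R_S2 hg). Qed.
Lemma R_t i : R i (gt i).
Proof. by apply: gen_in; exists 0%N; rewrite conjg1. Qed.

(** For odd q as a = ((a+1)/2)^2 - ((a-1)/2)^2, for even q since squaring is
   injective and hence surjective. *)
Lemma diff_squares a : exists b c, (a = b ^+ 2 - c ^+ 2)%R.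
Proof.
have [two0|two0] := eqVneq (2%:R : F)%R 0%R; last first.
  exists ((a + 1) / 2%:R)%R, ((a - 1) / 2%:R)%R; field.
  by rewrite two0.
have sq_inj : injective (fun b : F => (b ^+ 2)%R).
  move=> b c /= e; apply/eqP; rewrite -subr_eq0 -sqrf_eq0 sqrrB e.
  by rewrite -mulr_natr two0 mulr0 subr0 -mulr2n -mulr_natr two0 mulr0.
have [g _ gK] := injF_bij sq_inj.
by exists (g a), 0%R; rewrite expr0n subr0 gK.
Qed.

Lemma R_onto i a : exists2 g, R i g & isT i a (phi g).
Proof.
have sq b : exists2 g, R i g & isT i (b ^+ 2)%R (phi g).
  have [->|b0] := eqVneq b 0%R.
    exists 1; first exact: sub1 (R_sub i).
    by rewrite expr0n phi1; apply: isT1.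
  have [m ->] := w_pow b0; exists (gt i ^ (gd i ^+ m)); first by apply: gen_in; exists m.
  by rewrite -exprM muln2; apply: isT_gen.
have [b [c ->]] := diff_squares a; have [[g hg Tg] [h hh Th]] := (sq b, sq c).
exists (g * h^-1); first by apply: (subM (R_sub i)) => //; apply: (subV (R_sub i)).
by rewrite sphiM phiV; apply: isTM => //; apply: isTV.
Qed.

(** diag(w^-1, w) is a product of unipotent elements and z in SL(2); a subgroup that is
   normalised by long root elements and z_i is thus normalised by d_i. *)
Lemma d_in i : gen (fun g => Rgen i g \/ g = gz i) (gd i).
Proof.
have hS := gen_sub (fun g => Rgen i g \/ g = gz i).
have RS g : R i g -> gen (fun g => Rgen i g \/ g = gz i) g.
  by apply: gen_min => // h hh; apply: gen_in; left.
have hz : gen (fun g => Rgen i g \/ g = gz i) (gz i) by apply: gen_in; right.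
have [g hg /isT_S Tg] := R_onto i (val w)^-1%R.
have [h hh /isT_S Th] := R_onto i (val w).
have -> : gd i = g * h ^ gz i * g * (gz i)^-1.
  apply: (S2_eq (i := i)); first exact: S2_d.
    apply: (subM (S2_sub i)); last exact/(subV (S2_sub i))/S2_z.
    apply: (subM (S2_sub i)); last exact: R_S2.
    apply: (subM (S2_sub i)); first exact: R_S2.
    by apply: (subJ (S2_sub i)); [exact: R_S2 | exact: S2_z].
  rewrite conjgE !sphiM; have h1 := isSM (isS_zV i) (isSM Th (isS_z i)).
  apply: isS_eq (isS_d i) (isSM (isSM (isSM Tg h1) Tg) (isS_zV i)) _ _ _ _;
    field; exact: w0.
apply: (subM hS); last exact: (subV hS).
apply: (subM hS); last exact: RS.
apply: (subM hS); first exact: RS.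
by apply: (subJ hS) => //; apply: RS.
Qed.

End Rank1.

(** * The short root subgroups *)

Section Rank2.
Variables (F : finFieldType) (w : {unit F}) (n : nat) (hn : (1 < n)%N).
Hypothesis hw : (#|F|.-1.-primitive_root (val w))%R.
Variables (G : groupType) (S : sp_system w hn G).
Local Notation i0 := (ix1 hn).
Local Notation i1 := (ix2 hn).
Local Notation phi := (sphi S).
Local Notation pi := (spi S).
Local Notation gx := (gx S).
Local Notation gy := (gy S).
Local Notation gz := (gz S).
Local Notation gd := (gd S).
Local Notation gt := (gt S).
Local Notation gu := (gu S).
Local Notation faithful := (faithful S).
Local Notation R := (R S).
Implicit Types (i j k l : 'I_n) (p q : 'S_n) (g h : G) (m r : nat) (a b c : F).

Lemma conj_swap (g h a : G) : g ^ h = g -> (a ^ g) ^ h = (a ^ h) ^ g.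
Proof. by move=> e; rewrite conjJg e. Qed.

Lemma ud i j : gd i ^ gu i j = gd j. Proof. by rewrite dJ tpermL. Qed.

(** The copy of SL(2,q) that acts on e_i, e_j and dually on f_i, f_j. *)
Definition S1 i j :=
  gen (fun g => [\/ g = gx i j, g = (gd j)^-1 * gd i | g = gu i j * gz i ^+ 2]).

Lemma S1_sub i j : subgrp (S1 i j). Proof. exact: gen_sub. Qed.

Lemma S1_faithful i j : i != j -> faithful (S1 i j).
Proof.
case/two_trans => p [<- <-].
have h : faithful (fun g => S1 i0 i1 (g ^ (pi p)^-1)).
  apply: faithfulJ => g hg; apply: (sr_S1 (s := S)); move: g hg.
  apply: gen_min; [exact: gen_sub|] => g []->.
  - by rewrite x01; apply: gen_in; apply: Or31.
  - apply: gen_in; apply: Or32; rewrite /Delta_of commgEl conjgE -d0 -d1 conjgE d0.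
    by rewrite !invgM !invgK !mulgA.
  - by rewrite z0; apply: gen_in; apply: Or33.
move=> g hg; apply: h; move: g hg; apply: gen_conj; first exact: S1_sub.
move=> _ []->; rewrite -piV ?conjMg ?conjVg ?conjXg ?xJ ?(inj_eq perm_inj) // ?dJ ?zJ ?permK.
- by apply: gen_in; apply: Or31.
- by apply: gen_in; apply: Or32.
- by apply: gen_in; apply: Or33; rewrite /gu -piJ tpermJ !permK.
Qed.

Lemma S1_eq i j g h : i != j -> S1 i j g -> S1 i j h -> phi g = phi h -> g = h.
Proof. by move=> ij; exact: faithful_eq (S1_sub i j) (S1_faithful ij). Qed.

Lemma S1_x i j : S1 i j (gx i j). Proof. by apply: gen_in; apply: Or31. Qed.
Lemma S1_d i j : S1 i j ((gd j)^-1 * gd i). Proof. by apply: gen_in; apply: Or32. Qed.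
Lemma S1_u i j : S1 i j (gu i j * gz i ^+ 2). Proof. by apply: gen_in; apply: Or33. Qed.

Lemma torsion_x i j : i != j -> torsion (gx i j).
Proof. by move=> ij; exact: faithful_torsion (S1_sub i j) (S1_faithful ij) (S1_x i j). Qed.

Section Pair.
Variables (i j : 'I_n) (ij : i != j).
Let ji : j != i. Proof. by rewrite eq_sym. Qed.
Local Notation x := (gx i j).
Local Notation y := (gy i j).

Lemma x_di : x ^ gd i = x ^ (gd j)^-1.
Proof. by rewrite -{2}(xdd S ij) conjgM conjgK. Qed.
Lemma x_dj : x ^ gd j = x ^ (gd i)^-1.
Proof.
have e : gd i * gd j = gd j * gd i by apply: comm_conj; apply: dd.
by rewrite -{2}(xdd S ij) e conjgM conjgK.
Qed.
Lemma y_di : y ^ gd i = y ^ gd j.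
Proof. by rewrite gyE (conj_swap _ (zd S ji)) x_di conjJg conjVg dz invgK. Qed.

Lemma conj_powE (v g h : G) m : g ^ h = g -> v ^ g = v ^ h -> v ^ (g ^+ m) = v ^ (h ^+ m).
Proof.
move=> gh e; elim: m => [//|m IH].
by rewrite expgS conjgM e (conj_swap _ (conjX_fix _ (conj_sym gh))) IH expgSr conjgM.
Qed.

Lemma zij : gz i ^ gz j = gz i. Proof. exact: zz. Qed.

Lemma x_zV_t : (x ^ (gz j)^-1) ^ gt j = x ^ (gz j)^-1.
Proof.
have ex : gx j i = (x ^ (gz j)^-1) ^ gz i.
  by rewrite (xU S ij) conjgM (conj_swap _ (conjV_fix zij)).
by apply: (conjg_inj (gz i)); rewrite (conj_swap _ (tz S ji)) -ex xt.
Qed.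

Lemma y_tj : y ^ gt j = y.
Proof.
have azz : (x ^ (gz j)^-1) ^ (gz j * gz j) = y by rewrite conjgM conjgKV gyE.
by rewrite -azz -(conj_swap _ (tzz S j)) x_zV_t.
Qed.

Lemma xy_comm : x ^ y = x * gt i ^+ 2.
Proof.
have ex : gx j i = (x ^ (gz j)^-1) ^ gz i.
  by rewrite (xU S ij) conjgM (conj_swap _ (conjV_fix zij)).
have := xe S ji; rewrite ex (conj_swap _ zij) conjgKV -conjJg -conjMg.
move/conjg_inj/(congr1 (conjg^~ (gz j))).
by rewrite conjJg conjMg conjgKV conjXg (tz S ij) gyE.
Qed.

Lemma y_ti : y ^ gt i = y.
Proof. by rewrite gyE (conj_swap _ (conj_sym (tz S ij))) xt. Qed.

(** With e = y^(z_j) and v = e^(z_j), conjugating x by both sides of z = t t^z t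
   gives x y e v = t_i^2; conjugating this by t_j gives a second relation, and
   the two leave only v = y^-1. *)
Lemma yz : y ^ gz j = x^-1.
Proof.
have tz' : gt i ^ gz j = gt i by apply: tz.
have zt : gz j ^ gt i = gz j by apply: conj_sym.
have h2 := y_tj; have cy := y_ti; have hxy := xy_comm.
have h3 : x ^ (gt j ^ gz j) = x.
  by have := congr1 (conjg^~ (gz j)) x_zV_t; rewrite /= conjJg conjgKV.
have cz (b : G) : b ^ gt i = b -> (b ^ gz j) ^ gt i = b ^ gz j.
  by move=> e; rewrite (conj_swap _ zt) e.
have cx : x ^ gt i = x by apply: xt.
have [e ee] : exists e, y ^ gz j = e by exists (y ^ gz j).
have [v ev] : exists v, e ^ gz j = v by exists (e ^ gz j).
have ce : e ^ gt i = e by rewrite -ee; apply: cz.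
have cv : v ^ gt i = v by rewrite -ev; apply: cz.
have ct : gt i ^ gt j = gt i by apply: tt.
have cb : gt i ^ (gt j ^ gz j) = gt i by rewrite -{1}tz' -conjJg ct tz'.
have xtj' := xtj S ij.
have yb : y ^ (gt j ^ gz j) = y * (e * (gt i)^-1).
  by rewrite {1}gyE -conjJg xtj' conjMg conjMg -gyE ee conjVg tz'.
have ezz : e = x ^ (gz j * gz j) by rewrite conjgM -gyE ee.
have vzz : v = y ^ (gz j * gz j) by rewrite conjgM ee ev.
have etj : e ^ gt j = e * (v * (gt i)^-1).
  by rewrite {1}ezz -(conj_swap _ (tzz S j)) xtj' conjMg conjMg -ezz -vzz conjVg conjgM !tz'.
have E2 : x * y * e * v = gt i ^+ 2.
  apply: class2_relation => //.
  have {1}-> : y = ((x ^ gt j) ^ (gt j ^ gz j)) ^ gt j.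
    by rewrite -!conjgM mulgA -z_ttt // gyE.
  have -> : (x ^ gt j) ^ (gt j ^ gz j) = x * (y * (e * (gt i)^-1) * (gt i)^-1).
    by rewrite xtj' conjMg conjMg h3 yb conjVg cb.
  by rewrite conjMg xtj' conjMg conjMg conjMg h2 etj conjVg ct.
have vt : v ^ gt j = v.
  by rewrite vzz -(conj_swap _ (tzz S j)) h2.
have vy : v = y^-1.
  apply: (class2_inverse cx cy ce cv hxy E2).
  by have := congr1 (conjg^~ (gt j)) E2; rewrite /= !conjMg xtj' h2 etj vt !ct.
by apply: (conjg_inj (gz j)); rewrite ee ev vy gyE conjVg.
Qed.

Lemma x_diV : x ^ (gd i)^-1 = x ^ gd j. Proof. by rewrite x_dj. Qed.

Let dij : gd i ^ gd j = gd i. Proof. exact: dd. Qed.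
Let dji : gd j ^ gd i = gd j. Proof. exact: dd. Qed.

Lemma fix_conj2 (a g h : G) : a ^ h = a -> g ^ h = g -> (a ^ g) ^ h = a ^ g.
Proof. by move=> ah gh; rewrite conjJg ah gh. Qed.

Lemma nrm_R k l : nrm (R k) (gd l).
Proof.
apply: nrm_gen => [|_ [m ->]]; first exact: torsion_d.
apply: gen_in; have [->|lk] := eqVneq l k.
  by exists m.+1; rewrite -conjgM expgSr.
exists m; rewrite fix_conj2 //; first by apply: td; rewrite eq_sym.
by apply/conj_sym/conjX_fix; apply: dd.
Qed.

Lemma y_dd : y ^ (gd i * gd j) = y ^ (gd j * gd j).
Proof. by rewrite conjgM y_di -conjgM. Qed.
Lemma x_dVd : x ^ ((gd i)^-1 * gd j) = x ^ (gd j * gd j).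
Proof. by rewrite conjgM x_diV -conjgM. Qed.
Lemma y_dVd : y ^ ((gd i)^-1 * gd j) = y.
Proof.
by rewrite (comm_conj (conj_sym (conjV_fix dji))) conjgM -y_di conjgK.
Qed.

Let dX (k : nat) : (gd j * gd j) ^+ k = gd j ^+ k.*2.
Proof. by rewrite -expg2 -expgnA mul2n. Qed.

Lemma cdA : gd j ^ (gd i * gd j) = gd j.
Proof. by rewrite conjgM dji conjgE mulKg. Qed.
Lemma cdB : gd j ^ ((gd i)^-1 * gd j) = gd j.
Proof. by rewrite conjgM (conjV_fix dji) conjgE mulKg. Qed.

(** d_i d_j fixes x and d_i^-1 d_j fixes y, so the parameters of x and y can be
   changed independently of each other, but only by even powers of d_j. *)
Lemma xy_commX (k l : nat) : exists2 h, R i h &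
  (x ^ (gd j ^+ k.*2)) ^ (y ^ (gd j ^+ l.*2)) = x ^ (gd j ^+ k.*2) * h.
Proof.
pose tau := (gd i * gd j) ^+ l * ((gd i)^-1 * gd j) ^+ k.
have xtau : x ^ tau = x ^ (gd j ^+ k.*2).
  rewrite conjgM (conjX_fix _ (xdd S ij)) (conj_powE _ _ x_dVd) ?dX //.
  by apply: conj_sym; rewrite conjMg cdB.
have ytau : y ^ tau = y ^ (gd j ^+ l.*2).
  rewrite conjgM (conj_powE _ _ y_dd) ?dX; last by apply: conj_sym; rewrite conjMg cdA.
  by rewrite fix_conj2 //; apply: conjX_fix; rewrite ?y_dVd // conjXg cdB.
exists ((gt i ^+ 2) ^ tau); last by rewrite -xtau -ytau -conjJg xy_comm conjMg.
have nR := nrm_sub (R i); have [ni nj] := (nrm_R i i, nrm_R i j).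
apply: (nrmJ (H := R i)); last by apply: (subX (R_sub S i)); apply: R_t.
by apply: (subM nR); apply: (subX nR); apply: (subM nR) => //; apply: (subV nR).
Qed.

(** Here d_i d_j fixes x and d_i fixes t_j, so that the power of d_j on t_j is
   arbitrary. *)
Lemma x_tjX (k l : nat) : exists m, exists2 h, R i h &
  (x ^ (gd j ^+ k.*2)) ^ (gt j ^ (gd j ^+ l))
  = x ^ (gd j ^+ k.*2) * (y ^ (gd j ^+ m.*2) * h).
Proof.
have [r dr] := d_inv S.
pose tau := (gd i * gd j) ^+ l * (gd i)^-1 ^+ k.*2.
have cdi : gd j ^ (gd i)^-1 = gd j by apply: conjV_fix.
have xtau : x ^ tau = x ^ (gd j ^+ k.*2).
  by rewrite conjgM (conjX_fix _ (xdd S ij)) (conj_powE _ _ x_diV) //; apply: conj_sym.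
have ttau : gt j ^ tau = gt j ^ (gd j ^+ l).
  rewrite conjgM (_ : gt j ^ ((gd i * gd j) ^+ l) = gt j ^ (gd j ^+ l)); last first.
    by apply: conj_powE; [apply/conj_sym/cdA | rewrite conjgM td].
  rewrite fix_conj2 //; apply: conjX_fix; first by apply/conjV_fix/td.
  by rewrite conjXg cdi.
have ytau : y ^ tau = y ^ (gd j ^+ (l + r * k).*2).
  rewrite conjgM (conj_powE _ _ y_dd) ?dX; last by apply: conj_sym; rewrite conjMg cdA.
  have yV : y ^ (gd i)^-1 = y ^ (gd j)^-1.
    apply: (conjg_inj (gd j)); rewrite conjgKV (conj_swap (h := gd j)).
      by rewrite -y_di conjgK.
    by rewrite conjVg dij.
  rewrite (conj_swap (h := (gd i)^-1 ^+ k.*2)); last by apply: conjX_fix; rewrite conjXg cdi.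
  rewrite (conj_powE _ _ yV); last by rewrite conjVg; congr _^-1; apply: conjV_fix; apply: conj_sym.
  by rewrite dr -expgnA -conjgM -expgnDr doubleD addnC -!muln2 mulnA.
exists (l + r * k)%N, ((gt i)^-1 ^ tau); last first.
  by rewrite -xtau -ytau -ttau -conjJg (xtj S ij) !conjMg.
have nR := nrm_sub (R i); have [ni nj] := (nrm_R i i, nrm_R i j).
apply: (nrmJ (H := R i)); last by apply: (subV (R_sub S i)); apply: R_t.
apply: (subM nR); apply: (subX nR); last exact: (subV nR).
exact: (subM nR).
Qed.

Lemma y_tjX m (l : nat) : (y ^ (gd j ^+ m)) ^ (gt j ^ (gd j ^+ l)) = y ^ (gd j ^+ m).
Proof.
have H (a : nat) : (y ^ (gd j ^+ a)) ^ gt j = y ^ (gd j ^+ a).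
  rewrite -(conj_powE a (conj_sym dji) y_di) (conj_swap (h := gt j)) ?y_tj //.
  by apply/conj_sym/conjX_fix; apply: td.
have [r dr] := d_inv S.
have -> : gd j ^+ m = gd j ^+ (m + r * l) * gd j ^+ l.
  rewrite expgnDr expgnA -dr -mulgA; rewrite -[LHS]mulg1; congr (_ * _).
  by rewrite -expgMn ?mulVg ?expg1n //; apply/commute_sym/commuteV/commute_refl.
by rewrite [y ^ _]conjgM -conjJg H.
Qed.

End Pair.
End Rank2.

Section ShortRoots.
Variables (F : finFieldType) (w : {unit F}) (n : nat) (hn : (1 < n)%N).
Hypothesis hw : (#|F|.-1.-primitive_root (val w))%R.
Variables (G : groupType) (S : sp_system w hn G).
Local Notation phi := (sphi S).
Local Notation gx := (gx S).
Local Notation gy := (gy S).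
Local Notation gz := (gz S).
Local Notation gd := (gd S).
Local Notation gt := (gt S).
Local Notation R := (R S).
Implicit Types (i j k l : 'I_n) (p q : 'S_n) (g h : G) (m r : nat) (a b c : F).

Local Notation S1 := (S1 S).

Section Pair.
Variables (i j : 'I_n) (ij : i != j).
Let ji : j != i. Proof. by rewrite eq_sym. Qed.
Let dij : gd i ^ gd j = gd i. Proof. exact: dd. Qed.
Let dji : gd j ^ gd i = gd j. Proof. exact: dd. Qed.
Local Notation x := (gx i j).
Local Notation y := (gy i j).

(** Only conjugates by even powers of d_j are accessible until M0_xd is known.
   H2 acts by matrices e_i -> e_i + a e_j + b f_j + c f_i; R i is central in it. *)
Definition X2 g := exists m, g = x ^ (gd j ^+ m.*2).
Definition Y2 g := exists m, g = y ^ (gd j ^+ m.*2).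
Definition H2 := gen (fun g => [\/ X2 g, Y2 g | Rgen S i g]).

Lemma H2_sub : subgrp H2. Proof. exact: gen_sub. Qed.
Lemma H2_X g : X2 g -> H2 g. Proof. by move=> h; apply: gen_in; apply: Or31. Qed.
Lemma H2_Y g : Y2 g -> H2 g. Proof. by move=> h; apply: gen_in; apply: Or32. Qed.
Lemma H2_R g : R i g -> H2 g.
Proof. by move: g; apply: (gen_min H2_sub) => h hh; apply: gen_in; apply: Or33. Qed.

Lemma dX_z m : exists r, (gd j ^+ m.*2) ^ gz j = gd j ^+ r.*2.
Proof.
by have [r dr] := d_inv S; exists (r * m)%N; rewrite conjXg dz dr -expgnA -!muln2 mulnA.
Qed.

Lemma torsion_tX k m : torsion (gt k ^ (gd k ^+ m)).
Proof. exact/torsionJ/torsion_t. Qed.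

Lemma R_fix_j h g : gen (fun g => [\/ g = gt j, g = gd j | g = gz j]) g ->
  R i h -> h ^ g = h.
Proof.
move=> hg; move: h; apply: (gen_min (fix_sub g)) => _ [m ->].
apply: fix_conj2.
  move: g hg; apply: (gen_min (cent_sub _)) => _ []->; [exact: tt|exact: td|exact: tz].
apply/conj_sym/conjX_fix; move: g hg.
suff H : forall g, gen (fun g => [\/ g = gt j, g = gd j | g = gz j]) g -> gd i ^ g = gd i.
  by move=> g hg; apply/conj_sym/H.
apply: (gen_min (cent_sub _)) => _ []->; [exact/conj_sym/td | exact: dd |].
exact/conj_sym/zd.
Qed.

Lemma nrm_H2_t m : nrm H2 (gt j ^ (gd j ^+ m)).
Proof.
apply: nrm_gen => [|v [[k ->]|[k ->]|hR]]; first exact: torsion_tX.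
- have [r [h hh ->]] := x_tjX S ij k m.
  apply: (subM H2_sub); first by apply: H2_X; exists k.
  by apply: (subM H2_sub); [apply: H2_Y; exists r | apply: H2_R].
- by rewrite y_tjX //; apply: H2_Y; exists k.
- rewrite R_fix_j; [by apply: H2_R; apply: gen_in | | exact: gen_in].
  exact: (subJ (S2_sub S j) (S2_t S j) (subX (S2_sub S j) _ (S2_d S j))).
Qed.

Lemma nrm_H2_z : nrm H2 (gz j).
Proof.
apply: nrm_gen => [|v [[k ->]|[k ->]|hR]]; first exact: torsion_z.
- have [r e] := dX_z k; rewrite conjJg -gyE e.
  by apply: H2_Y; exists r.
- have [r e] := dX_z k; rewrite conjJg yz // e conjVg.
  by apply: (subV H2_sub); apply: H2_X; exists r.
- by rewrite R_fix_j; [apply: H2_R; apply: gen_in | exact: S2_z | exact: gen_in].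
Qed.

Lemma nrm_H2_d : nrm H2 (gd j).
Proof.
have := d_in hw S j; apply: (gen_min (nrm_sub H2)).
by move=> _ [[m ->]|->]; [exact: nrm_H2_t | exact: nrm_H2_z].
Qed.

Definition M0 := gen X2.
Definition N0 := gen Y2.

Lemma x_R m h : R i h -> (x ^ (gd j ^+ m)) ^ h = x ^ (gd j ^+ m).
Proof.
move: h; apply: (gen_min (cent_sub _)) => _ [k ->].
have -> : x ^ (gd j ^+ m) = (x ^ (gd j ^+ (m + k))) ^ (gd i ^+ k).
  rewrite (conj_swap (h := gd i ^+ k)); last by apply: conjX_fix; rewrite conjXg dji.
  rewrite (conj_powE k _ (x_di S ij)) ?conjVg ?(conj_sym dji) //.
    by rewrite expVgn addnC expgnDr conjgM conjgKV.
  by apply: conjV_fix.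
rewrite -conjJg; congr (_ ^ _); rewrite (conj_swap (h := gt i)) ?xt //.
by apply/conj_sym/conjX_fix/td.
Qed.

Lemma y_R m h : R i h -> (y ^ (gd j ^+ m)) ^ h = y ^ (gd j ^+ m).
Proof.
have [r dr] := d_inv S.
move: h; apply: (gen_min (cent_sub _)) => _ [k ->].
have -> : y ^ (gd j ^+ m) = (y ^ (gd j ^+ (m + r * k))) ^ (gd i ^+ k).
  rewrite (conj_swap (h := gd i ^+ k)); last by apply: conjX_fix; rewrite conjXg dji.
  rewrite (conj_powE k _ (y_di S ij)) //.
  by rewrite addnC expgnDr expgnA -dr expVgn [in RHS]conjgM -[(y ^ _) ^ _]conjgM mulgV conjg1.
rewrite -conjJg; congr (_ ^ _); rewrite (conj_swap (h := gt i)) ?y_ti //.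
by apply/conj_sym/conjX_fix/td.
Qed.

Lemma M0_R v h : M0 v -> R i h -> h ^ v = h.
Proof.
move=> hv hh; move: v hv; apply: (gen_min (cent_sub _)) => _ [m ->].
exact/conj_sym/x_R.
Qed.

Lemma N0_R v h : N0 v -> R i h -> h ^ v = h.
Proof.
move=> hv hh; move: v hv; apply: (gen_min (cent_sub _)) => _ [m ->].
exact/conj_sym/y_R.
Qed.

(** M0 and N0 commute modulo R i, which is central. *)
Lemma H2_prod g : H2 g -> prodS M0 (prodS N0 (R i)) g.
Proof.
have [hM hN hR] : [/\ subgrp M0, subgrp N0 & subgrp (R i)].
  by split; [exact: gen_sub|exact: gen_sub|exact: R_sub].
have hNR : subgrp (prodS N0 (R i)).
  apply: prodS_sub => // v hv; split=> h hh; last rewrite conjV_fix; rewrite ?(N0_R hv) //.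
have hMNR : subgrp (prodS M0 (prodS N0 (R i))).
  apply: prodS_sub => //; apply: (gen_min (nrm_sub _)) => _ [k ->].
  apply: nrm_torsion; first exact/torsionJ/(torsion_x S ij).
  have hx : M0 (x ^ (gd j ^+ k.*2)) by apply: gen_in; exists k.
  move=> _ [v [h [hv hh ->]]]; rewrite conjMg (M0_R hx hh).
  apply: (subM hNR); last exact: prodS_r.
  move: v hv; apply: gen_conj => // _ [l ->].
  have [h' hh' e] := xy_commX S ij k l.
  set a := x ^ _ in hx e *; set b := y ^ _ in e *.
  have -> : b ^ a = b * h'^-1.
    have ba : b * a = a * b * h'^-1 by rewrite [a * b]conjgC e !mulgA mulgK.
    by apply: (mulgI a); rewrite -(conjgC b a) ba -mulgA.
  by exists b, h'^-1; split; [apply: gen_in; exists l | exact: (subV hR) |].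
apply: (gen_min hMNR) => v [hv|hv|hv].
- by apply: prodS_l => //; apply: gen_in.
- by apply: prodS_r => //; apply: prodS_l => //; apply: gen_in.
- by apply: prodS_r => //; apply: prodS_r => //; apply: gen_in.
Qed.

Lemma isX_sub : subgrp (fun g => exists a, isX i j a (phi g)).
Proof.
split=> [|g h [a ha] [b hb]|g [a ha]].
- by exists 0%R; rewrite phi1; apply: isX1.
- by exists (a + b)%R; rewrite sphiM; apply: isXM.
- by exists (- a)%R; rewrite phiV; apply: isXV.
Qed.

Lemma M0_isX g : M0 g -> exists a, isX i j a (phi g).
Proof.
move: g; apply: (gen_min isX_sub) => _ [m ->].
elim: (m.*2) => [|k [a ha]]; first by exists 1%R; rewrite conjg1; apply: isXx.
exists (a / val w)%R; rewrite expgSr conjgM phiJ.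
by apply: isX_Dj ha (isDd S j); rewrite ?w0.
Qed.

Lemma M0_S1 g : M0 g -> S1 i j g.
Proof.
move: g; apply: (gen_min (S1_sub S i j)) => _ [m ->].
have -> : x ^ (gd j ^+ m.*2) = x ^ (((gd j)^-1 * gd i)^-1 ^+ m).
  rewrite invgM invgK (conj_powE m _ (x_dVd S ij)).
    by rewrite -expg2 -expgnA mul2n.
  by apply: conj_sym; rewrite conjMg cdB.
apply: (subJ (S1_sub S i j)); first exact: S1_x.
by apply: (subX (S1_sub S i j)); apply: (subV (S1_sub S i j)); apply: S1_d.
Qed.

(** d_j is a product of long root elements and z_j, which normalise H2.  In the
   normal form of x^(d_j) in H2 the factors from N0 and R i are trivial because
   phi is faithful on each of them and maps x^(d_j) to a matrix e_i -> e_i + a e_j. *)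
Lemma M0_xd : M0 (x ^ gd j).
Proof.
have /H2_prod[m1 [_ [hm1 [n1 [h [hn1 hh ->]]] e]]] : H2 (x ^ gd j).
  apply: (nrmJ nrm_H2_d); apply: H2_X; exists 0%N.
  by rewrite conjg1.
have ex := isX_Dj ij (w0 w) (isXx S ij) (isDd S j); rewrite -phiJ e !sphiM in ex.
have [a ha] := M0_isX hm1.
have [n2 hn2 en] : exists2 n2, M0 n2 & n1 = n2 ^ gz j.
  move: n1 hn1 {e ex}; apply: gen_min.
    split=> [|u v [u' hu ->] [v' hv ->]|u [u' hu ->]].
    - by exists 1; [exact: gen_one | rewrite conj1g].
    - by exists (u' * v'); [exact: gen_mul | rewrite conjMg].
    - by exists u'^-1; [exact: gen_inv | rewrite conjVg].
  move=> _ [m ->]; have [r er] := dX_z m; exists (x ^ (gd j ^+ r.*2)).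
    by apply: gen_in; exists r.
  have ez : ((gd j ^+ m.*2) ^ gz j) ^ gz j = gd j ^+ m.*2.
    by rewrite -[LHS]conjgM conjXg dzz.
  by rewrite -er [RHS]conjJg ez -gyE.
have [b hb] := M0_isX hn2.
have hY : isY i j b (phi n1) by rewrite en phiJ; apply: isX_Z (isZz S j).
have [c hc] := R_isT hh.
have b0 : b = 0%R.
  have := (ex (evec F i) j).2; rewrite !actM !hc !hY !ha !ec_e !fc_e !eqxx (negPf ij) (negPf ji).
  by rewrite /= !(mulr0n, mulr1n, mul0r, mulr0, mul1r, mulr1, subr0, add0r, addr0, oppr0) => <-.
have n21 : n1 = 1.
  rewrite en; have -> : n2 = 1; last by rewrite conj1g.
  by apply: (S1_faithful (S := S) ij (M0_S1 hn2)); apply: (isX_eq1 (i := i) (j := j)); rewrite -b0.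
have c0 : c = 0%R.
  have := (ex (evec F i) i).2; rewrite !actM !hc !hY !ha b0 !ec_e !fc_e !eqxx (negPf ij).
  by rewrite /= !(mulr0n, mulr1n, mul0r, mulr0, mul1r, mulr1, subr0, add0r, addr0, oppr0) => <-.
have h1 : h = 1 by apply: (R_eq1 hh); rewrite -c0.
by rewrite e n21 h1 !mulg1.
Qed.

Lemma M0_xdX m : M0 (x ^ (gd j ^+ m)).
Proof.
rewrite -[m]odd_double_half expgnDr; case: (odd m); last first.
  by rewrite mul1g; apply: gen_in; exists m./2.
rewrite expg1 conjgM; have := M0_xd; apply: gen_conj; first exact: gen_sub.
move=> _ [k ->]; apply: gen_in; exists (k + m./2)%N.
by rewrite doubleD expgnDr conjgM.
Qed.

End Pair.

(** Described as an orbit of the torus, so that relations of x_ij pass to all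
   elements by conjugation.  That this is a subgroup follows in SL(2,q), where
   the parameter determines the element. *)
Definition M i j g := g = 1 \/ exists m, g = gx i j ^ (gd i ^+ m).

Section RootGroup.
Variables (i j : 'I_n) (ij : i != j).

Lemma M_x m : M i j (gx i j ^ (gd i ^+ m)). Proof. by right; exists m. Qed.

Lemma M_S1 g : M i j g -> S1 i j g.
Proof.
case=> [->|[m ->]]; first exact: sub1 (S1_sub S i j).
have [r dr] := d_inv S; apply: (M0_S1 ij).
rewrite (conj_powE m _ (x_di S ij)).
  by rewrite dr -expgnA; apply: M0_xdX.
by apply/conjV_fix; apply: dd.
Qed.

Lemma isX_gen m : isX i j (val w ^+ m)%R (phi (gx i j ^ (gd i ^+ m))).
Proof.
elim: m => [|m IH]; first by rewrite conjg1; apply: isXx.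
rewrite expgSr conjgM phiJ exprSr.
by apply: isX_Di IH (isDd S i); rewrite ?w0.
Qed.

Lemma M_isX g : M i j g -> exists a, isX i j a (phi g).
Proof.
case=> [->|[m ->]]; first by exists 0%R; rewrite phi1; apply: isX1.
by eexists; apply: isX_gen.
Qed.

Lemma M_onto a : exists2 g, M i j g & isX i j a (phi g).
Proof.
have [->|a0] := eqVneq a 0%R.
  by exists 1; [left | rewrite phi1; apply: isX1].
by have [m ->] := w_pow hw a0; eexists; [apply: M_x | apply: isX_gen].
Qed.

Lemma S1_isX_eq a g h : S1 i j g -> S1 i j h -> isX i j a (phi g) ->
  isX i j a (phi h) -> g = h.
Proof.
move=> hg hh ga ha; apply: (S1_eq (S := S) ij hg hh).
by apply: spP => v k; rewrite !ga !ha.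
Qed.

Lemma M_eq1 g : M i j g -> isX i j 0 (phi g) -> g = 1.
Proof. by move=> hg h0; apply: (S1_faithful (S := S) ij (M_S1 hg)); exact: isX_eq1 h0. Qed.

Lemma S1_M g a : S1 i j g -> isX i j a (phi g) -> M i j g.
Proof. by move=> hg ha; have [h hh /(S1_isX_eq hg (M_S1 hh) ha) ->] := M_onto a. Qed.

Lemma M_sub : subgrp (M i j).
Proof.
have hS := S1_sub S i j.
split=> [|g h hg hh|g hg]; first by left.
- have [[a ha] [b hb]] := (M_isX hg, M_isX hh).
  apply: (S1_M (a := (a + b)%R)); first by apply: (subM hS); apply: M_S1.
  by rewrite sphiM; apply: isXM.
- have [a ha] := M_isX hg; apply: (S1_M (a := (- a)%R)); first by apply: (subV hS); apply: M_S1.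
  by rewrite phiV; apply: isXV.
Qed.

Lemma M_abel g h : M i j g -> M i j h -> g ^ h = g.
Proof.
move=> hg hh; have [[a ha] [b hb]] := (M_isX hg, M_isX hh).
have hS := S1_sub S i j.
apply: conj_comm; apply: (S1_isX_eq (a := (a + b)%R)).
- by apply: (subM hS); apply: M_S1.
- by apply: (subM hS); apply: M_S1.
- by rewrite sphiM; apply: isXM.
- by rewrite sphiM addrC; apply: isXM.
Qed.

End RootGroup.
End ShortRoots.

(** * Unipotent radicals *)

Section Radical.
Variables (F : finFieldType) (w : {unit F}) (n : nat) (hn : (1 < n)%N).
Hypothesis hw : (#|F|.-1.-primitive_root (val w))%R.
Variables (G : groupType) (S : sp_system w hn G).
Local Notation gx := (gx S).
Local Notation gy := (gy S).
Local Notation gz := (gz S).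
Local Notation gd := (gd S).
Local Notation R := (R S).
Implicit Types (i j k l : 'I_n) (p q : 'S_n) (g h : G) (m r : nat) (a b c : F).

Implicit Types (J : {set 'I_n}).

Lemma x_zz i j : i != j -> gx i j ^ (gz i * gz i) = (gx i j)^-1.
Proof.
move=> ij; have ji : j != i by rewrite eq_sym.
have := yz S ji; rewrite gyE -[LHS]conjgM (xU S ij) -conjVg => e.
apply: (conjg_inj (gz i * (gz j)^-1)); rewrite -e; apply: conj_swap.
have e1 : gz i ^ (gz i * (gz j)^-1) = gz i.
  by rewrite [LHS]conjgM (conj_comm (erefl (gz i * gz i))) conjV_fix // (zz S ij).
by rewrite conjMg e1.
Qed.

Lemma gyC i j : i != j -> gy i j = gy j i.
Proof.
move=> ij; have ji : j != i by rewrite eq_sym.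
have zij : (gz j)^-1 ^ gz i = (gz j)^-1 by rewrite conjVg (zz S ji).
rewrite (gyE S j i) (xU S ij) -conjgM -mulgA [(gz j)^-1 * _]conjgC zij mulgA conjgM.
by rewrite x_zz // -(yz S ij) conjgK.
Qed.

(* Conjugating M0_xdX by z_j removes the restriction to even powers for y too. *)
Lemma N0_yX i j m : i != j -> N0 S i j (gy i j ^ (gd j ^+ m)).
Proof.
move=> ij; have [r dr] := d_inv S.
have : N0 S i j ((gx i j ^ (gd j ^+ (r * m))) ^ gz j).
  move: (M0_xdX hw S ij (r * m)); apply: gen_conj; first exact: gen_sub.
  move=> _ [k ->]; have [l e] := dX_z S j k; apply: gen_in; exists l.
  by rewrite conjJg -gyE e.
by rewrite conjJg -gyE conjXg dz expgnA expVgn -dr invgK.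
Qed.

Lemma xy_R i j g v : i != j -> M0 S i j g -> N0 S i j v ->
  exists2 h, R i h & v ^ g = v * h.
Proof.
move=> ij; apply: comm_gen; first exact: R_sub.
- by move=> a k ha hk; apply: (M0_R ij) hk; apply: gen_in.
- by move=> a k ha hk; apply: (N0_R ij) hk; apply: gen_in.
move=> _ _ [k ->] [l ->]; have [h hh e] := xy_commX S ij k l.
by exists h^-1; [exact: (subV (R_sub S i)) | exact: swap_comm].
Qed.

End Radical.

Section Levi.
Variables (F : finFieldType) (w : {unit F}) (n : nat) (hn : (1 < n)%N).
Hypothesis hw : (#|F|.-1.-primitive_root (val w))%R.
Variables (G : groupType) (S : sp_system w hn G).
Local Notation i1 := (ix2 hn).
Local Notation pi := (spi S).
Local Notation gx := (gx S).
Local Notation gy := (gy S).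
Local Notation gz := (gz S).
Local Notation gd := (gd S).
Local Notation gt := (gt S).
Local Notation R := (R S).
Implicit Types (i j k l : 'I_n) (p q : 'S_n) (g h : G) (m r : nat) (a b c : F).

Local Notation M := (M S).
Implicit Types (J : {set 'I_n}).

Lemma y_zk i j k : i != j -> k != i -> k != j -> gy i j ^ gz k = gy i j.
Proof.
move=> ij ki kj; have jk : j != k by rewrite eq_sym.
by rewrite gyE (conj_swap _ (zz S jk)) xz.
Qed.
Lemma y_dk i j k : i != j -> k != i -> k != j -> gy i j ^ gd k = gy i j.
Proof.
move=> ij ki kj; have jk : j != k by rewrite eq_sym.
by rewrite gyE (conj_swap _ (zd S jk)) xd.
Qed.
Lemma y_tk i j k : i != j -> k != i -> k != j -> gy i j ^ gt k = gy i j.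
Proof.
by move=> ij ki kj; rewrite gyE (conj_swap _ (conj_sym (tz S kj))) xtk.
Qed.
Lemma y_xjk i j k : i != j -> k != i -> k != j -> gy i j ^ gx j k = gy i j.
Proof.
move=> ij ki kj; have ji : j != i by rewrite eq_sym.
have zx : gz i ^ gx j k = gz i by apply/conj_sym/xz; rewrite // 1?eq_sym.
by rewrite gyC // gyE (conj_swap _ zx) xxb.
Qed.
Lemma y_xkj i j k : i != j -> k != i -> k != j ->
  gy i j ^ gx k j = gy i j * (gy i k)^-1.
Proof.
move=> ij ki kj; have [ji ik] : j != i /\ i != k by split; rewrite eq_sym.
have zx : gz i ^ gx k j = gz i by apply/conj_sym/xz; rewrite // 1?eq_sym.
rewrite (gyC S ij) (gyC S ik) !gyE (conj_swap _ zx) -conjVg -conjMg.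
by congr (_ ^ _); apply: swap_comm; apply: xxa; rewrite // 1?eq_sym //.
Qed.
Lemma y_xkl i j k l : i != j -> k != i -> k != j -> l != i -> l != j -> k != l ->
  gy i j ^ gx k l = gy i j.
Proof.
move=> ij ki kj li lj kl.
have zx : gz j ^ gx k l = gz j by apply/conj_sym/xz; rewrite // 1?eq_sym.
by rewrite gyE (conj_swap _ zx) xxd.
Qed.
Lemma x_yk i j k : i != j -> k != i -> k != j -> gy i k ^ gx i j = gy i k.
Proof.
move=> ij ki kj; have [ik jk] : i != k /\ j != k by split; rewrite eq_sym.
by rewrite gyE -{1}(xz S ij ki kj) -conjJg xxb // eq_sym.
Qed.

Definition torus := gen (fun g => exists j, g = gd j).

Lemma torus_sub : subgrp torus. Proof. exact: gen_sub. Qed.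
Lemma torus_d j : torus (gd j). Proof. by apply: gen_in; exists j. Qed.
Lemma torus_abel g h : torus g -> torus h -> g ^ h = g.
Proof.
move=> hg hh; move: g hg; apply: (gen_min (fix_sub h)) => _ [j ->].
move: h hh; apply: (gen_min (cent_sub _)) => _ [k ->].
by have [->|jk] := eqVneq j k; [rewrite conjgE mulKg | apply: dd].
Qed.
Lemma torus_dX j m : torus (gd j ^+ m).
Proof. exact: (subX torus_sub _ (torus_d j)). Qed.
Lemma torus_dVX j m : torus ((gd j)^-1 ^+ m).
Proof. exact: (subX torus_sub _ (subV torus_sub (torus_d j))). Qed.

(* Extends a relation between root elements v, v' to torus conjugates, when each
   can be moved by a torus element that fixes the other. *)
Lemma tor_conj (v v' p q : G) : v ^ q = v -> p ^ q = p -> v' ^ p = v' ->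
  (v ^ p) ^ (v' ^ q) = ((v ^ v') ^ p) ^ q.
Proof.
move=> vq pq vp; rewrite [(v ^ v') ^ p]conjJg vp [RHS]conjJg.
by rewrite (conj_swap v pq) vq.
Qed.

Lemma x_dE i j m : i != j -> gx i j ^ (gd i ^+ m) = gx i j ^ ((gd j)^-1 ^+ m).
Proof.
by move=> ij; apply: conj_powE (x_di S ij); apply/conjV_fix/dd.
Qed.
Lemma y_dE i j m : i != j -> gy i j ^ (gd i ^+ m) = gy i j ^ (gd j ^+ m).
Proof. by move=> ij; apply: conj_powE (y_di S ij); apply: dd. Qed.

Lemma M0_x i j m : i != j -> M0 S i j (gx i j ^ (gd i ^+ m)).
Proof.
move=> ij; have [r dr] := d_inv S; rewrite x_dE // dr -expgnA.
exact: M0_xdX.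
Qed.
Lemma N0_y i j m : i != j -> N0 S i j (gy i j ^ (gd i ^+ m)).
Proof. by move=> ij; rewrite y_dE //; apply: N0_yX. Qed.

Lemma torsion_xd i j m : i != j -> torsion (gx i j ^ (gd i ^+ m)).
Proof. by move=> ij; apply/torsionJ/torsion_x. Qed.

(** For J1 = J2 = J this is the unipotent radical of the stabiliser of f_i in the
   symplectic group on the indices of J and i.  Two sets are allowed, so that a
   single root element x_ij can be left out. *)
Definition Qgen i (J1 J2 : {set 'I_n}) g :=
  [\/ exists2 j, j \in J1 & exists m, g = gx i j ^ (gd i ^+ m),
      exists2 j, j \in J2 & exists m, g = gy i j ^ (gd i ^+ m) | Rgen S i g].
Definition Q i J1 J2 := gen (Qgen i J1 J2).

Lemma Q_sub i J1 J2 : subgrp (Q i J1 J2). Proof. exact: gen_sub. Qed.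
Lemma Q_x i (J1 J2 : {set 'I_n}) j m : j \in J1 -> Q i J1 J2 (gx i j ^ (gd i ^+ m)).
Proof. by move=> hj; apply: gen_in; apply: Or31; exists j => //; exists m. Qed.
Lemma Q_y i (J1 J2 : {set 'I_n}) j m : j \in J2 -> Q i J1 J2 (gy i j ^ (gd i ^+ m)).
Proof. by move=> hj; apply: gen_in; apply: Or32; exists j => //; exists m. Qed.
Lemma Q_R i (J1 J2 : {set 'I_n}) g : R i g -> Q i J1 J2 g.
Proof. by move: g; apply: (gen_min (Q_sub i J1 J2)) => g hg; apply: gen_in; apply: Or33. Qed.
Lemma QS i (J1 J2 J1' J2' : {set 'I_n}) g : J1 \subset J1' -> J2 \subset J2' ->
  Q i J1 J2 g -> Q i J1' J2' g.
Proof.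
move=> s1 s2; apply: genS => v [[j hj [m ->]]|[j hj [m ->]]|hv].
- by apply: Q_x; move/fintype.subsetP: s1; apply.
- by apply: Q_y; move/fintype.subsetP: s2; apply.
- by apply: Q_R; apply: gen_in.
Qed.

Lemma notin_neq i j (J : {set 'I_n}) : i \notin J -> j \in J -> i != j.
Proof. by move=> iJ jJ; apply: contraNneq iJ => ->. Qed.

Lemma nrm_Q_x i k (J1 J2 : {set 'I_n}) m : i \notin J1 -> i \notin J2 -> i != k ->
  nrm (Q i J1 J2) (gx i k ^ (gd i ^+ m)).
Proof.
move=> i1 i2 ik; have ki : k != i by rewrite eq_sym.
apply: nrm_gen => [|v [[j hj [a ->]]|[j hj [a ->]]|hv]]; first exact: torsion_xd.
- have ij := notin_neq i1 hj; have [->|jk] := eqVneq k j.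
    by rewrite (M_abel hw (S := S) ij); [apply: Q_x | exact: M_x | exact: M_x].
  have [ji jk'] : j != i /\ j != k by split; rewrite eq_sym.
  rewrite [gx i j ^ _]x_dE // [gx i k ^ _]x_dE // tor_conj.
  + rewrite xxb // -x_dE // fix_conj2; [exact: Q_x | | ].
      by apply/conjX_fix/conjV_fix/xd.
    by apply: torus_abel; [apply: torus_dX | apply: torus_dVX].
  + by apply/conjX_fix/conjV_fix/xd.
  + by apply: torus_abel; apply: torus_dVX.
  + by apply/conjX_fix/conjV_fix/xd.
- have ij := notin_neq i2 hj; have [->|jk] := eqVneq k j.
    have [h hh ->] := xy_R ij (M0_x m ij) (N0_y a ij).
    by apply: (subM (Q_sub _ _ _)); [apply: Q_y | apply: Q_R].
  have [ji jk'] : j != i /\ j != k by split; rewrite eq_sym.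
  have dk : gd j ^+ a ^ ((gd k)^-1 ^+ m) = gd j ^+ a.
    by apply: torus_abel; [apply: torus_dX | apply: torus_dVX].
  have yk : gy i j ^ ((gd k)^-1 ^+ m) = gy i j by apply/conjX_fix/conjV_fix/y_dk.
  rewrite [gy i j ^ _]y_dE // [gx i k ^ _]x_dE // tor_conj //.
    by rewrite x_yk // fix_conj2 // -y_dE //; apply: Q_y.
  by apply/conjX_fix/xd.
- by rewrite (M0_R (S := S) ik) //; [apply: Q_R; apply: gen_in | apply: M0_x | apply: gen_in].
Qed.

Lemma nrm_Q_M i k (J1 J2 : {set 'I_n}) g : i \notin J1 -> i \notin J2 -> i != k ->
  M i k g -> nrm (Q i J1 J2) g.
Proof.
by move=> i1 i2 ik [->|[m ->]]; [apply: (sub1 (nrm_sub _)) | apply: nrm_Q_x].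
Qed.

(** The part of the group that belongs to the symplectic group on the indices
   in J. *)
Definition Lgen J g :=
  [\/ exists2 p : 'S_n, (forall k, k \notin J -> p k = k) & g = pi p,
      exists2 j, j \in J & [\/ g = gz j, g = gd j | g = gt j] |
      exists j k, [/\ j \in J, k \in J, j != k & g = gx j k]].
Definition L J := gen (Lgen J).

Lemma L_sub J : subgrp (L J). Proof. exact: gen_sub. Qed.
Lemma L_p J (p : 'S_n) : (forall k, k \notin J -> p k = k) -> L J (pi p).
Proof. by move=> hp; apply: gen_in; apply: Or31; exists p. Qed.
Lemma L_z J j : j \in J -> L J (gz j).
Proof. by move=> hj; apply: gen_in; apply: Or32; exists j => //; apply: Or31. Qed.
Lemma L_d J j : j \in J -> L J (gd j).
Proof. by move=> hj; apply: gen_in; apply: Or32; exists j => //; apply: Or32. Qed.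
Lemma L_t J j : j \in J -> L J (gt j).
Proof. by move=> hj; apply: gen_in; apply: Or32; exists j => //; apply: Or33. Qed.
Lemma L_x J j k : j \in J -> k \in J -> j != k -> L J (gx j k).
Proof. by move=> hj hk jk; apply: gen_in; apply: Or33; exists j, k. Qed.
Lemma L_dX J j m : j \in J -> L J (gd j ^+ m).
Proof. by move=> hj; apply: (subX (L_sub J)); apply: L_d. Qed.
Lemma L_xd J j k m : j \in J -> k \in J -> j != k -> L J (gx j k ^ (gd j ^+ m)).
Proof. by move=> hj hk jk; apply: (subJ (L_sub J)); [apply: L_x | apply: L_dX]. Qed.
Lemma L_yd J j k m : j \in J -> k \in J -> j != k -> L J (gy j k ^ (gd j ^+ m)).
Proof.
move=> hj hk jk; apply: (subJ (L_sub J)); last exact: L_dX.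
by rewrite gyE; apply: (subJ (L_sub J)); [apply: L_x | apply: L_z].
Qed.
Lemma L_R J j g : j \in J -> R j g -> L J g.
Proof.
move=> hj; move: g; apply: (gen_min (L_sub J)) => _ [m ->].
by apply: (subJ (L_sub J)); [apply: L_t | apply: L_dX].
Qed.

Lemma torsion_pi (p : 'S_n) : torsion (pi p).
Proof.
exists #[p]%g; first exact: order_gt0.
by rewrite -(homX (spiM S)) expg_order pi1.
Qed.

Lemma L_fix i J g : i \notin J -> L J g ->
  [/\ gd i ^ g = gd i, gz i ^ g = gz i & gt i ^ g = gt i].
Proof.
move=> iJ hg; split; move: g hg; apply: (gen_min (cent_sub _)) => _
  [[p hp ->]|[j hj []->]|[j [k [hj hk jk ->]]]].
all: try (by rewrite ?dJ ?zJ ?tJ hp).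
all: have ij := notin_neq iJ hj; have ji : j != i by rewrite eq_sym.
all: try (have ik := notin_neq iJ hk).
- exact/conj_sym/zd.
- exact: dd.
- exact/conj_sym/td.
- exact/conj_sym/xd.
- exact: zz.
- exact: zd.
- exact/conj_sym/tz.
- exact/conj_sym/xz.
- exact: tz.
- exact: td.
- exact: tt.
- exact/conj_sym/xtk.
Qed.

Lemma perm_stable J (p : 'S_n) k : (forall k, k \notin J -> p k = k) ->
  k \in J -> p k \in J.
Proof.
move=> hp hk; apply/negPn/negP=> hpk; have := hp _ hpk.
by move/perm_inj => e; rewrite e hk in hpk.
Qed.

(** The case distinctions run through the commutator relations between a root
   element that involves i and a generator of L J. *)
Lemma nrm_Q_L i J g : i \notin J -> L J g -> nrm (Q i J J) g.
Proof.
move=> iJ; move: g; apply: (gen_min (nrm_sub _)) => g hg.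
have tg : torsion g.
  case: hg => [[p _ ->]|[j _ []->]|[j [k [_ _ jk ->]]]]; [exact: torsion_pi|exact: torsion_z|
    exact: torsion_d|exact: torsion_t|exact: torsion_x].
have [gdi _ gti] := L_fix iJ (gen_in hg).
have Qs := Q_sub i J J.
have diX m : (gd i ^+ m) ^ g = gd i ^+ m by rewrite conjXg gdi.
have Qd m v : Q i J J v -> Q i J J (v ^ (gd i ^+ m)).
  apply: nrmJ; apply: (subX (nrm_sub _)); apply: nrm_gen; first exact: torsion_d.
  move=> _ [[j hj [l ->]]|[j hj [l ->]]|[l ->]]; rewrite -conjgM -expgSr.
  - exact: Q_x.
  - exact: Q_y.
  - by apply: Q_R; apply: gen_in; exists l.+1.
have Qx j : j \in J -> Q i J J (gx i j) by move=> hj; have := Q_x i J 0 hj; rewrite conjg1; apply.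
have Qy j : j \in J -> Q i J J (gy i j) by move=> hj; have := Q_y i J 0 hj; rewrite conjg1; apply.
have QM : forall u v, Q i J J u -> Q i J J v -> Q i J J (u * v) by move=> *; apply: (subM Qs).
have QV : forall u, Q i J J u -> Q i J J u^-1 by move=> *; apply: (subV Qs).
have Qt : Q i J J (gt i) by apply: Q_R; apply: R_t.
have [r dr] := d_inv S.
apply: nrm_gen => // v [[j hj [m ->]]|[j hj [m ->]]|[m ->]].
- rewrite (conj_swap _ (diX m)); apply: (Qd m).
  have ij := notin_neq iJ hj; have ji : j != i by rewrite eq_sym.
  case: hg => [[p hp ->]|[k hk hg]|[k [l [hk hl kl ->]]]].
  + by rewrite xJ // hp //; apply: Qx; apply: perm_stable hp hj.
  + have [ekj|kj] := eqVneq k j.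
      move: hg; rewrite ekj; case=> ->; first by rewrite -gyE; apply: Qy.
        by rewrite x_dj // dr; apply: Q_x.
      by rewrite xtj //; apply: (QM _ _ (Qx _ hj)); apply: QM; [apply: Qy | apply: QV].
    have ki : k != i by rewrite eq_sym; apply: notin_neq iJ hk.
    by case: hg => ->; rewrite ?xz ?xd ?xtk //; apply: Qx.
  + have [ki li] : k != i /\ l != i by split; rewrite eq_sym; apply: (notin_neq iJ).
    have [ekj|kj] := eqVneq k j.
      have lj : l != j by rewrite -ekj eq_sym.
      by rewrite ekj xxa //; apply: QM; apply: Qx.
    have [elj|lj] := eqVneq l j; first by rewrite elj xxc //; apply: Qx.
    by rewrite xxd //; apply: Qx.
- rewrite (conj_swap _ (diX m)); apply: (Qd m).
  have ij := notin_neq iJ hj; have ji : j != i by rewrite eq_sym.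
  case: hg => [[p hp ->]|[k hk hg]|[k [l [hk hl kl ->]]]].
  + by rewrite yJ // hp //; apply: Qy; apply: perm_stable hp hj.
  + have [ekj|kj] := eqVneq k j.
      move: hg; rewrite ekj; case=> ->; first by rewrite yz //; apply: QV; apply: Qx.
        by rewrite -y_di //; apply: (Q_y i J 1 hj).
      by rewrite y_tj //; apply: Qy.
    have ki : k != i by rewrite eq_sym; apply: notin_neq iJ hk.
    by case: hg => ->; rewrite ?y_zk ?y_dk ?y_tk //; apply: Qy.
  + have [ki li] : k != i /\ l != i by split; rewrite eq_sym; apply: (notin_neq iJ).
    have [ekj|kj] := eqVneq k j.
      have lj : l != j by rewrite -ekj eq_sym.
      by rewrite ekj y_xjk //; apply: Qy.
    have [elj|lj] := eqVneq l j.
      have kj' : k != j by [].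
      by rewrite elj y_xkj //; apply: (QM _ _ (Qy _ hj)); apply: QV; apply: Qy.
    by rewrite y_xkl //; apply: Qy.
- by rewrite (conj_swap _ (diX m)); apply: (Qd m); rewrite gti.
Qed.

End Levi.

Section RadicalFaithful.
Variables (F : finFieldType) (w : {unit F}) (n : nat) (hn : (1 < n)%N).
Hypothesis hw : (#|F|.-1.-primitive_root (val w))%R.
Variables (G : groupType) (S : sp_system w hn G).
Local Notation i1 := (ix2 hn).
Local Notation phi := (sphi S).
Local Notation gx := (gx S).
Local Notation gy := (gy S).
Local Notation gz := (gz S).
Local Notation gd := (gd S).
Local Notation R := (R S).
Implicit Types (i j k l : 'I_n) (p q : 'S_n) (g h : G) (m r : nat) (a b c : F).

Local Notation M := (M S).
Local Notation Q := (Q S).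
Local Notation L := (L S).
Local Notation gact g v := (vact v (phi g)).
Implicit Types (J : {set 'I_n}) (v : 'rV[F]_(n + n)).

Lemma act1g v : gact 1 v = v. Proof. by rewrite phi1 act1. Qed.
Lemma actMg g h v : gact (g * h) v = gact h (gact g v).
Proof. by rewrite sphiM actM. Qed.

Lemma fix_act_sub v : subgrp (fun g => gact g v = v).
Proof.
split=> [|g h hg hh|g hg]; first exact: act1g.
- by rewrite actMg hg.
- by rewrite -{1}hg phiV actK.
Qed.

(* For g^-1, the vector v is written as an image under g. *)
Lemma coord_sub (T : Type) (c : 'rV[F]_(n + n) -> T) :
  subgrp (fun g => forall v, c (gact g v) = c v).
Proof.
split=> [v|g h hg hh v|g hg v]; first by rewrite act1g.
- by rewrite actMg hh hg.
- by rewrite -[in RHS](actKV v (phi g)) -phiV hg.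
Qed.

Lemma isY_y i j m : i != j -> isY i j (val w ^+ m)%R (phi (gy i j ^ (gd i ^+ m))).
Proof.
move=> ij; have := isX_Z ij (isX_gen S ij m) (isZz S j).
rewrite -phiJ conjJg -gyE (_ : (gd i ^+ m) ^ gz j = gd i ^+ m) //.
by rewrite conjXg; congr (_ ^+ _); apply/conj_sym/zd; rewrite eq_sym.
Qed.

Lemma Q_coord i J1 J2 g k v : Q i J1 J2 g -> i \notin J1 -> i \notin J2 ->
  k \notin J1 -> k \notin J2 -> k != i ->
  ec (gact g v) k = ec v k /\ fc (gact g v) k = fc v k.
Proof.
move=> hg i1 i2 k1 k2 ki.
suff /(_ v) [-> ->] : forall v, (ec (gact g v) k, fc (gact g v) k) = (ec v k, fc v k) by [].
move: g hg; apply: (gen_min (coord_sub (fun v => (ec v k, fc v k)))).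
move=> _ [[j hj [m ->]]|[j hj [m ->]]|[m ->]] u.
- have ij := notin_neq i1 hj; have kj := notin_neq k1 hj; rewrite !(isX_gen S ij m).
  by rewrite (negPf ki) (negPf kj) !mul0r addr0 subr0.
- have ij := notin_neq i2 hj; have kj := notin_neq k2 hj; rewrite !(isY_y m ij).
  by rewrite (negPf ki) (negPf kj) !mul0r !addr0.
- by rewrite !(isT_gen S i m) (negPf ki) !mul0r addr0.
Qed.

Lemma Q_ei i J1 J2 g v : Q i J1 J2 g -> i \notin J1 -> i \notin J2 ->
  ec (gact g v) i = ec v i.
Proof.
move=> hg i1 i2; move: g hg v; apply: (gen_min (coord_sub (fun v => ec v i))).
move=> _ [[j hj [m ->]]|[j hj [m ->]]|[m ->]] u.
- have ij := notin_neq i1 hj; rewrite (isX_gen S ij m _ _).1.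
  by rewrite (negPf ij) !mul0r addr0.
- by have ij := notin_neq i2 hj; rewrite (isY_y m ij _ _).1.
- by rewrite (isT_gen S i m _ _).1.
Qed.

Lemma Q_fi i J1 J2 g : Q i J1 J2 g -> i \notin J1 -> i \notin J2 ->
  gact g (fvec F i) = fvec F i.
Proof.
move=> hg i1 i2; move: g hg; apply: (gen_min (fix_act_sub _)).
move=> _ [[j hj [m ->]]|[j hj [m ->]]|[m ->]]; apply: coordP => k.
- have ij := notin_neq i1 hj; rewrite !(isX_gen S ij m) !ec_f !fc_f.
  by rewrite [j == i]eq_sym (negPf ij) !mulr0 addr0 subr0.
- have ij := notin_neq i2 hj; rewrite !(isY_y m ij) !ec_f !fc_f.
  by rewrite !mulr0 !addr0.
- by rewrite !(isT_gen S i m) !ec_f mulr0 addr0.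
Qed.

Lemma L_coord i J g v : i \notin J -> L J g ->
  ec (gact g v) i = ec v i /\ fc (gact g v) i = fc v i.
Proof.
move=> iJ hg.
suff /(_ v) [-> ->] : forall v, (ec (gact g v) i, fc (gact g v) i) = (ec v i, fc v i) by [].
move: g hg; apply: (gen_min (coord_sub (fun v => (ec v i, fc v i)))).
move=> _ [[p hp ->]|[j hj []->]|[j [k [hj hk jk ->]]]] u.
- by rewrite sphi_pi !isP_sp -{1 2}(hp _ iJ) permK.
- by rewrite !(isZz S j) (negPf (notin_neq iJ hj)).
- by rewrite !(isDd S j) (negPf (notin_neq iJ hj)) !mul1r.
- by rewrite !(isTt S j) (negPf (notin_neq iJ hj)) !mul0r addr0.
- rewrite !(isXx S jk) (negPf (notin_neq iJ hj)) (negPf (notin_neq iJ hk)).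
  by rewrite !mul0r addr0 subr0.
Qed.

Lemma L_fixv J g v : (forall k, k \in J -> ec v k = 0%R /\ fc v k = 0%R) ->
  L J g -> gact g v = v.
Proof.
move=> v0 hg; move: g hg; apply: (gen_min (fix_act_sub _)).
move=> _ [[p hp ->]|[j hj []->]|[j [k [hj hk jk ->]]]]; apply: coordP => l.
- rewrite sphi_pi !isP_sp; have [lJ|lJ] := boolP (l \in J); last first.
    by rewrite -{1 3}(hp _ lJ) permK.
  have [-> ->] := v0 _ lJ.
  have pl : (p^-1)%g l \in J.
    apply/negPn/negP => h; have := hp _ h; rewrite permKV => e.
    by rewrite -e lJ in h.
  by have [-> ->] := v0 _ pl.
- by rewrite !(isZz S j); case: eqP => [->|//]; have [-> ->] := v0 _ hj; rewrite oppr0.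
- rewrite !(isDd S j); case: eqP => [->|_]; last by rewrite !mul1r.
  by have [-> ->] := v0 _ hj; rewrite !mulr0.
- by rewrite !(isTt S j); have [-> _] := v0 _ hj; rewrite mulr0 addr0.
- rewrite !(isXx S jk); have [-> _] := v0 _ hj; have [_ ->] := v0 _ hk.
  by rewrite !mulr0 addr0 subr0.
Qed.

Lemma L_ei i J g : i \notin J -> L J g -> gact g (evec F i) = evec F i.
Proof.
move=> iJ; apply: L_fixv => k kJ; rewrite ec_e fc_e.
by rewrite eq_sym (negPf (notin_neq iJ kJ)).
Qed.
Lemma L_fi i J g : i \notin J -> L J g -> gact g (fvec F i) = fvec F i.
Proof.
move=> iJ; apply: L_fixv => k kJ; rewrite ec_f fc_f.
by rewrite eq_sym (negPf (notin_neq iJ kJ)).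
Qed.

Lemma zz_R i j g : i != j -> R i g -> g ^ gz j = g.
Proof.
by move=> ij hg; apply: (R_fix_j ij _ hg); apply: gen_in; apply: Or33.
Qed.

Lemma nrm_Q_z i J1 J2 k : i \notin J1 -> i \notin J2 -> i != k -> k \notin J1 -> k \notin J2 ->
  nrm (Q i J1 J2) (gz k).
Proof.
move=> i1 i2 ik k1 k2; have ki : k != i by rewrite eq_sym.
have zd m : (gd i ^+ m) ^ gz k = gd i ^+ m.
  by rewrite conjXg; congr (_ ^+ _); apply/conj_sym/zd.
apply: nrm_gen => [|v [[j hj [m ->]]|[j hj [m ->]]|hv]]; first exact: torsion_z.
- have ij := notin_neq i1 hj; have kj := notin_neq k1 hj.
  by rewrite fix_conj2 //; [apply: Q_x | apply: xz].
- have ij := notin_neq i2 hj; have kj := notin_neq k2 hj.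
  by rewrite fix_conj2 //; [apply: Q_y | apply: y_zk].
- by rewrite (zz_R ik); [apply: Q_R; apply: gen_in | apply: gen_in].
Qed.

Lemma M_zk_N0 i k (m : G) : i != k -> M i k m -> N0 S i k (m ^ gz k).
Proof.
move=> ik [->|[a ->]]; first by rewrite conj1g; apply: (sub1 (gen_sub _)).
rewrite conjJg -gyE (_ : (gd i ^+ a) ^ gz k = gd i ^+ a); first exact: N0_y.
by rewrite conjXg; congr (_ ^+ _); apply/conj_sym/zd; rewrite eq_sym.
Qed.

Lemma M_M0 i k (m : G) : i != k -> M i k m -> M0 S i k m.
Proof. by move=> ik [->|[a ->]]; [apply: (sub1 (gen_sub _)) | apply: M0_x]. Qed.

(** The commutator relations allow one index k at a time to be split off: an
   element of the radical is y x q with y, x root elements for i, k, and q in the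
   radical of J minus k.  The coordinates of index k of the image of e_i are the
   parameters of x and y, so these are trivial; what remains at the end is a long
   root element. *)
Lemma Q_faithful i J g : i \notin J -> Q i J J g ->
  gact g (evec F i) = evec F i -> g = 1.
Proof.
elim: {J}_.+1 {-2}J (ltnSn #|J|) g => // N IH J cJ g iJ hg e.
have [J0|[k kJ]] := set_0Vmem J.
  have hR : R i g.
    move: hg; apply: genS => v [[j]|[j]|hv]; rewrite ?J0 ?inE //.
    exact: gen_in.
  have [c hc] := R_isT hR; apply: (R_eq1 hR); suff -> : 0%R = c by [].
  have := (hc (evec F i) i).2; rewrite e !fc_e ec_e eqxx.
  by rewrite mul1r mulr1 add0r.
have ik := notin_neq iJ kJ; have ki : k != i by rewrite eq_sym.
pose J' := J :\ k; have kJ' : k \notin J' by rewrite !inE eqxx.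
have iJ' : i \notin J' by rewrite !inE negb_and iJ orbT.
have hQ' := Q_sub S i J' J'; have hM := M_sub hw S ik.
have nM (m : G) : M i k m -> nrm (Q i J' J') m by apply: nrm_Q_M.
have hP := prodS_sub hM hQ' nM.
have nN (m : G) : M i k m -> nrm (Q i J' J') (m ^ gz k).
  move=> hm; apply: (subJ (nrm_sub _)); first exact: nM.
  exact: nrm_Q_z.
have nNP (m : G) : M i k m -> nrm (prodS (M i k) (Q i J' J')) (m ^ gz k).
  move=> hm; have {}nN := nN m hm; split=> _ [m1 [q [hm1 hq ->]]]; rewrite conjMg.
    have [h hh /swap_comm ->] := xy_R ik (M_M0 ik hm1) (M_zk_N0 ik hm).
    apply: (subM hP); last by apply: prodS_r => //; apply: nrmJ.
    apply: (subM hP); first exact: prodS_l.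
    by apply: prodS_r => //; apply: (subV hQ'); apply: Q_R.
  have hmV : M i k m^-1 by apply: (subV hM).
  rewrite -conjVg; have [h hh /swap_comm ->] := xy_R ik (M_M0 ik hm1) (M_zk_N0 ik hmV).
  apply: (subM hP); last by apply: prodS_r => //; rewrite conjVg; apply: nrmJV.
  apply: (subM hP); first exact: prodS_l.
  by apply: prodS_r => //; apply: (subV hQ'); apply: Q_R.
have hMz : subgrp (fun g => exists2 m, M i k m & g = m ^ gz k).
  split=> [|u v [u' hu ->] [v' hv ->]|u [u' hu ->]].
  - by exists 1; [exact: (sub1 hM) | rewrite conj1g].
  - by exists (u' * v'); [exact: (subM hM) | rewrite conjMg].
  - by exists u'^-1; [exact: (subV hM) | rewrite conjVg].
have hNP : subgrp (prodS (fun g => exists2 m, M i k m & g = m ^ gz k)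
                         (prodS (M i k) (Q i J' J'))).
  by apply: prodS_sub => // _ [m hm ->]; apply: nNP.
have : prodS (fun g => exists2 m, M i k m & g = m ^ gz k)
                         (prodS (M i k) (Q i J' J')) g.
  move: g hg {e}; apply: (gen_min hNP) => v [[j hj [m ->]]|[j hj [m ->]]|hv].
  - apply: prodS_r => //; have [->|jk] := eqVneq j k.
      by apply: prodS_l => //; apply: M_x.
    by apply: prodS_r => //; apply: Q_x; rewrite !inE jk.
  - have [->|jk] := eqVneq j k.
      apply: prodS_l => //; exists (gx i k ^ (gd i ^+ m)); first exact: M_x.
      rewrite [RHS]conjJg -gyE; congr (_ ^ _); rewrite conjXg; congr (_ ^+ _).
      exact/esym/conj_sym/zd.
    by apply: prodS_r => //; apply: prodS_r => //; apply: Q_y; rewrite !inE jk.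
  - by apply: prodS_r => //; apply: prodS_r => //; apply: Q_R; apply: gen_in.
case=> _ [_ [[m hm ->] [m1 [q [hm1 hq ->]]] eg]].
have [[a ha] [b hb]] := (M_isX ik hm, M_isX ik hm1).
have := isX_Z ik ha (isZz S k); rewrite -phiJ => hY.
move: e; rewrite eg (actMg (m ^ gz k)) (actMg m1) => e.
have [e1 e2] := Q_coord (gact m1 (gact (m ^ gz k) (evec F i))) hq iJ' iJ' kJ' kJ' ki.
move: e1 e2; rewrite e !hb !hY !ec_e !fc_e !eqxx ?(negPf ki) ?(negPf ik).
rewrite /= !(mulr0n, mulr1n, mul0r, mulr0, mul1r, mulr1, subr0, add0r, addr0) => b0 a0.
have m1_1 : m1 = 1 by apply: (M_eq1 hw ik hm1); rewrite b0.
have m_1 : m = 1 by apply: (M_eq1 hw ik hm); rewrite a0.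
rewrite m1_1 m_1 conj1g !mul1g; apply: (IH J') => //.
  by move: cJ; rewrite (cardsD1 k J) kJ.
by move: e; rewrite m1_1 m_1 conj1g !act1g.
Qed.

End RadicalFaithful.

(** * The induction step *)

Section Step.
Variables (F : finFieldType) (w : {unit F}) (n : nat) (hn : (1 < n)%N).
Hypothesis hw : (#|F|.-1.-primitive_root (val w))%R.
Variables (G : groupType) (S : sp_system w hn G).
Local Notation i1 := (ix2 hn).
Local Notation phi := (sphi S).
Local Notation gx := (gx S).
Local Notation gy := (gy S).
Local Notation gz := (gz S).
Local Notation gd := (gd S).
Local Notation gt := (gt S).
Local Notation gu := (gu S).
Local Notation faithful := (faithful S).
Local Notation S2 := (S2 S).
Local Notation R := (R S).
Implicit Types (i j k l : 'I_n) (p q : 'S_n) (g h : G) (m r : nat) (a b c : F).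

Local Notation M := (M S).
Local Notation Q := (Q S).
Local Notation L := (L S).
Local Notation S1 := (S1 S).
Local Notation gact g v := (vact v (phi g)).

Implicit Types (J : {set 'I_n}).
Variables (J : {set 'I_n}) (i j : 'I_n) (iJ : i \notin J) (jJ : j \in J).
Let ij : i != j. Proof. exact: notin_neq iJ jJ. Qed.
Let ji : j != i. Proof. by rewrite eq_sym. Qed.
Local Notation Qi := (Q i J J).
Local Notation A := (Q i (J :\ j) J).
Local Notation U' := (gu i j * gz i ^+ 2).
Let iJj : i \notin J :\ j. Proof. by rewrite !inE negb_and iJ orbT. Qed.

Lemma nrm_Q_d i' J1 J2 k : i' \notin J1 -> i' \notin J2 -> nrm (Q i' J1 J2) (gd k).
Proof.
move=> i1 i2; have [r dr] := d_inv S.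
have sw v m : (v ^ (gd i' ^+ m)) ^ gd k = (v ^ gd k) ^ (gd i' ^+ m).
  by apply: conj_swap; apply: (torus_abel (S := S)); [apply: torus_dX | apply: torus_d].
apply: nrm_gen => [|v [[l hl [m ->]]|[l hl [m ->]]|hv]]; first exact: torsion_d.
- have il := notin_neq i1 hl; have [->|ki] := eqVneq k i'.
    by rewrite -conjgM -expgSr; apply: Q_x.
  rewrite sw; have [->|kl] := eqVneq k l; last by rewrite xd //; apply: Q_x.
  by rewrite x_dj // dr -conjgM -expgnDr; apply: Q_x.
- have il := notin_neq i2 hl; have [->|ki] := eqVneq k i'.
    by rewrite -conjgM -expgSr; apply: Q_y.
  rewrite sw; have [->|kl] := eqVneq k l; last by rewrite y_dk //; apply: Q_y.
  by rewrite -y_di // -conjgM -expgS; apply: Q_y.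
- by apply: Q_R; apply: (nrmJ (nrm_R S i' k)); apply: gen_in.
Qed.

(** The Levi decomposition of the stabiliser of the vector f_i. *)
Definition P0 := prodS (L J) Qi.

Lemma P0_sub : subgrp P0.
Proof.
apply: prodS_sub; [exact: L_sub | exact: Q_sub | move=> g; exact: nrm_Q_L].
Qed.
Lemma P0_L g : L J g -> P0 g. Proof. by apply: prodS_l; apply: Q_sub. Qed.
Lemma P0_Q g : Qi g -> P0 g. Proof. by apply: prodS_r; apply: L_sub. Qed.
Lemma nrm_P0_L g : L J g -> nrm P0 g.
Proof. by move=> hg; apply: nrm_in; [exact: P0_sub | exact: P0_L]. Qed.
Lemma nrm_L_di : nrm (L J) (gd i).
Proof.
apply: nrm_torsion; first exact: torsion_d.
by move=> h hh; have [/conj_sym -> _ _] := L_fix iJ hh.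
Qed.
Lemma nrm_P0_di : nrm P0 (gd i).
Proof. by apply: nrm_prodS; [exact: nrm_L_di | exact: nrm_Q_d]. Qed.
Lemma nrm_P0_dX k m : k = i \/ k \in J -> nrm P0 (gd k ^+ m).
Proof.
move=> h; apply: (subX (nrm_sub _)); case: h => [->|kJ]; first exact: nrm_P0_di.
by apply: nrm_P0_L; apply: L_d.
Qed.

Lemma A_Q g : A g -> Qi g.
Proof. by apply: QS => //; apply: subsetDl. Qed.

Lemma M_Q g : M i j g -> Qi g.
Proof. by case=> [->|[m ->]]; [apply: (sub1 (Q_sub _ _ _ _)) | apply: Q_x]. Qed.

Lemma Q_MA g : Qi g -> prodS (M i j) A g.
Proof.
have hP : subgrp (prodS (M i j) A).
  apply: prodS_sub; [exact: M_sub | exact: Q_sub |] => h hh.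
  exact: nrm_Q_M hh.
move: g; apply: (gen_min hP) => v [[l hl [m ->]]|[l hl [m ->]]|hv].
- have [->|lj] := eqVneq l j; first by apply: prodS_l; [exact: Q_sub | exact: M_x].
  by apply: prodS_r; [exact: M_sub | apply: Q_x; rewrite !inE lj].
- by apply: prodS_r; [exact: M_sub | apply: Q_y].
- by apply: prodS_r; [exact: M_sub | apply: Q_R; apply: gen_in].
Qed.

Lemma Q_AM g : Qi g -> exists a m : G, [/\ A a, M i j m & g = a * m].
Proof.
move=> /(subV (Q_sub _ _ _ _)) /Q_MA[m [a [hm ha e]]]; exists a^-1, m^-1; split.
- exact: (subV (Q_sub _ _ _ _)).
- exact: (subV (M_sub hw S ij)).
- by rewrite -[g]invgK e invgM.
Qed.

(** Among the root elements of the radical only x_ij generates a copy of SL(2) with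
   x_ji; the commutators of x_ji with the others are products of root elements of
   L J and of the radical. *)
Lemma A_M (a m : G) : A a -> M j i m -> P0 (a ^ m).
Proof.
move=> ha [->|[b ->]]; first by rewrite conjg1; apply: P0_Q; apply: A_Q.
have [r dr] := d_inv S.
move: a ha; apply: gen_conj; first exact: P0_sub.
have Pm u v : P0 u -> P0 v -> P0 (u * v) by apply: (subM P0_sub).
have Pv u : P0 u -> P0 u^-1 by apply: (subV P0_sub).
have Qx k : k \in J -> Qi (gx i k) by move=> hk; have := Q_x S i J 0 hk; rewrite conjg1; apply.
have Qy k : k \in J -> Qi (gy i k) by move=> hk; have := Q_y S i J 0 hk; rewrite conjg1; apply.
have nd k (c : nat) : k = i \/ k \in J -> nrm P0 (gd k ^+ c) by apply: nrm_P0_dX.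
move=> _ [[k hk [c ->]]|[k hk [c ->]]|[c ->]].
- move: hk; rewrite !inE => /andP[kj kJ]; have ik := notin_neq iJ kJ.
  have [ki jk] : k != i /\ j != k by split; rewrite eq_sym.
  rewrite x_dE // dr -expgnA tor_conj.
  + apply: (nrmJ (nd _ _ (or_intror jJ))); apply: (nrmJ (nd _ _ (or_intror kJ))).
    rewrite (swap_comm (xxa S ji _ _)) //; apply: Pm; first exact/P0_Q/Qx.
    by apply/Pv/P0_L/L_x.
  + by apply/conjX_fix/xd.
  + by apply: (torus_abel (S := S)); apply: torus_dX.
  + by apply/conjX_fix/xd.
- have ik := notin_neq iJ hk; have ki : k != i by rewrite eq_sym.
  have [->|kj] := eqVneq k j.
    have hN : N0 S j i (gy i j ^ (gd i ^+ c)) by rewrite gyC //; apply: N0_yX.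
    have [h hh ->] := xy_R ji (M0_x hw S b ji) hN.
    by apply: Pm; [apply/P0_Q/Q_y | apply/P0_L/(L_R jJ)].
  have jk : j != k by rewrite eq_sym.
  rewrite y_dE // tor_conj.
  + apply: (nrmJ (nd _ _ (or_intror jJ))); apply: (nrmJ (nd _ _ (or_intror hk))).
    have -> : gy i k ^ gx j i = gy i k * (gy j k)^-1.
      have zx : gz k ^ gx j i = gz k by apply/conj_sym/xz.
      rewrite !gyE (conj_swap _ zx) -conjVg -conjMg; congr (_ ^ _).
      exact: swap_comm (xxa S ji _ _).
    apply: Pm; first exact/P0_Q/Qy.
    apply/Pv/P0_L; rewrite gyE; apply: (subJ (L_sub _ _)); [exact: L_x | exact: L_z].
  + by apply/conjX_fix/y_dk.
  + by apply: (torus_abel (S := S)); apply: torus_dX.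
  + by apply/conjX_fix/xd.
- have -> : gx j i ^ (gd j ^+ b) = (gx j i ^ (gd i ^+ c)) ^ (gd j ^+ (c + b)).
    have e : gx j i ^ (gd i ^+ c) = gx j i ^ ((gd j)^-1 ^+ c).
      by apply: (conj_powE c _ (x_dj S ji)); apply/conjV_fix/dd.
    by rewrite e -conjgM expgnDr expVgn mulKg.
  have -> : gt i ^ (gd i ^+ c) = (gt i ^ (gd i ^+ c)) ^ (gd j ^+ (c + b)).
    rewrite [RHS]fix_conj2 //; first by apply/conjX_fix/td.
    by apply: (torus_abel (S := S)); apply: torus_dX.
  rewrite -!conjJg; apply: (nrmJ (nd _ _ (or_intror jJ))).
  apply: (nrmJ (nd _ _ (or_introl erefl))).
  rewrite (swap_comm (xtj S ji)); apply: (Pm _ _); first exact/P0_Q/Q_R/R_t.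
  apply/Pv/Pm; first by rewrite -gyC //; apply/P0_Q/Qy.
  by apply/Pv/P0_L/L_t.
Qed.

Lemma nrm_P0_zz : nrm P0 (gz i ^+ 2).
Proof. by have [m ->] := zz_d hw S i; apply: nrm_P0_dX; left. Qed.

(** U' interchanges the indices i and j up to signs, and takes the root elements
   of A to root elements of L J or, in the case of y_ij, of the radical. *)
Lemma A_U (a : G) : A a -> P0 (a ^ U').
Proof.
move=> ha; rewrite conjgM; apply: (nrmJ nrm_P0_zz); move: a ha.
apply: gen_conj; first exact: P0_sub.
move=> _ [[k hk [c ->]]|[k hk [c ->]]|[c ->]]; rewrite conjJg conjXg ud.
- move: hk; rewrite !inE => /andP[kj kJ]; have ik := notin_neq iJ kJ.
  have jk : j != k by rewrite eq_sym.
  by rewrite xJ // tpermL tpermD //; apply: P0_L; apply: L_xd.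
- have ik := notin_neq iJ hk; have [->|kj] := eqVneq k j.
    rewrite yJ // tpermL tpermR -gyC // -y_dE //; exact/P0_Q/Q_y.
  have jk : j != k by rewrite eq_sym.
  by rewrite yJ // tpermL tpermD //; apply: P0_L; apply: L_yd.
- by rewrite tJ tpermL; apply: P0_L; apply: (L_R jJ); apply: gen_in; exists c.
Qed.

(** ** Opposite root elements *)
Local Notation zz2 := (gz j * gz i).

(* z_j z_i maps the root (i, j) to its negative, which is (j, i). *)
Lemma x_zjzi k l : k != l -> gx k l ^ (gz l * gz k) = (gx l k)^-1.
Proof.
move=> kl; have lk : l != k by rewrite eq_sym.
have zkl : gz k ^ gz l = gz k by apply: zz.
have -> : gz l * gz k = gz l * gz l * (gz k * (gz l)^-1).
  by rewrite -!mulgA; congr (_ * _); rewrite [gz k * _]conjgC conjV_fix // mulVKg.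
have e : gx k l ^ (gz l * gz l) = (gx k l)^-1 by rewrite conjgM -gyE yz.
by rewrite conjgM e conjVg -xU.
Qed.

Lemma xd_zz k l (b : nat) : k != l ->
  (gx k l ^ (gd k ^+ b)) ^ (gz l * gz k) = (gx l k ^ (gd l ^+ b))^-1.
Proof.
move=> kl; have lk : l != k by rewrite eq_sym.
have zkl : gz k ^ gz l = gz k by apply: zz.
rewrite [LHS]conjJg x_zjzi // conjXg (_ : gd k ^ (gz l * gz k) = (gd k)^-1).
  rewrite conjVg; congr _^-1.
  by apply/esym/(conj_powE b _ (x_di S lk)); apply: conjV_fix; apply: dd.
by rewrite -(comm_conj zkl) conjgM dz conjVg; congr _^-1; apply/conj_sym/zd.
Qed.

Lemma M_zz (m : G) : M i j m -> M j i (m ^ zz2).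
Proof.
case=> [->|[b ->]]; first by rewrite conj1g; left.
by rewrite xd_zz //; apply: (subV (M_sub hw S ji)); apply: M_x.
Qed.

Lemma M_zzV (m : G) : M i j m -> exists2 m', M j i m' & m = m' ^ zz2.
Proof.
case=> [->|[b ->]]; first by exists 1; [left | rewrite conj1g].
exists ((gx j i ^ (gd j ^+ b))^-1); first by apply: (subV (M_sub hw S ji)); apply: M_x.
have zij : gz i ^ gz j = gz i by apply: zz.
by rewrite conjVg -(comm_conj zij) xd_zz // invgK.
Qed.

(** The radical of the stabiliser of e_i, conjugate to Q i J J under z_i. *)
Definition QV g := Qi (g ^ (gz i)^-1).

Lemma QV_sub : subgrp QV. Proof. exact/subgrpJ/Q_sub. Qed.

Lemma nrm_QV (c c' : G) : c ^ (gz i)^-1 = c' -> nrm Qi c' -> nrm QV c.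
Proof.
move=> e nc; split=> h hh; rewrite /QV conjJg ?conjVg e; first exact: nrmJ.
exact: nrmJV.
Qed.

Lemma nrm_QV_L (c : G) : L J c -> nrm QV c.
Proof.
move=> hc; apply: (nrm_QV (c' := c)); last exact: nrm_Q_L.
by have [_ /conj_sym h _] := L_fix iJ hc; apply: conjV_fix.
Qed.

Lemma nrm_QV_di : nrm QV (gd i).
Proof.
apply: (nrm_QV (c' := (gd i)^-1)); last exact/(subV (nrm_sub _))/nrm_Q_d.
by apply: (conjg_inj (gz i)); rewrite conjgKV conjVg dz invgK.
Qed.

Lemma M_QV n1 : M j i n1 -> QV n1.
Proof.
case=> [->|[b ->]]; first by rewrite /QV conj1g; apply: (sub1 (Q_sub _ _ _ _)).
have e : (gx j i) ^ (gz i)^-1 = (gy i j)^-1.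
  rewrite gyC //; apply: (conjg_inj (gz i)).
  by rewrite conjgKV conjVg yz // invgK.
rewrite /QV conjJg e conjXg (conjV_fix (conj_sym (zd S ij))) conjVg.
by apply: (subV (Q_sub _ _ _ _)); rewrite -y_dE //; apply: Q_y.
Qed.

(** The image of A_M under z_j z_i, which interchanges the two radicals. *)
Lemma A_M_opp (a m : G) : A a -> M i j m -> prodS (L J) QV ((a ^ zz2) ^ m).
Proof.
move=> ha /M_zzV[m' hm' ->]; rewrite -conjJg.
have [l [q [hl hq ->]]] := A_M ha hm'; rewrite conjMg; exists (l ^ zz2), (q ^ zz2).
have hlj : L J (l ^ gz j) by apply: (subJ (L_sub _ _)) => //; apply: L_z.
split=> //; rewrite /QV conjgM ?conjgK.
  by have [_ /conj_sym -> _] := L_fix iJ hlj.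
by apply: (nrmJ (H := Qi)) => //; apply: nrm_Q_L => //; apply: L_z.
Qed.

(** ** The Bruhat decomposition of the rank one group *)
Lemma U_S1 : S1 i j U'. Proof. exact: S1_u. Qed.

Lemma M_ji_S1 n1 : M j i n1 -> S1 i j n1.
Proof.
case=> [->|[b ->]]; first exact: sub1 (S1_sub S i j).
have hS := S1_sub S i j.
have -> : gx j i ^ (gd j ^+ b) = ((gx i j ^ (gd i ^+ b)) ^ U')^-1.
  have eu : (gx i j ^ (gd i ^+ b)) ^ gu i j = gx j i ^ (gd j ^+ b).
    by rewrite conjJg xJ // tpermL tpermR conjXg ud.
  rewrite conjgM eu [_ ^ (gz i ^+ 2)]conjJg.
  have ez : gx j i ^ (gz i ^+ 2) = (gx j i)^-1 by rewrite expg2 conjgM -gyE yz.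
  have ed : gd j ^ (gz i ^+ 2) = gd j.
    by have [m ->] := zz_d hw S i; apply: conjX_fix; apply: dd.
  by rewrite ez conjXg ed conjVg invgK.
apply: (subV hS); apply: (subJ hS); last exact: U_S1.
by apply: (M_S1 hw ij); apply: M_x.
Qed.

Lemma isB_U : isB i j 0 1 (-1) 0 (phi U').
Proof.
rewrite expg2 !sphiM sphi_pi => v k; rewrite !actM !(isZz S i) !isP_sp tpermV.
rewrite eqxx tpermL; split; (have [ki|ki] := eqVneq k i; first by rewrite ?ki; ring);
  (have [kj|kj] := eqVneq k j; first by rewrite ?kj tpermR; ring);
  by rewrite tpermD 1?eq_sym.
Qed.

Lemma isB_d m : isB i j (val w ^- m) 0 0 (val w ^+ m) (phi (((gd j)^-1 * gd i) ^+ m)).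
Proof.
have h1 : isB i j (val w)^-1 0 0 (val w) (phi ((gd j)^-1 * gd i)).
  have hj : forall v k, (ec (gact (gd j)^-1 v) k = (if k == j then val w else 1) * ec v k)%R *
     (fc (gact (gd j)^-1 v) k = (if k == j then (val w)^-1 else 1) * fc v k)%R.
    rewrite phiV; apply: coord_inv => v k; rewrite !(isDd S j).
    by split; case: eqP => _; rewrite ?mul1r ?mulKf ?mulVKf ?w0.
  move=> v k; rewrite actMg !(isDd S i) !hj; have w1 := w0 w; coord_field.
elim: m => [|m IH].
  by rewrite expg0 phi1 invr1 => v k; rewrite !act1; coord_ring.
rewrite expgSr sphiM; have := isBM ij IH h1.
by rewrite !(mulr0, mul0r, addr0, add0r) -invfM -exprSr.
Qed.

(** A case of the Bruhat decomposition of SL(2,q), checked on matrices; it holds in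
   G because phi is faithful on S1 i j. *)
Lemma rank1_decomp (n1 m : G) : M j i n1 -> M i j m ->
  exists (m1 m2 n2 : G) (k : nat), [/\ M i j m1, M j i n2, M i j m2 &
    n1 * m * U' = m1 * n2 * m2 * ((gd j)^-1 * gd i) ^+ k].
Proof.
move=> hn1 hm; have [[b /(isX_Bt ij) hb] [a /(isX_B ij) ha]] := (M_isX ji hn1, M_isX ij hm).
have hL := isBM ij (isBM ij hb ha) isB_U; rewrite -!sphiM in hL.
(* The equations compare the four entries of the matrices with parameters a1, b1,
   a2 of m1, n2, m2 and the diagonal matrix of c; for b = 0 there is a choice. *)
have [a1 [b1 [a2 [c [c0 E1 E2 E3 E4]]]]] : exists a1 b1 a2 c : F, [/\ (c != 0)%R,
   (- a = (1 + a1 * b1) / c)%R, (1 = c * (a1 + (1 + a1 * b1) * a2))%R,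
   (- (a * b + 1) = b1 / c)%R & (b = c * (1 + b1 * a2))%R].
  have [->|b0] := eqVneq b 0%R; last first.
    by exists b^-1%R, (- (b * (a * b + 1)))%R, 0%R, b; split=> //; field.
  by exists (a - 1)%R, 1%R, (-1)%R, (-1)%R; split; rewrite ?oppr_eq0 ?oner_eq0 //; field; rewrite ?oppr_eq0 ?oner_eq0.
have [m1 hm1 /(isX_B ij) Hm1] := M_onto hw S ij a1.
have [n2 hn2 /(isX_Bt ij) Hn2] := M_onto hw S ji b1.
have [m2 hm2 /(isX_B ij) Hm2] := M_onto hw S ij a2.
have [k ec] := w_pow hw c0; exists m1, m2, n2, k; split=> //.
have hR := isBM ij (isBM ij (isBM ij Hm1 Hn2) Hm2) (isB_d k); rewrite -!sphiM in hR.
have hS := S1_sub S i j; apply: (S1_eq (S := S) ij).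
- apply: (subM hS); last exact: U_S1.
  by apply: (subM hS); [apply: M_ji_S1 | apply: M_S1].
- apply: (subM hS); last by apply: (subX hS); apply: S1_d.
  apply: (subM hS); last exact: M_S1.
  by apply: (subM hS); [apply: M_S1 | apply: M_ji_S1].
rewrite -ec in hR; apply: (isB_eq hL hR).
- by transitivity (- a)%R; [ring | rewrite E1; field].
- by transitivity (1%R : F); [ring | rewrite [LHS]E2; ring].
- by transitivity (- (a * b + 1))%R; [ring | rewrite E3; field].
- by transitivity b; [ring | rewrite [LHS]E4; ring].
Qed.

(** ** The cells K Q Q- Q *)
(** K is the Levi subgroup that also contains the torus for the index i. *)
Definition Di := gen (fun g => g = gd i).
Definition K := prodS Di (L J).

Lemma K_sub : subgrp K.
Proof.
apply: prodS_sub; [exact: gen_sub | exact: L_sub |].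
by apply: (gen_min (nrm_sub _)) => _ ->; apply: nrm_L_di.
Qed.
Lemma K_L g : L J g -> K g. Proof. by apply: prodS_r; apply: gen_sub. Qed.
Lemma K_di : K (gd i). Proof. by apply: prodS_l; [exact: L_sub | exact: gen_in]. Qed.

Lemma nrm_K g : K g -> nrm Qi g /\ nrm QV g.
Proof.
have H H' : nrm H' (gd i) -> (forall l : G, L J l -> nrm H' l) -> forall g, K g -> nrm H' g.
  move=> nd nL _ [u [l [hu hl ->]]]; apply: (subM (nrm_sub _)); last exact: nL.
  by move: u hu; apply: (gen_min (nrm_sub _)) => _ ->.
move=> hg; split; move: g hg; apply: H.
- exact: nrm_Q_d.
- by move=> l; apply: nrm_Q_L.
- exact: nrm_QV_di.
- by move=> l; apply: nrm_QV_L.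
Qed.

Definition cells g := exists k q1 v q2 : G,
  [/\ K k, Qi q1, QV v & Qi q2] /\ g = k * q1 * v * q2.

Lemma cells1 : cells 1.
Proof.
exists 1, 1, 1, 1; rewrite !mulg1; split=> //.
by split; [exact: sub1 K_sub | exact: sub1 (Q_sub _ _ _ _) | exact: sub1 QV_sub |
  exact: sub1 (Q_sub _ _ _ _)].
Qed.

Lemma cells_Q g (q : G) : cells g -> Qi q -> cells (g * q).
Proof.
move=> [k [q1 [v [q2 [[hk h1 hv h2] ->]]]]] hq; exists k, q1, v, (q2 * q).
by rewrite !mulgA; split=> //; split=> //; apply: (subM (Q_sub _ _ _ _)).
Qed.

Lemma cells_K g (c : G) : cells g -> K c -> cells (g * c).
Proof.
move=> [k [q1 [v [q2 [[hk h1 hv h2] ->]]]]] hc; have [nq nv] := nrm_K hc.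
exists (k * c), (q1 ^ c), (v ^ c), (q2 ^ c); split.
  by split; [apply: (subM K_sub) | apply: nrmJ | apply: nrmJ | apply: nrmJ].
by rewrite !conjgE -!mulgA !mulKVg.
Qed.

Lemma cells_P0 g (c : G) : cells g -> P0 c -> cells (g * c).
Proof.
by move=> hg [l [q [hl hq ->]]]; rewrite mulgA; apply: cells_Q => //; apply: cells_K => //; apply: K_L.
Qed.

Lemma K_d k m : k = i \/ k \in J -> K (gd k ^+ m).
Proof.
move=> h; apply: (subX K_sub); case: h => [->|kJ]; first exact: K_di.
by apply/K_L/L_d.
Qed.

Lemma QV_MA (v : G) : QV v -> exists (a n1 : G), [/\ A a, M j i n1 & v = a ^ zz2 * n1].
Proof.
move=> hv; have zij : gz i ^ gz j = gz i by apply: zz.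
have : Qi (v ^ zz2^-1).
  rewrite invgM conjgM; apply: (nrmJV (H := Qi)) => //.
  by apply: nrm_Q_L => //; apply: L_z.
case/Q_AM => a [m [ha hm e]]; exists a, (m ^ zz2); split=> //; first exact: M_zz.
by rewrite -(conjMg a m) -e; exact: esym (conjgKV _ _).
Qed.

Lemma cells_calc (k q1 b n1 m a u m1 n2 m2 d l v c : G) :
  n1 * m * u = m1 * n2 * m2 * d -> a * u = u * c -> b * m1 = m1 * (l * v) ->
  k * q1 * (b * n1) * (m * a) * u = k * l * (q1 * m1) ^ l * (v * n2) * m2 * (d * c).
Proof.
move=> e1 e2 e3; transitivity (k * q1 * (b * (n1 * m * u)) * c).
  by rewrite -!mulgA e2.
rewrite e1; transitivity (k * q1 * (b * m1) * (n2 * m2 * d) * c); first by rewrite -!mulgA.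
by rewrite e3 conjgE -!mulgA !mulKVg.
Qed.

(** Write v q2 = b n1 m a with n1, m root elements for (j, i) and (i, j), and b, a
   in the parts of the two radicals without these roots.  Then a^U' lies in K Q,
   and n1 m U' = m1 n2 m2 h in SL(2,q), where b^m1 is in the product of L J and
   the opposite radical. *)
Lemma cells_U g : cells g -> cells (g * U').
Proof.
move=> [k [q1 [v [q2 [[hk h1 hv h2] ->]]]]].
have [m [a [hm ha ->]]] := Q_MA h2; have [a' [n1 [ha' hn1 ->]]] := QV_MA hv.
have [m1 [m2 [n2 [r [hm1 hn2 hm2 e]]]]] := rank1_decomp hn1 hm.
have [l [v3 [hl hv3 e3]]] := A_M_opp ha' hm1.
have ec : a' ^ zz2 * m1 = m1 * (l * v3) by rewrite -e3; apply: conjgC.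
rewrite (cells_calc k q1 e (conjgC a U') ec).
rewrite mulgA; apply: cells_P0; last exact: A_U.
apply: cells_K; last first.
  apply: (subX K_sub); apply: (subM K_sub); last exact: K_di.
  by apply: (subV K_sub); apply/K_L/L_d.
exists (k * l), ((q1 * m1) ^ l), (v3 * n2), m2; split=> //; split.
- by apply: (subM K_sub) => //; apply: K_L.
- apply: (nrmJ (nrm_Q_L iJ hl)); apply: (subM (Q_sub _ _ _ _)) => //; exact: M_Q.
- by apply: (subM QV_sub) => //; apply: M_QV.
- exact: M_Q.
Qed.

(* Stability under g and g^-1 is required, so that such g form a subgroup. *)
Definition cell_stab h := (forall g, cells g -> cells (g * h)) /\ (forall g, cells g -> cells (g * h^-1)).

Lemma cell_stab_sub : subgrp cell_stab.
Proof.
split=> [|g h [g1 g2] [h1 h2]|g [g1 g2]].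
- by split=> g hg; rewrite ?invg1 mulg1.
- split=> c hc; rewrite ?invgM mulgA; first exact/h1/g1.
  exact/g2/h2.
- by split=> c hc; rewrite ?invgK; [apply: g2 | apply: g1].
Qed.

Lemma stab_K (c : G) : K c -> cell_stab c.
Proof.
by move=> hc; split=> g hg; apply: cells_K => //; apply: (subV K_sub).
Qed.
Lemma stab_Q (q : G) : Qi q -> cell_stab q.
Proof.
by move=> hq; split=> g hg; apply: cells_Q => //; apply: (subV (Q_sub _ _ _ _)).
Qed.
Lemma stab_U' : cell_stab U'.
Proof.
split=> g hg; first exact: cells_U.
have [[//|N] _ e] := faithful_torsion (S1_sub S i j) (S1_faithful (S := S) ij) U_S1.
have -> : U'^-1 = U' ^+ N by apply: (mulgI U'); rewrite mulgV -expgS e.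
elim: N {e} => [|N IH]; first by rewrite expg0 mulg1.
by rewrite expgSr mulgA; apply: cells_U.
Qed.
Lemma stab_u : cell_stab (gu i j).
Proof.
have -> : gu i j = U' * (gz i ^+ 2)^-1 by rewrite mulgK.
apply: (subM cell_stab_sub); first exact: stab_U'.
apply: (subV cell_stab_sub); have [m ->] := zz_d hw S i.
by apply: stab_K; apply: K_d; left.
Qed.

(** The generators of L (i |: J) can be written with elements of K and Q and with
   the transposition of i and j. *)
Lemma L_cells g : L (i |: J) g -> cells g.
Proof.
move=> hg; suff [h _] : cell_stab g by rewrite -[g]mul1g; apply/h/cells1.
have sJ (a b : G) : cell_stab a -> cell_stab b -> cell_stab (a ^ b) by apply: (subJ cell_stab_sub).
have sL (a : G) : L J a -> cell_stab a by move=> ha; apply/stab_K/K_L.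
have su := stab_u.
have sx k : k \in J -> cell_stab (gx i k).
  by move=> hk; apply: stab_Q; have := Q_x S i J 0 hk; rewrite conjg1; apply.
move: g hg; apply: (gen_min cell_stab_sub) => _
  [[p hp ->]|[k hk []->]|[k [l [hk hl kl ->]]]].
- have hp' k : k \notin J -> k != i -> p k = k.
    by move=> h1 h2; apply: hp; rewrite !inE negb_or h2.
  have [pi_i|pi_i] := eqVneq (p i) i.
    apply/sL/L_p => k hk; have [->|ki] := eqVneq k i; [exact: pi_i | exact: hp'].
  have pJ : p i \in J.
    apply/negPn/negP => h; have := hp' _ h pi_i => /perm_inj e.
    by rewrite e eqxx in pi_i.
  have -> : p = (p * tperm i (p i)) * tperm i (p i) by rewrite -mulgA tperm2 mulg1.
  rewrite spiM; apply: (subM cell_stab_sub).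
    apply/sL/L_p => k hk; rewrite permM; have [->|ki] := eqVneq k i; first by rewrite tpermR.
    rewrite (hp' k hk ki) tpermD //; first by rewrite eq_sym.
    by apply: contraNneq hk => <-.
  have [->|pj] := eqVneq (p i) j; first exact: su.
  have -> : tperm i (p i) = (tperm i j) ^ (tperm j (p i)).
    by rewrite tpermJ tpermL tpermD // eq_sym.
  rewrite piJ; apply: sJ; first exact: su.
  by apply/sL/L_p => k hk; rewrite tpermD //; apply: contraNneq hk => <-.
- move: hk; rewrite in_setU1 => /orP[/eqP->|hk]; last by apply/sL/L_z.
  have -> : gz i = gz j ^ gu i j by rewrite zJ tpermR.
  by apply: sJ => //; apply/sL/L_z.
- move: hk; rewrite in_setU1 => /orP[/eqP->|hk]; last by apply/sL/L_d.
  exact/stab_K/K_di.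
- move: hk; rewrite in_setU1 => /orP[/eqP->|hk]; last by apply/sL/L_t.
  exact/stab_Q/Q_R/R_t.
- move: hk hl kl; rewrite !in_setU1 => /orP[/eqP->|hk] /orP[/eqP->|hl].
  + by rewrite eqxx.
  + by move=> _; apply: sx.
  + move=> ki; have [->|kj] := eqVneq k j.
      have -> : gx j i = gx i j ^ gu i j by rewrite xJ // tpermL tpermR.
      by apply: sJ => //; apply: sx.
    have -> : gx k i = gx k j ^ gu i j.
      by rewrite xJ // tpermR tpermD // eq_sym.
    by apply: sJ => //; apply/sL/L_x.
  + by move=> kl; apply/sL/L_x.
Qed.

Lemma Di_isD g : Di g -> S2 i g /\ exists2 c, (c != 0)%R & isD i c (phi g).
Proof.
move=> hg; split.
  by move: g hg; apply: (gen_min (S2_sub S i)) => _ ->; apply: S2_d.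
move: g hg; apply: gen_min => [|_ ->]; last by exists (val w); [exact: w0 | exact: isDd].
split=> [|g h [c c0 hc] [c' c0' hc']|g [c c0 hc]].
- exists 1%R; first exact: oner_neq0.
  by move=> v k; rewrite phi1 !act1 invr1; case: eqP; rewrite !mul1r.
- exists (c * c')%R; first exact: mulf_neq0.
  by move=> v k; rewrite actMg !hc' !hc; split; case: eqP => _; field; rewrite ?c0 ?c0'.
- exists c^-1%R; first by rewrite invr_eq0.
  by rewrite phiV; apply: coord_inv => v k; rewrite !hc; split; case: eqP => _; rewrite ?mul1r // ?invrK ?mulVKf ?mulKf.
Qed.

(** An element d l q1 v q2 of the kernel fixes f_i, as do l, q1 and q2, while d only
   scales it; so the conjugate of v in the radical maps e_i to a multiple of e_i,
   whence v = 1 and d = 1.  Then q1 q2 fixes e_i, and l remains. *)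
Lemma step_faithful : faithful (L J) -> faithful (L (i |: J)).
Proof.
move=> IH g /L_cells[_ [q1 [v [q2 [[[d [l [hd hl ->]]] h1 hv h2] eg]]]]] e1.
have [hd2 [c c0 hc]] := Di_isD hd; pose q := v ^ (gz i)^-1.
have ev : v = q ^ gz i by rewrite conjgKV.
have act_z : gact (gz i) (evec F i) = fvec F i.
  apply: coordP => k; rewrite !(isZz S i) !ec_e !fc_e !ec_f !fc_f eqxx.
  by case: eqP => _; rewrite ?oppr0.
have act_d : gact d (fvec F i) = (c *: fvec F i)%R.
  apply: coordP => k; rewrite !hc !coordE; case: eqP => _; rewrite /= ?mulr0 ?mulr1 //.
have actZ (a : F) u g' : gact g' (a *: u)%R = (a *: gact g' u)%R by apply: esym; apply: scalemxAl.
have e2 : gact g (fvec F i) = fvec F i by rewrite e1 act1.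
have e3 : (c *: gact q (evec F i))%R = evec F i.
  have h : gact v (c *: fvec F i)%R = fvec F i.
    have hq2 : gact q2^-1 (fvec F i) = fvec F i.
      by apply: (Q_fi (J1 := J) (J2 := J)) => //; apply: (subV (Q_sub _ _ _ _)).
    have e4 : gact q2 (gact v (c *: fvec F i)%R) = fvec F i.
      by rewrite -[RHS]e2 eg !actMg act_d !actZ (L_fi iJ hl) (Q_fi h1).
    by rewrite -[LHS](actK _ (phi q2)) e4 -phiV hq2.
  rewrite -[LHS](actK _ (phi (gz i))) -[RHS](actK _ (phi (gz i))); congr (vact _ _).
  rewrite act_z -[RHS]h ev actZ actZ; congr (_ *: _)%R.
  by rewrite -act_z -!actMg (conjgC q).
have c1 : c = 1%R.
  have := congr1 (fun u => ec u i) e3; rewrite ecZ (Q_ei _ hv) // !ec_e eqxx.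
  by rewrite mulr1.
have q_1 : q = 1.
  by apply: (Q_faithful hw iJ hv); move: e3; rewrite c1 scale1r.
have d_1 : d = 1.
  apply: (S2_faithful hd2); apply: spP => u k; rewrite !hc act1 c1 invr1.
  by case: eqP => _; rewrite !mul1r.
have hq12 : Qi (q1 * q2) by apply: (subM (Q_sub _ _ _ _)).
have eg' : g = l * (q1 * q2) by rewrite eg d_1 ev q_1 conj1g !mulg1 mul1g mulgA.
have q12 : q1 * q2 = 1.
  apply: (Q_faithful hw iJ hq12).
  by have : gact g (evec F i) = evec F i; [rewrite e1 act1 | rewrite eg' actMg (L_ei iJ hl)].
by rewrite eg' q12 mulg1; apply: IH => //; rewrite -e1 eg' q12 mulg1.
Qed.

End Step.

(** * The homomorphism is an isomorphism *)

Section Conclusion.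
Variables (F : finFieldType) (w : {unit F}) (n : nat) (hn : (1 < n)%N).
Hypothesis hw : (#|F|.-1.-primitive_root (val w))%R.
Variables (G : groupType) (S : sp_system w hn G).
Local Notation i0 := (ix1 hn).
Local Notation phi := (sphi S).
Local Notation gz := (gz S).
Local Notation gd := (gd S).
Local Notation gu := (gu S).
Local Notation faithful := (faithful S).
Local Notation S2 := (S2 S).
Local Notation R := (R S).
Implicit Types (i j k l : 'I_n) (p q : 'S_n) (g h : G) (m r : nat) (a b c : F).

Local Notation M := (M S).
Local Notation Q := (Q S).
Local Notation L := (L S).
Local Notation gact g v := (vact v (phi g)).
Implicit Types (J : {set 'I_n}) (v : 'rV[F]_(n + n)).

Lemma L1_S2 j g : L [set j] g -> S2 j g.
Proof.
have hS := S2_sub S j.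
move: g; apply: (gen_min hS) => _ [[p hp ->]|[k /set1P-> []->]|[k [l [/set1P-> /set1P-> + ->]]]].
- have -> : p = 1; last by rewrite pi1; apply: sub1 hS.
  have hp' k : k != j -> p k = k by move=> kj; apply: hp; rewrite inE.
  apply/permP => k; rewrite perm1; have [->|] := eqVneq k j; last exact: hp'.
  apply/eqP/negPn/negP => pj; have := hp' _ pj => /perm_inj e.
  by rewrite e eqxx in pj.
- exact: S2_z.
- exact: S2_d.
- exact: S2_t.
- by rewrite eqxx.
Qed.

Lemma L_faithful J j : j \in J -> faithful (L J).
Proof.
elim: {J}_.+1 {-2}J (ltnSn #|J|) j => // N IH J cJ j jJ.
have [J0|[i]] := set_0Vmem (J :\ j).
  have -> : J = [set j] by rewrite -(finset.setD1K jJ) J0 finset.setU0.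
  by move=> g /L1_S2; apply: S2_faithful.
rewrite !inE => /andP[ij iJ].
have jJ' : j \in J :\ i by rewrite !inE eq_sym ij.
rewrite -(finset.setD1K iJ); apply: (step_faithful hw (j := j)) => //; first by rewrite !inE eqxx.
by apply: IH jJ'; move: cJ; rewrite (cardsD1 i J) iJ.
Qed.

Lemma L_all g : L [set: 'I_n] g.
Proof.
have := ss_gen S g; move: g; apply: (gen_min (L_sub S _)) => v [[p ->]|[->|->|->|->]].
- by apply: L_p => k; rewrite inE.
- by rewrite -x01; apply: L_x; rewrite ?inE.
- by rewrite -t0; apply: L_t; rewrite ?inE.
- by rewrite -d0; apply: L_d; rewrite ?inE.
- by rewrite -z0; apply: L_z; rewrite ?inE.
Qed.

Lemma sphi_inj : injective phi.
Proof.
move=> g h; apply: (faithful_eq (L_sub S [set: 'I_n])); [|exact: L_all|exact: L_all].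
by apply: (L_faithful (j := i0)); rewrite inE.
Qed.

Lemma Q_L i J g : i \notin J -> Q i J J g -> L (i |: J) g.
Proof.
move=> iJ; have iJ' : i \in i |: J by rewrite finset.setU11.
move: g; apply: (gen_min (L_sub S _)) => v [[j hj [m ->]]|[j hj [m ->]]|hv].
- by apply: L_xd; rewrite ?(notin_neq iJ hj) // inE hj orbT.
- by apply: L_yd; rewrite ?(notin_neq iJ hj) // inE hj orbT.
- by apply: (L_R (j := i)) => //; apply: gen_in.
Qed.

(** By induction on J: the root elements for one index k clear the coordinates of
   index k, and change only the coordinate at f_i otherwise. *)
Lemma Q_trans i J v : i \notin J -> ec v i = 1%R ->
  (forall k, k \notin J -> k != i -> ec v k = 0%R /\ fc v k = 0%R) ->
  exists2 q, Q i J J q & gact q (evec F i) = v.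
Proof.
elim: {J}_.+1 {-2}J (ltnSn #|J|) v => // N IH J cJ v iJ vi v0.
have [J0|[k kJ]] := set_0Vmem J.
  have [q hq Tq] := R_onto hw S i (fc v i); exists q; first exact: Q_R.
  apply: coordP => l; rewrite !Tq !ec_e !fc_e eqxx.
  have [->|li] := eqVneq l i; first by rewrite vi; split; rewrite /= ?mulr1 ?mul1r ?add0r.
  have [-> ->] : ec v l = 0%R /\ fc v l = 0%R by apply: v0; rewrite ?J0 ?inE.
  by rewrite /= !mul0r addr0.
have ik := notin_neq iJ kJ; have ki : k != i by rewrite eq_sym.
pose J' := J :\ k; have iJ' : i \notin J' by rewrite !inE negb_and iJ orbT.
have [a hM Xa] := M_onto hw S ik (ec v k).
have [b hM' Xb] := M_onto hw S ik (fc v k).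
pose u := (v - ec v k *: evec F k - fc v k *: fvec F k - (ec v k * fc v k) *: fvec F i)%R.
have [|||q hq e] := IH J' _ u iJ'.
- by move: cJ; rewrite (cardsD1 k J) kJ.
- by rewrite !coordE (negPf ik) /= vi; ring.
- move=> l; rewrite !inE negb_and negbK => hl li; rewrite !coordE (negPf li).
  have [->|lk] := eqVneq l k; first by rewrite /= mulr1n; split; ring.
  have [-> ->] : ec v l = 0%R /\ fc v l = 0%R.
    by apply: v0 => //; move: hl; rewrite (negPf lk).
  by rewrite /= mulr0n; split; ring.
have sQ : forall g, Q i J' J' g -> Q i J J g by move=> g; apply: QS; apply: subsetDl.
exists (q * a * (b ^ gz k)).
  have hQ := Q_sub S i J J; have hx (m : G) : M i k m -> Q i J J m.
    by case=> [->|[r ->]]; [apply: sub1 hQ | apply: Q_x].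
  apply: (subM hQ); first by apply: (subM hQ); [apply: sQ | apply: hx].
  case: hM' {Xb} => [->|[r ->]]; first by rewrite conj1g; apply: sub1 hQ.
  rewrite conjJg -gyE (_ : (gd i ^+ r) ^ gz k = gd i ^+ r); first exact: Q_y.
  by rewrite conjXg; congr (_ ^+ _); apply/conj_sym/zd.
have Yb := isX_Z ik Xb (isZz S k); rewrite -phiJ in Yb.
rewrite (actMg S (q * a)) (actMg S q) e; apply: coordP => l.
rewrite !Yb !Xa !coordE (negPf ik) (negPf ki) !eqxx vi.
have [->|li] := eqVneq l i; first by rewrite (negPf ik) /= ?mulr0n ?mulr1n vi; split; ring.
by have [->|lk] := eqVneq l k; rewrite /= ?mulr0n ?mulr1n; split; ring.
Qed.

(** The vector is moved to one with coordinate 1 at f_i; after applying z_i^-1 it is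
   in the range of Q_trans. *)
Lemma L_trans i J v : i \in J -> v != 0%R ->
  (forall k, k \notin J -> ec v k = 0%R /\ fc v k = 0%R) ->
  exists2 g, L J g & gact g v = fvec F i.
Proof.
move=> iJ vn0 v0.
have hL := L_sub S J.
have supp g u : L J g -> (forall k, k \notin J -> ec u k = 0%R /\ fc u k = 0%R) ->
    forall k, k \notin J -> ec (gact g u) k = 0%R /\ fc (gact g u) k = 0%R.
  by move=> hg h k kJ; have [-> ->] := L_coord u kJ hg; apply: h.
have [k kJ hk] : exists2 k, k \in J & (ec v k != 0%R) || (fc v k != 0%R).
  have [/exists_inP//|] := boolP [exists k in J, (ec v k != 0%R) || (fc v k != 0%R)].
  rewrite negb_exists_in => /forall_inP h; case/eqP: vn0; apply: coordP => k.
  rewrite ec0 fc0; have [kJ|/v0//] := boolP (k \in J).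
  by have := h k kJ; rewrite negb_or !negbK => /andP[/eqP-> /eqP->].
have [g1 hg1 f1] : exists2 g1, L J g1 & fc (gact g1 v) k != 0%R.
  have [f0|f0] := eqVneq (fc v k) 0%R; last by exists 1; [exact: sub1 hL | rewrite act1g].
  exists (gz k); first exact: L_z.
  by rewrite (isZz S k v k).2 eqxx; rewrite f0 eqxx orbF in hk.
have [g2 hg2 f2] : exists2 g2, L J g2 & fc (gact g2 v) i != 0%R.
  exists (g1 * gu k i).
    apply: (subM hL) => //; apply: L_p => l lJ; rewrite tpermD //.
      by apply: contraNneq lJ => <-.
    by apply: contraNneq lJ => <-.
  by rewrite actMg sphi_pi isP_sp tpermV tpermR.
have [m em] := w_pow hw f2; have [r dr] := d_inv S.
have fX : fc (gact (g2 * (gd i)^-1 ^+ m) v) i = 1%R.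
  have h1 u : fc (gact (gd i)^-1 u) i = ((val w)^-1 * fc u i)%R.
    by have := (isDd S i (gact (gd i)^-1 u) i).2; rewrite phiV actKV eqxx => ->; rewrite mulKf ?w0.
  have hD (l : nat) u : fc (gact ((gd i)^-1 ^+ l) u) i = (val w ^- l * fc u i)%R.
    elim: l u => [|l IH] u; first by rewrite expg0 act1g invr1 mul1r.
    by rewrite expgSr actMg h1 IH mulrA -invfM -exprS.
  by rewrite actMg hD -em mulVf.
have hg3 : L J (g2 * (gd i)^-1 ^+ m).
  by apply: (subM hL) => //; apply: (subX hL); apply: (subV hL); apply: L_d.
move: (g2 * _) fX hg3 => g3 f3 hg3.
pose u := gact (gz i)^-1 (gact g3 v).
have uz : gact (gz i) u = gact g3 v by rewrite /u phiV actKV.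
have iJ' : i \notin J :\ i by rewrite !inE eqxx.
have hs := supp g3 v hg3 v0.
have [||q hq eq] := Q_trans (v := u) iJ'.
- by have := (isZz S i u i).2; rewrite eqxx uz f3.
- move=> l; rewrite !inE negb_and negbK => hl li; move: hl; rewrite (negPf li) /= => lJ.
  have := hs l lJ; have := (isZz S i u l); rewrite uz (negPf li) => -[-> ->].
  by [].
have hz : L J (gz i) by apply: L_z.
have qL : L J q^-1 by apply: (subV hL); rewrite -(finset.setD1K iJ); apply: Q_L.
exists (g3 * (gz i)^-1 * q^-1 * gz i).
  apply: (subM hL) => //; apply: (subM hL) => //; apply: (subM hL) => //.
  exact: (subV hL).
rewrite !actMg -/u -eq phiV actK; apply: coordP => l.
by rewrite !(isZz S i) !ec_e !fc_e !ec_f !fc_f eqxx; case: eqP => _; rewrite ?oppr0.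
Qed.

Lemma sp_bil_act (B : Sp F n) u v : sp_bil (vact u B) (vact v B) = sp_bil u v.
Proof.
rewrite /sp_bil /vact trmx_mul -!mulmxA; congr ((_ *m _)%R 0%R 0%R).
by rewrite !mulmxA (eqP (SpP B)).
Qed.

Lemma mul_sp_form v : (v *m sp_form F n = row_mx (- rsubmx v) (lsubmx v))%R.
Proof.
rewrite -{1}[v]hsubmxK mul_row_block !mulmx0 mulmx1 mulmxN mulmx1.
by rewrite add0r addr0.
Qed.
Lemma sp_bil_deltar v (l : 'I_(n + n)) : sp_bil v (delta_mx 0%R l) = (v *m sp_form F n)%R 0%R l.
Proof. by rewrite /sp_bil trmx_delta -colE mxE. Qed.
Lemma bil_f v k : sp_bil v (fvec F k) = ec v k.
Proof. by rewrite sp_bil_deltar mul_sp_form row_mxEr mxE. Qed.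
Lemma bil_e v k : sp_bil v (evec F k) = (- fc v k)%R.
Proof. by rewrite sp_bil_deltar mul_sp_form row_mxEl !mxE. Qed.

(* The coordinates of index k are values of the form on e_k and f_k. *)
Lemma fixes_coord (B : Sp F n) u k :
  vact (evec F k) B = evec F k -> vact (fvec F k) B = fvec F k ->
  ec (vact u B) k = ec u k /\ fc (vact u B) k = fc u k.
Proof.
move=> he hf; split; first by rewrite -!bil_f -{1}hf sp_bil_act.
by apply: oppr_inj; rewrite -!bil_e -{1}he sp_bil_act.
Qed.

Definition supported J (B : Sp F n) := forall k, k \notin J ->
  vact (evec F k) B = evec F k /\ vact (fvec F k) B = fvec F k.

Lemma L_supported J g : L J g -> supported J (phi g).
Proof. by move=> hg k kJ; rewrite (L_ei kJ hg) (L_fi kJ hg). Qed.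

Lemma supportedM J B C : supported J B -> supported J C -> supported J (B * C).
Proof.
by move=> hB hC k kJ; rewrite !actM; have [-> ->] := hB k kJ; apply: hC.
Qed.

(** B is first multiplied by an element of L J that returns the image of f_i to
   f_i, and then by an element of the radical that does the same for e_i. *)
Lemma supported_onto J B : supported J B -> exists g, phi g = B.
Proof.
elim: {J}_.+1 {-2}J (ltnSn #|J|) B => // N IH J cJ B hB.
have [J0|[i iJ]] := set_0Vmem J.
  exists 1; rewrite phi1; apply: spP => v k; rewrite act1.
  have [|h1 h2] := hB k; first by rewrite J0 inE.
  by have [-> ->] := fixes_coord v h1 h2.
have supp u k : k \notin J -> ec (vact u B) k = ec u k /\ fc (vact u B) k = fc u k.
  by move=> kJ; have [h1 h2] := hB k kJ; apply: fixes_coord.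
have fi0 : fvec F i != 0%R.
  apply/negP => /eqP/(congr1 (fun u => fc u i)); rewrite fc_f fc0 eqxx => /eqP.
  by rewrite oner_eq0.
have iN k : k \notin J -> k != i by move=> kJ; apply: notin_neq kJ iJ.
have [||g hg eg] := @L_trans i J (vact (fvec F i) B) iJ.
- apply: contra_neq fi0 => e; rewrite -(actK (fvec F i) B) e.
  exact: mul0mx.
- move=> k kJ; have [-> ->] := supp (fvec F i) k kJ.
  by rewrite ec_f fc_f (negPf (iN k kJ)).
have hC := supportedM hB (L_supported hg).
have [C eC] : exists C, B * phi g = C by exists (B * phi g).
rewrite eC in hC.
have fiC : vact (fvec F i) C = fvec F i by rewrite -eC actM.
pose J' := J :\ i; have iJ' : i \notin J' by rewrite !inE eqxx.
have [||q hq eq] := Q_trans (v := vact (evec F i) C) iJ'.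
- by rewrite -bil_f -fiC sp_bil_act bil_f ec_e eqxx.
- move=> k; rewrite !inE negb_and negbK => hk ki; move: hk; rewrite (negPf ki) /= => kJ.
  have [h1 h2] := hC k kJ; have [-> ->] := fixes_coord (evec F i) h1 h2.
  by rewrite ec_e fc_e (negPf ki).
have hqL : L J q^-1.
  by apply: (subV (L_sub S J)); rewrite -(finset.setD1K iJ); apply: Q_L.
have [||h eh] := IH J' _ (C * phi q^-1).
- by move: cJ; rewrite (cardsD1 i J) iJ.
- move=> k; rewrite !inE negb_and negbK => /orP[/eqP->|kJ].
    rewrite !actM fiC -eq phiV actK; split=> //.
    by rewrite -phiV; apply: (Q_fi (J1 := J') (J2 := J')) => //; apply: (subV (Q_sub _ _ _ _)).
  exact: (supportedM hC (L_supported hqL)) kJ.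
exists (h * q * g^-1); rewrite !sphiM eh !phiV mulgVK -eC mulgK.
by [].
Qed.

Lemma sphi_bij : bijective phi.
Proof.
have onto (B : Sp F n) : exists g, phi g = B.
  by apply: (@supported_onto [set: 'I_n]) => k; rewrite inE.
have [f hf] := boolp.choice onto.
by exists f => [g|B]; [apply: sphi_inj; rewrite hf | exact: hf].
Qed.

End Conclusion.

(** * Generators of point stabilisers in the symmetric group *)

Section Stabilisers.
Variables (n : nat) (A : 'S_n -> Prop) (k : nat) (c : 'S_n).
Hypothesis hA : subgrp A.
Hypothesis hc : A c.
Hypothesis c_succ : forall i j : 'I_n, (k <= i)%N -> j = i.+1 :> nat -> c i = j.
Hypothesis hk : forall i j : 'I_n, i = k :> nat -> j = k.+1 :> nat -> A (tperm i j).

Lemma adjacent_tperm (i j : 'I_n) : (k <= i)%N -> j = i.+1 :> nat -> A (tperm i j).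
Proof.
move: i j; suff H : forall m (i j : 'I_n), i = (k + m)%N :> nat -> j = i.+1 :> nat -> A (tperm i j).
  by move=> i j ki; apply: (H (i - k)%N); rewrite subnKC.
elim=> [|m IH] i j ei ej; first by apply: hk; rewrite ?ej ei addn0.
have lt : (k + m < n)%N by rewrite (leq_ltn_trans _ (ltn_ord i)) // ei leq_add2l.
pose i' := Ordinal lt; have e : c i' = i by apply: c_succ; rewrite ?leq_addr //= ei addnS.
have -> : tperm i j = tperm i' i ^ c.
  by rewrite tpermJ e; congr tperm; apply/esym/c_succ; rewrite // ei leq_addr.
by apply: (subJ hA) => //; apply: IH => //=; rewrite ei addnS.
Qed.

Lemma stab_tperm (i j : 'I_n) : (k <= i)%N -> (k <= j)%N -> A (tperm i j).
Proof.
wlog lij : i j / (i <= j)%N.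
  by move=> H ki kj; case: (leqP i j) => h; [apply: H | rewrite tpermC; apply: H => //; apply: ltnW].
move=> ki _; move: j lij.
suff H : forall m (j : 'I_n), j = (i + m)%N :> nat -> A (tperm i j).
  by move=> j ij; apply: (H (j - i)%N); rewrite subnKC.
elim=> [|m IH] j ej.
  have -> : j = i by apply: ord_inj; rewrite ej addn0.
  by rewrite tperm1; apply: sub1 hA.
have lt : (i + m < n)%N by rewrite (leq_ltn_trans _ (ltn_ord j)) // ej leq_add2l.
pose j' := Ordinal lt; have A1 : A (tperm j' j).
  by apply: adjacent_tperm; rewrite /= ?ej ?addnS // (leq_trans ki) // leq_addr.
have [e|ne] := eqVneq i j'; first by rewrite e.
have ij : i != j by rewrite -val_eqE /= ej addnS neq_ltn ltnS leq_addr.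
have -> : tperm i j = tperm i j' ^ tperm j' j.
  by rewrite tpermJ tpermL tpermD // eq_sym.
by apply: (subJ hA) => //; apply: IH.
Qed.

(** If c shifts the points from k on, except the last one, its powers conjugate the
   transposition of k and k+1 to all adjacent transpositions of these points. *)
Lemma stab_generated (s : 'S_n) : (forall i : 'I_n, (i < k)%N -> s i = i) -> A s.
Proof.
suff H : forall m l (s : 'S_n), (k <= l)%N -> (n <= l + m)%N ->
    (forall i : 'I_n, (i < l)%N -> s i = i) -> A s.
  by move=> hs; apply: (H n k s) => //; apply: leq_addl.
elim=> [|m IH] l {}s kl nlm hs.
  have -> : s = 1; last exact: sub1 hA.
  apply/permP => i; rewrite perm1; apply: hs.
  by rewrite addn0 in nlm; apply: leq_trans nlm.
have [nl|ln] := leqP n l; first by apply: (IH l) => //; apply: leq_trans (leq_addr _ _).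
pose a := Ordinal ln.
have sa : (l <= s a)%N.
  rewrite leqNgt; apply/negP => h; have := hs _ h => /perm_inj e.
  by rewrite e ltnn in h.
have -> : s = s * tperm (s a) a * tperm (s a) a by rewrite -mulgA tperm2 mulg1.
apply: (subM hA); last by apply: stab_tperm; rewrite // (leq_trans kl).
apply: (IH l.+1); rewrite ?(leqW kl) ?addSnnS // => i; rewrite ltnS leq_eqVlt permM.
case/orP => [/eqP e|h].
  by have -> : i = a by [apply: ord_inj]; rewrite tpermL.
rewrite (hs _ h) tpermD //; rewrite -val_eqE /= neq_ltn ?h ?orbT //.
by rewrite (leq_trans h sa) orbT.
Qed.

End Stabilisers.

Lemma stab_fix01 n (hn : (1 < n)%N) (p : 'S_n) :
  p (ix1 hn) = ix1 hn -> p (ix2 hn) = ix2 hn -> forall i : 'I_n, (i < 2)%N -> p i = i.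
Proof.
move=> h0 h1 [[|[|i]] hi] //= _.
- by have -> : Ordinal hi = ix1 hn by apply: ord_inj.
- by have -> : Ordinal hi = ix2 hn by apply: ord_inj.
Qed.

Lemma stab_fix0 n (hn : (1 < n)%N) (p : 'S_n) :
  p (ix1 hn) = ix1 hn -> forall i : 'I_n, (i < 1)%N -> p i = i.
Proof.
move=> h0 [[|i] hi] //= _.
by have -> : Ordinal hi = ix1 hn by apply: ord_inj.
Qed.

Definition cyc n : 'S_n := perm (@ordS_inj n).

Lemma cyc_succ n (i j : 'I_n) : j = i.+1 :> nat -> cyc n i = j.
Proof.
by move=> e; apply: ord_inj; rewrite permE /= modn_small ?e // -e.
Qed.

(** * The relations hold in the symplectic group *)

Section SpRelations.
Variables (F : finFieldType) (w : {unit F}) (n : nat) (hn : (1 < n)%N).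
Local Notation i0 := (ix1 hn).
Local Notation i1 := (ix2 hn).
Local Notation sg := (sp_sigma F hn).
Local Notation ta := (sp_tau F hn).
Local Notation de := (sp_delta w hn).
Local Notation ze := (sp_Z F hn).
Local Notation P := (@sp_perm F n).
Local Notation tt := (tperm i0 i1).
Implicit Types (i j k l : 'I_n) (p q : 'S_n) (g h : Sp F n).

(** The root elements f_i -> f_i + a e_j and f_i -> f_i + a e_i, which occur as
   conjugates by Z. *)
Definition isW i j (a : F) g := forall v k,
  (ec (vact v g) k = ec v k + (k == j)%:R * a * fc v i + (k == i)%:R * a * fc v j)%R *
  (fc (vact v g) k = fc v k).
Definition isV i (a : F) g := forall v k,
  (ec (vact v g) k = ec v k + (k == i)%:R * a * fc v i)%R *
  (fc (vact v g) k = fc v k).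

Lemma isW_P p g h i j a : isW i j a g -> isP p h -> isW (p i) (p j) a (g ^ h).
Proof.
move=> hg hh; apply: conj_coord => u k; rewrite !hh !hg !permK.
by rewrite !(can2_eq (permKV p) (permK p)).
Qed.
Lemma isV_P p g h i a : isV i a g -> isP p h -> isV (p i) a (g ^ h).
Proof.
move=> hg hh; apply: conj_coord => u k; rewrite !hh !hg !permK.
by rewrite !(can2_eq (permKV p) (permK p)).
Qed.
Lemma isX_Zi g h i j a : i != j -> isX i j a g -> isZ i h -> isW i j a (g ^ h).
Proof. by move=> ij hg hh; apply: conj_coord => u k; rewrite !hh !hg; coord_ring. Qed.
Lemma isT_Z g h i a : isT i a g -> isZ i h -> isV i (- a)%R (g ^ h).
Proof. by move=> hg hh; apply: conj_coord => u k; rewrite !hh !hg; coord_ring. Qed.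

Lemma sX : isX i0 i1 1 sg. Proof. exact: isX_sp. Qed.
Lemma zZ : isZ i0 ze. Proof. exact: isZ_sp. Qed.
Lemma dD : isD i0 (val w) de. Proof. exact: isD_sp. Qed.
Lemma tT : isT i0 1 ta. Proof. exact: isT_sp. Qed.
Lemma sXP p : isX (p i0) (p i1) 1 (sg ^ P p). Proof. exact/isX_P/isP_sp/sX. Qed.
Lemma zZP p : isZ (p i0) (ze ^ P p). Proof. exact/isZ_P/isP_sp/zZ. Qed.
Lemma dDP p : isD (p i0) (val w) (de ^ P p). Proof. exact/isD_P/isP_sp/dD. Qed.
Lemma tTP p : isT (p i0) 1 (ta ^ P p). Proof. exact/isT_P/isP_sp/tT. Qed.

Lemma P1 : P 1 = 1.
Proof. exact: hom1 (@sp_permM F n). Qed.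
Lemma PJ p q : P (p ^ q) = P p ^ P q.
Proof. exact: homJ (@sp_permM F n) p q. Qed.
Lemma PX p m : P (p ^+ m) = P p ^+ m.
Proof. exact: homX (@sp_permM F n) p m. Qed.

Lemma commP' (G : groupType) (a b : G) : a * b = b * a -> [~ a, b] = 1.
Proof. by move/conj_comm/commg_fix. Qed.
Lemma commP2 (G : groupType) (a b c : G) : a * b = b * a * c -> [~ a, b] = c.
Proof. by move=> e; apply/commg_conj; rewrite conjgE e !mulgA mulVg mul1g. Qed.

Lemma zP p : p i0 = i0 -> ze ^ P p = ze.
Proof. by move=> e; apply: spP => v k; rewrite !(zZP p) !zZ e. Qed.
Lemma dP p : p i0 = i0 -> de ^ P p = de.
Proof. by move=> e; apply: spP => v k; rewrite !(dDP p) !dD e. Qed.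
Lemma tP p : p i0 = i0 -> ta ^ P p = ta.
Proof. by move=> e; apply: spP => v k; rewrite !(tTP p) !tT e. Qed.
Lemma sP p : p i0 = i0 -> p i1 = i1 -> sg ^ P p = sg.
Proof. by move=> e0 e1; apply: spP => v k; rewrite !(sXP p) !sX e0 e1. Qed.

Let ij : i0 != i1. Proof. by []. Qed.
Let ji : i1 != i0. Proof. by []. Qed.

Ltac coords := move=> *; apply: spP => v k; rewrite !actM.

Lemma spz g i : isZ i g -> i != i0 -> i != i1 -> sg * g = g * sg.
Proof. by move=> hg h0 h1; coords; rewrite !sX !hg ?sX; coord_ring. Qed.
Lemma spd g i : isD i (val w) g -> i != i0 -> i != i1 -> sg * g = g * sg.
Proof. by move=> hg h0 h1; coords; rewrite !sX !hg ?sX; coord_ring. Qed.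
Lemma spt g i : isT i 1 g -> i != i0 -> i != i1 -> sg * g = g * sg.
Proof. by move=> hg h0 h1; coords; rewrite !sX !hg ?sX; coord_ring. Qed.
Lemma zz' g i : isZ i g -> i != i0 -> ze * g = g * ze.
Proof. by move=> hg h0; coords; rewrite !zZ !hg ?zZ; coord_ring. Qed.
Lemma zd' g i : isD i (val w) g -> i != i0 -> ze * g = g * ze.
Proof. by move=> hg h0; coords; rewrite !zZ !hg ?zZ; coord_ring. Qed.
Lemma dd' g i : isD i (val w) g -> i != i0 -> de * g = g * de.
Proof. by move=> hg h0; coords; rewrite !dD !hg ?dD; coord_ring. Qed.
Lemma tz' g i : isZ i g -> i != i0 -> ta * g = g * ta.
Proof. by move=> hg h0; coords; rewrite !tT !hg ?tT; coord_ring. Qed.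
Lemma td' g i : isD i (val w) g -> i != i0 -> ta * g = g * ta.
Proof. by move=> hg h0; coords; rewrite !tT !hg ?tT; coord_ring. Qed.
Lemma tt' g i : isT i 1 g -> i != i0 -> ta * g = g * ta.
Proof. by move=> hg h0; coords; rewrite !tT !hg ?tT; coord_ring. Qed.
Lemma sdd' : sg * (de * de ^ P tt) = de * de ^ P tt * sg.
Proof.
have := dDP tt; rewrite tpermL; move: (de ^ P tt) => g h; have w1 := w0 w.
by coords; rewrite !h !dD !sX !h !dD; coord_field.
Qed.
Lemma szu : sg * (ze * P tt * ze^-1) = ze * P tt * ze^-1 * sg.
Proof.
have hW := isX_Zi ij sX zZ; have h : (sg ^ ze) ^ P tt = sg ^ ze.
  have := isW_P hW (@isP_sp F n tt); rewrite tpermL tpermR => h.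
  by apply: spP => v k; rewrite !h !hW; coord_ring.
by apply: comm_conj; rewrite [LHS]conjgM [sg ^ (ze * _)]conjgM h conjgK.
Qed.
Lemma tzz' : ta * ze ^+ 2 = ze ^+ 2 * ta.
Proof. by rewrite expg2; coords; rewrite !tT !zZ ?tT; coord_ring. Qed.
Lemma st' : sg * ta = ta * sg.
Proof. by coords; rewrite !tT !sX !tT; coord_ring. Qed.
Lemma stu : sg * ta ^ P tt = ta ^ P tt * sg * (sg ^ (ze ^ P tt) * ta^-1).
Proof.
have ht := tTP tt; rewrite tpermL in ht.
have hy : isY i0 i1 1 (sg ^ (ze ^ P tt)).
  by have hz := zZP tt; rewrite tpermL in hz; apply: isX_Z sX hz.
have hV := isTV tT.
move: (ta ^ P tt) (sg ^ _) ht hy => g1 g2 ht hy.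
by coords; rewrite !hV !hy !sX !ht ?sX ?ht; coord_ring.
Qed.
Lemma sxa g h k : k != i0 -> k != i1 -> isX i1 k 1 g -> isX i0 k 1 h -> sg * g = g * sg * h.
Proof.
by move=> k0 k1 hg hh; apply: spP => v l; rewrite !actM !hh !sX !hg !sX ?hg; coord_ring.
Qed.
Lemma sxb g k : k != i0 -> k != i1 -> isX i0 k 1 g -> sg * g = g * sg.
Proof.
by move=> k0 k1 hg; apply: spP => v l; rewrite !actM !hg !sX !hg; coord_ring.
Qed.
Lemma sxc g k : k != i0 -> k != i1 -> isX k i1 1 g -> sg * g = g * sg.
Proof.
by move=> k0 k1 hg; apply: spP => v l; rewrite !actM !hg !sX !hg; coord_ring.
Qed.
Lemma sxd g k l : k != i0 -> k != i1 -> l != i0 -> l != i1 -> k != l ->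
  isX k l 1 g -> sg * g = g * sg.
Proof.
by move=> k0 k1 l0 l1 kl hg; apply: spP => v m; rewrite !actM !hg !sX !hg; coord_ring.
Qed.
Lemma sxe : sg * sg ^ ze = sg ^ ze * sg * (ta ^+ 2) ^ (ze * P tt).
Proof.
have hW := isX_Zi ij sX zZ.
have h2 := isV_P (isT_Z (isTM tT tT) zZ) (@isP_sp F n tt).
rewrite -conjgM tpermL in h2; rewrite expg2.
move: (sg ^ ze) (_ ^ (ze * _)) hW h2 => g1 g2 hW h2.
by apply: spP => v l; rewrite !actM !h2 !hW !sX !hW; coord_ring.
Qed.
Lemma sxe_even : (2%:R : F)%R = 0%R -> sg * sg ^ ze = sg ^ ze * sg.
Proof.
move=> two0; rewrite sxe; have -> : ta ^+ 2 = 1; last by rewrite conj1g mulg1.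
by apply: (isT_eq1 (i := i0)); have := isTM tT tT; rewrite -mulr2n two0.
Qed.

End SpRelations.

(** * The presented group *)

Section Universal.
Variables (X : choiceType) (G H : groupType).

Lemma free_lift_comp (f : G -> H) (g : X -> G) a :
  {morph f : x y / x * y} -> f (free_lift g a) = free_lift (f \o g) a.
Proof.
move=> fM; rewrite /free_lift; elim: (generic_quotient.repr a) => [|[x b] u IH] /=.
  exact: hom1.
by rewrite fM IH; case: b; rewrite /= ?(homV fM).
Qed.

Lemma eq_free_lift (g h : X -> G) a : g =1 h -> free_lift g a = free_lift h a.
Proof.
move=> e; rewrite /free_lift; elim: (generic_quotient.repr a) => [|[x b] u IH] //=.
by rewrite IH e.
Qed.

Lemma kernel_normal (f : G -> H) : {morph f : x y / x * y} ->
  normal_subgroup (fun a => f a = 1).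
Proof.
move=> fM; split=> [|x y|x|x y]; first exact: hom1.
- by rewrite fM => -> ->; rewrite mulg1.
- by rewrite (homV fM) => ->; rewrite invg1.
- by rewrite (homJ fM) => ->; rewrite conj1g.
Qed.

End Universal.

Section Quotient.
Variables (X : choiceType) (R : set (free_group X)) (H : groupType) (g : X -> H).
Hypothesis hR : forall r, R r -> free_lift g r = 1.

Local Notation cls := (@pres_proj X R).

Lemma lift_closure a : normal_closure R a -> free_lift g a = 1.
Proof.
move=> ha; apply: (ha (fun a => free_lift g a = 1)) => //.
exact/kernel_normal/free_liftM.
Qed.

Definition pres_lift (x : presented R) : H := free_lift g (generic_quotient.repr x).

Lemma pres_lift_cls a : pres_lift (cls a) = free_lift g a.
Proof.
have := lift_closure (pres_repr a); rewrite gmulfM gmulfV => e.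
by apply: (mulgI (free_lift g (generic_quotient.repr (cls a)))^-1); rewrite e mulVg.
Qed.

Lemma pres_liftM : {morph pres_lift : x y / x * y}.
Proof.
move=> x y; rewrite -(pres_proj_repr x) -(pres_proj_repr y) -pres_projM.
by rewrite !pres_lift_cls gmulfM.
Qed.

Lemma pres_cls1 a : R a -> cls a = 1.
Proof.
move=> ha; apply/eqP; rewrite eq_sym; apply/pres_projP; rewrite invg1 mul1g.
exact: normal_closure_sub.
Qed.

End Quotient.

Section Relators.
Variables (p e q n : nat) (hp : prime p) (hq : q = (p ^ e)%N) (hn : (1 < n)%N).
Variables (F : finFieldType) (hF : #|F| = q) (w : {unit F}).
Variables (Rsym : set (free_group (sym_gen n))) (hsym : presents Rsym (sym_perm hn)).
Variables (Rsigma : set (free_group 'I_3)) (hsigma : presents Rsigma (sl2_sigma w hn)).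
Variables (Rtau : set (free_group 'I_3)) (htau : presents Rtau (sl2_tau w hn)).
Local Notation i0 := (ix1 hn).
Local Notation i1 := (ix2 hn).
Local Notation P := (@sp_perm F n).
Local Notation tt := (tperm i0 i1).
Local Notation rels := (relators q Rsym Rsigma Rtau).

Definition gen_val (x : sp_gen n) : Sp F n :=
  match x with
  | GenSigma => sp_sigma F hn
  | GenTau => sp_tau F hn
  | GenDelta => sp_delta w hn
  | GenZ => sp_Z F hn
  | GenU => P tt
  | GenV _ => P (cyc n)
  end.

Lemma presents_rel (X : choiceType) (G : groupType) (R : set (free_group X)) (g : X -> G) r :
  presents R g -> R r -> free_lift g r = 1.
Proof. by move=> h hr; apply/h; apply: normal_closure_sub. Qed.

Lemma two_eq0 : ~~ odd q -> (2%:R : F)%R = 0%R.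
Proof.
move=> oq; have p2 : p = 2%N.
  move: oq; rewrite hq oddX negb_or => /andP[_ op].
  by case: (even_prime hp) => // op'; rewrite op' in op.
have := card_finPcharP (F := F) (n := e) _ hp; rewrite hF hq => /(_ erefl).
by rewrite p2 inE => /andP[_ /eqP].
Qed.

Section Cycle.
Variable h2 : (2 < n)%N.
Let i2 := Ordinal h2.
Lemma cyc0 : cyc n i0 = i1. Proof. exact: cyc_succ. Qed.
Lemma cyc1 : cyc n i1 = i2. Proof. exact: cyc_succ. Qed.
Lemma i20 : i2 != i0. Proof. by []. Qed.
Lemma i21 : i2 != i1. Proof. by []. Qed.
Lemma ct0 : (cyc n * tt) i0 = i0. Proof. by rewrite permM cyc0 tpermR. Qed.
Lemma ct1 : (cyc n * tt) i1 = i2. Proof. by rewrite permM cyc1 tpermD. Qed.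
Lemma tc0 : (tt * cyc n) i0 = i2. Proof. by rewrite permM tpermL cyc1. Qed.
Lemma tc1 : (tt * cyc n) i1 = i1. Proof. by rewrite permM tpermR cyc0. Qed.
Lemma cc0 : (cyc n ^+ 2) i0 = i2. Proof. by rewrite expg2 permM cyc0 cyc1. Qed.
Lemma tJc : tt ^ cyc n = tperm i1 i2. Proof. by rewrite tpermJ cyc0 cyc1. Qed.
Lemma cc1 (h3 : (3 < n)%N) : (cyc n ^+ 2) i1 = Ordinal h3.
Proof. by rewrite expg2 permM cyc1; apply: cyc_succ. Qed.
Lemma tJcc (h3 : (3 < n)%N) : tt ^ (cyc n ^+ 2) = tperm i2 (Ordinal h3).
Proof. by rewrite tpermJ cc0 (cc1 h3). Qed.
End Cycle.

Lemma gen_valX a m : free_lift gen_val (a ^+ m) = free_lift gen_val a ^+ m.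
Proof. exact: homX (@free_liftM _ _ gen_val) a m. Qed.

Lemma gen_val_sym c :
  free_lift gen_val (free_lift (@sym_letter n) c) = P (free_lift (sym_perm hn) c).
Proof.
rewrite (free_lift_comp _ _ (@free_liftM _ _ gen_val)) (free_lift_comp _ _ (@sp_permM F n)).
by apply: eq_free_lift => -[|h] /=; rewrite free_lift_letter.
Qed.

Local Notation s_ := (letter (GenSigma n)).
Local Notation t_ := (letter (GenTau n)).
Local Notation d_ := (letter (GenDelta n)).
Local Notation Z_ := (letter (GenZ n)).
Local Notation U_ := (letter (GenU n)).

Lemma gen_val_sigma c :
  free_lift gen_val (free_lift (triple s_ (Delta_of U_ d_) (Uprime_of q U_ Z_)) c) =
  free_lift (sl2_sigma w hn) c.
Proof.
rewrite (free_lift_comp _ _ (@free_liftM _ _ gen_val)); apply: eq_free_lift => i.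
rewrite /sl2_sigma /= /triple /Delta_of /Uprime_of sp_U_perm hF.
case: i => [[|[|[|//]]] hi] /=; rewrite !(tnth_nth 1) /=.
- by rewrite free_lift_letter.
- by rewrite gmulfR /= !free_lift_letter.
- by case: (odd q); rewrite ?gmulfM ?gen_valX /= !free_lift_letter.
Qed.

Lemma gen_val_tau c :
  free_lift gen_val (free_lift (triple t_ d_ Z_) c) = free_lift (sl2_tau w hn) c.
Proof.
rewrite (free_lift_comp _ _ (@free_liftM _ _ gen_val)); apply: eq_free_lift => i.
rewrite /sl2_tau /= /triple.
by case: i => [[|[|[|//]]] hi] /=; rewrite !(tnth_nth 1) /= free_lift_letter.
Qed.

Lemma relators_hold r : rels r -> free_lift gen_val r = 1.
Proof.
have PE (a b : 'S_n) : P a ^ P b = P (a ^ b) by rewrite PJ.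
have sgfix (b : 'S_n) : b i0 = i0 -> b i1 = i1 -> [~ sp_sigma F hn, P b] = 1.
  by move=> b0 b1; apply/commg_fix/sP.
case=> [{}r hr|h|h|h h3|h h3| | | | |h h3|h h4|h|h| | |h|h h3 ev|od| |{}r hr|{}r hr
       |h|h|h|h h3|od|ev| | |h|].
- by rewrite gen_val_sym (presents_rel hsym hr) P1.
all: rewrite ?(gmulfR, gmulfJ, gmulfV, gen_valX, gmulfM) /= ?free_lift_letter /=.
- rewrite PE tJc; apply/commg_fix/zP.
  by rewrite tpermD.
- rewrite PE tJc; apply/commg_fix/dP.
  by rewrite tpermD.
- rewrite -sp_permM; apply/commg_fix/zP.
  exact: ct0.
- rewrite -sp_permM; apply/commg_fix/dP.
  exact: ct0.
- apply: commP'; have := @zZP F n hn tt; rewrite tpermL.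
  by move/zz'; apply.
- apply: commP'; have := @dDP F w n hn tt; rewrite tpermL.
  by move/zd'; apply.
- apply: commP'; have := @dDP F w n hn tt; rewrite tpermL.
  by move/dd'; apply.
- apply: commP'; exact: szu.
- have := sgfix (tt ^ (cyc n ^+ 2)); rewrite PJ PX (tJcc h h3).
  by apply; rewrite tpermD.
- rewrite PE -!sp_permM tJc; apply: sgfix; first by rewrite permM ct0 tpermD.
  by rewrite permM (ct1 h) tpermR.
- apply: commP'; have := @zZP F n hn (cyc n ^+ 2); rewrite (cc0 h) PX.
  by move/spz; apply.
- apply: commP'; have := @dDP F w n hn (cyc n ^+ 2); rewrite (cc0 h) PX.
  by move/spd; apply.
- apply: commP'; exact: sdd'.
- apply: commP'; have := @zZP F n hn tt; rewrite tpermL.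
  by move/tz'; apply.
- rewrite PE tJc; apply/commg_fix/tP.
  by rewrite tpermD.
- rewrite -sp_permM; apply/commg_fix/tP.
  exact: ct0.
- apply: commP'; exact: tzz'.
- apply: commP'; have := @dDP F w n hn tt; rewrite tpermL.
  by move/td'; apply.
- by rewrite gen_val_sigma (presents_rel hsigma hr).
- by rewrite gen_val_tau (presents_rel htau hr).
- rewrite -sp_permM; apply/eqP; rewrite mulg_eq1 invgK; apply/eqP/commP2.
  have := @sXP F n hn (cyc n); have := @sXP F n hn (cyc n * tt).
  by rewrite ct0 (ct1 h) cyc0 (cyc1 h) => h1 h2; apply: (sxa _ _ h2 h1).
- rewrite -sp_permM; apply: commP'; have := @sXP F n hn (cyc n * tt).
  by rewrite ct0 (ct1 h); apply: sxb.
- rewrite -sp_permM; apply: commP'; have := @sXP F n hn (tt * cyc n).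
  by rewrite tc1 (tc0 h); apply: sxc.
- apply: commP'; have := @sXP F n hn (cyc n ^+ 2).
  by rewrite (cc0 h) (cc1 h h3) PX; apply: sxd.
- by apply/eqP; rewrite mulg_eq1 invgK; apply/eqP/commP2/sxe.
- apply: commP'; apply: sxe_even; exact: two_eq0.
- apply: commP'; exact: st'.
- by apply/eqP; rewrite mulg_eq1 invgK; apply/eqP/commP2/stu.
- apply: commP'; have := @tTP F n hn (cyc n ^+ 2); rewrite (cc0 h) PX.
  by move/spt; apply.
- apply: commP'; have := @tTP F n hn tt; rewrite tpermL.
  by move/tt'; apply.
Qed.

End Relators.

(** * The presented group satisfies the relations *)

Section Presentation.
Variables (ch e q n : nat) (hch : prime ch) (hq : q = (ch ^ e)%N) (hn : (1 < n)%N).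
Variables (F : finFieldType) (hF : #|F| = q) (w : {unit F}).
Variables (Rsym : set (free_group (sym_gen n))) (hsym : presents Rsym (sym_perm hn)).
Variables (Rsigma : set (free_group 'I_3)) (hsigma : presents Rsigma (sl2_sigma w hn)).
Variables (Rtau : set (free_group 'I_3)) (htau : presents Rtau (sl2_tau w hn)).
Local Notation i0 := (ix1 hn).
Local Notation i1 := (ix2 hn).
Local Notation P := (@sp_perm F n).
Local Notation tt := (tperm i0 i1).
Local Notation rels := (relators q Rsym Rsigma Rtau).

Local Notation GP := (presented rels).
Local Notation pr := (@pres_proj (sp_gen n) rels).
Local Notation Lt x := (pr (letter x)).
Local Notation gs := (Lt (GenSigma n)).
Local Notation gt := (Lt (GenTau n)).
Local Notation gd := (Lt (GenDelta n)).
Local Notation gz := (Lt (GenZ n)).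
Local Notation gu := (Lt (GenU n)).
Local Notation gv h := (Lt (GenV h)).

Lemma prV a : pr a^-1 = (pr a)^-1.
Proof. exact: homV (@pres_projM _ rels) a. Qed.
Lemma prJ a b : pr (a ^ b) = pr a ^ pr b.
Proof. exact: homJ (@pres_projM _ rels) a b. Qed.
Lemma prX a m : pr (a ^+ m) = pr a ^+ m.
Proof. exact: homX (@pres_projM _ rels) a m. Qed.
Lemma prR a b : pr [~ a, b] = [~ pr a, pr b].
Proof. exact: homR (@pres_projM _ rels) a b. Qed.
Definition prE := (prR, prJ, prX, prV, (@pres_projM _ rels)).

Lemma rel_fix a b : rels [~ a, b] -> pr a ^ pr b = pr a.
Proof. by move/pres_cls1; rewrite prR => /commg_fix. Qed.
Lemma rel_comm a b c : rels ([~ a, b] * c^-1) -> pr a ^ pr b = pr a * pr c.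
Proof.
move/pres_cls1; rewrite pres_projM prV prR => /eqP.
by rewrite mulg_eq1 invgK => /eqP/commg_conj.
Qed.

Lemma closure_pr (Y : choiceType) (R : set (free_group Y)) f a :
  (forall r, R r -> rels (free_lift f r)) -> normal_closure R a ->
  pr (free_lift f a) = 1.
Proof.
move=> hR; rewrite (free_lift_comp _ _ (@pres_projM _ rels)); apply: lift_closure => r hr.
by rewrite -(free_lift_comp _ _ (@pres_projM _ rels)); apply: pres_cls1; apply: hR.
Qed.

Lemma letters_generate (H : GP -> Prop) : subgrp H -> (forall x, H (Lt x)) -> forall g, H g.
Proof.
move=> hH hx g; rewrite -(pres_proj_repr g) -(free_cls_repr (generic_quotient.repr g)).
elim: (generic_quotient.repr _) => [|[x b] u IH]; first exact: (sub1 hH).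
rewrite -cat1s -free_mul_cls [pr _]pres_projM; apply: (subM hH) => //.
case: b; first exact: hx.
have -> : free_cls [:: (x, false)] = (letter x)^-1 by rewrite [RHS]free_inv_cls.
by rewrite prV; apply: (subV hH); apply: hx.
Qed.

(** ** Permutations as words *)

Lemma sym_word (p : 'S_n) : exists c, free_lift (sym_perm hn) c = p.
Proof.
pose A p := exists c, free_lift (sym_perm hn) c = p.
have hA : subgrp A.
  split=> [|_ _ [c <-] [c' <-]|_ [c <-]]; first by exists 1; apply: free_lift1.
    by exists (c * c'); rewrite free_liftM.
  by exists c^-1; rewrite gmulfV.
have hU (i j : 'I_n) : i = 0%N :> nat -> j = 1%N :> nat -> A (tperm i j).
  move=> e0 e1; have -> : i = i0 by apply: ord_inj.
  have -> : j = i1 by apply: ord_inj.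
  by exists (letter (SymU n)); rewrite free_lift_letter.
have hV : A (cyc n).
  have [h|h] := ltnP 2 n; first by exists (letter (SymV h)); rewrite free_lift_letter.
  have -> : cyc n = tt; last exact: hU.
  have n2 : n = 2%N by apply/eqP; rewrite eqn_leq h hn.
  apply/permP => i; apply: ord_inj; rewrite permE /=.
  have [i_0|i_0] := posnP i.
    by rewrite (_ : i = i0) ?tpermL ?modn_small //; apply: ord_inj.
  have i_1 : i = 1%N :> nat.
    by apply/eqP; rewrite eqn_leq i_0 -ltnS -n2 ltn_ord.
  by rewrite (_ : i = i1) ?tpermR /= -?n2 ?modnn //; apply: ord_inj.
by apply: (stab_generated (k := 0) hA hV) => // i j _; apply: cyc_succ.
Qed.

Definition perm_word p := projT1 (cid (sym_word p)).
(** The image of S_n in the presented group.  It is independent of the chosen word,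
   because the relators on U and V present S_n. *)
Definition ppi (p : 'S_n) : GP := pr (free_lift (@sym_letter n) (perm_word p)).

Lemma ppiE c : ppi (free_lift (sym_perm hn) c) = pr (free_lift (@sym_letter n) c).
Proof.
rewrite /ppi /perm_word; case: cid => c' /= c'E.
apply: (mulgI (pr (free_lift (@sym_letter n) c'))^-1).
rewrite mulVg -prV -pres_projM -gmulfV -free_liftM; apply/esym.
apply: closure_pr (@rel_i_sym n q Rsym Rsigma Rtau) _.
by apply/hsym; rewrite free_liftM gmulfV /= c'E mulVg.
Qed.

Lemma ppiM : {morph ppi : p1 p2 / p1 * p2}.
Proof.
move=> p1 p2; have [c1 <-] := sym_word p1; have [c2 <-] := sym_word p2.
by rewrite -free_liftM !ppiE free_liftM pres_projM.
Qed.

Lemma ppi1 : ppi 1 = 1.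
Proof. exact: hom1 ppiM. Qed.
Lemma ppiV p1 : ppi p1^-1 = (ppi p1)^-1.
Proof. exact: homV ppiM p1. Qed.
Lemma ppiJ p1 p2 : ppi (p1 ^ p2) = ppi p1 ^ ppi p2.
Proof. exact: homJ ppiM p1 p2. Qed.

Lemma ppi_U : ppi tt = gu.
Proof. by have := ppiE (letter (SymU n)); rewrite !free_lift_letter. Qed.
Lemma ppi_V h : ppi (cyc n) = gv h.
Proof. by have := ppiE (letter (SymV h)); rewrite !free_lift_letter. Qed.

Lemma ppi_fix_sub (x : GP) : subgrp (fun p => x ^ ppi p = x).
Proof.
split=> [|p1 p2 h1 h2|p1 h1]; first by rewrite ppi1 conjg1.
  by rewrite ppiM conjgM h1.
by rewrite ppiV; apply: conjV_fix.
Qed.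

(** The permutation V U fixes the first index and is a cycle on the others.  For
   n = 3 the relation with V U is absent, but the stabiliser has order 2. *)
Lemma fix_stab0 (x : GP) : (forall h, x ^ (gu ^ gv h) = x) ->
  (forall h, (3 < n)%N -> x ^ (gv h * gu) = x) ->
  forall p : 'S_n, p i0 = i0 -> x ^ ppi p = x.
Proof.
move=> hUV hVU p p0.
have hT (h : (2 < n)%N) : x ^ ppi (tperm i1 (Ordinal h)) = x.
  by rewrite -(tJc hn h) ppiJ ppi_U (ppi_V h).
pose c : 'S_n := if (3 < n)%N then cyc n * tt else
  if insub 2 is Some i then tperm i1 i else 1.
have hc : x ^ ppi c = x.
  rewrite /c; case: ltnP => h3; first by rewrite ppiM (ppi_V (ltnW h3)) ppi_U hVU.
  case: insubP => [i hi ei|_]; last by rewrite ppi1 conjg1.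
  have -> : i = Ordinal hi by apply: ord_inj.
  exact: hT.
apply: (stab_generated (k := 1) (ppi_fix_sub x) hc) => [i j i_gt0 ej|i j ei ej|].
- rewrite /c; case: ltnP => h3.
    rewrite permM (cyc_succ ej) tpermD // -val_eqE /= ej; first by rewrite eq_sym.
    by rewrite eqSS eq_sym -lt0n.
  have j2 : j = 2%N :> nat.
    by apply/eqP; rewrite eqn_leq -ltnS (leq_trans (ltn_ord j)) //= ej.
  have {ej}ei : i = i1 by apply: ord_inj; apply: succn_inj; rewrite /= -ej.
  case: insubP => [k _ ek|]; last by rewrite -j2 ltn_ord.
  by rewrite ei tpermL; apply: ord_inj; rewrite ek.
- have h : (2 < n)%N by rewrite (leq_trans _ (ltn_ord j)) // ej.
  have -> : i = i1 by apply: ord_inj.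
  have -> : j = Ordinal h by apply: ord_inj.
  exact: hT.
exact: (stab_fix0 p0).
Qed.

(** V U U^V fixes the first two indices and is a cycle on the others; for n = 4 the
   stabiliser is generated by U^(V^2). *)
Lemma fix_stab01 (x : GP) : (forall h, (3 < n)%N -> x ^ (gu ^ (gv h ^+ 2)) = x) ->
  (forall h, (4 < n)%N -> x ^ (gv h * gu * gu ^ gv h) = x) ->
  forall p : 'S_n, p i0 = i0 -> p i1 = i1 -> x ^ ppi p = x.
Proof.
move=> hUVV hVUU p p0 p1.
have hT (h : (2 < n)%N) (h3 : (3 < n)%N) : x ^ ppi (tperm (Ordinal h) (Ordinal h3)) = x.
  by rewrite -(tJcc hn h h3) ppiJ ppi_U expg2 ppiM (ppi_V h) -expg2 hUVV.
pose c : 'S_n := if (4 < n)%N then cyc n * tt * tt ^ cyc n else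
  if insub 2 is Some i then if insub 3 is Some j then tperm i j else 1 else 1.
have hc : x ^ ppi c = x.
  rewrite /c; case: ltnP => h4.
    by rewrite ppiM (ppiM (cyc n)) ppiJ (ppi_V (ltnW (ltnW h4))) ppi_U hVUU.
  case: insubP => [i hi ei|_]; last by rewrite ppi1 conjg1.
  case: insubP => [j hj ej|_]; last by rewrite ppi1 conjg1.
  have -> : i = Ordinal hi by apply: ord_inj.
  have -> : j = Ordinal hj by apply: ord_inj.
  exact: hT.
apply: (stab_generated (k := 2) (ppi_fix_sub x) hc) => [i j i_gt1 ej|i j ei ej|].
- rewrite /c; case: ltnP => h4.
    rewrite (tJc hn (ltnW (ltnW h4))) !permM (cyc_succ ej).
    have j3 : (2 < j)%N by rewrite ej.
    have jn k : (k < 3)%N -> (k == j) = false.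
      by move=> hk; apply/negbTE; rewrite neq_ltn (leq_trans hk).
    by rewrite tpermD -?val_eqE /= ?jn // tpermD -?val_eqE /= ?jn.
  have j3 : j = 3%N :> nat.
    by apply/eqP; rewrite eqn_leq -ltnS (leq_trans (ltn_ord j)) //= ej.
  have i2 : i = 2%N :> nat by apply: succn_inj; rewrite /= -ej.
  case: insubP => [k _ ek|]; last by rewrite -i2 ltn_ord.
  case: insubP => [l _ el|]; last by rewrite -j3 ltn_ord.
  by rewrite (_ : i = k) ?tpermL; apply: ord_inj; rewrite ?ek ?el.
- have h3 : (3 < n)%N by rewrite (leq_trans _ (ltn_ord j)) // ej.
  have -> : i = Ordinal (ltnW h3) by apply: ord_inj.
  have -> : j = Ordinal h3 by apply: ord_inj.
  exact: hT.
exact: (stab_fix01 p0 p1).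
Qed.

(** ** The relations for all indices *)

Lemma ppi_fix (x : GP) (p1 p2 : 'S_n) : (forall p : 'S_n, p i0 = i0 -> x ^ ppi p = x) ->
  p1 i0 = p2 i0 -> x ^ ppi p1 = x ^ ppi p2.
Proof.
move=> hx p12; rewrite -{1}(mulgKV p2 p1) ppiM conjgM (hx (p1 * p2^-1)) //.
by rewrite permM p12 permK.
Qed.

Lemma z_fix (p : 'S_n) : p i0 = i0 -> gz ^ ppi p = gz.
Proof.
apply: fix_stab0 => [h|h h3].
  by have := rel_fix (rel_i_Z_UV q Rsym Rsigma Rtau h); rewrite !prE.
by have := rel_fix (rel_i_Z_VU q Rsym Rsigma Rtau h h3); rewrite !prE.
Qed.
Lemma d_fix (p : 'S_n) : p i0 = i0 -> gd ^ ppi p = gd.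
Proof.
apply: fix_stab0 => [h|h h3].
  by have := rel_fix (rel_i_d_UV q Rsym Rsigma Rtau h); rewrite !prE.
by have := rel_fix (rel_i_d_VU q Rsym Rsigma Rtau h h3); rewrite !prE.
Qed.
Lemma s_fix (p : 'S_n) : p i0 = i0 -> p i1 = i1 -> gs ^ ppi p = gs.
Proof.
apply: fix_stab01 => h hh.
  by have := rel_fix (rel_ii_s_UV2 q Rsym Rsigma Rtau h hh); rewrite !prE.
by have := rel_fix (rel_ii_s_VUUV q Rsym Rsigma Rtau h hh); rewrite !prE.
Qed.

Lemma s_ppi (p1 p2 : 'S_n) : p1 i0 = p2 i0 -> p1 i1 = p2 i1 -> gs ^ ppi p1 = gs ^ ppi p2.
Proof.
move=> h0 h1; rewrite -{1}(mulgKV p2 p1) ppiM conjgM (s_fix (p := p1 * p2^-1)) // permM.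
  by rewrite h0 permK.
by rewrite h1 permK.
Qed.

Lemma other_gt2 (i : 'I_n) : i != i0 -> i != i1 -> (2 < n)%N.
Proof.
by case: i => [[|[|i]] hi] //= _ _; apply: leq_trans hi.
Qed.

(** The assumption is the case of the third index; the other indices are conjugate to it
   under the stabiliser of the first two. *)
Lemma third_fix (x : GP) : (forall p : 'S_n, p i0 = i0 -> x ^ ppi p = x) ->
  (forall h, gs ^ (x ^ (gv h ^+ 2)) = gs) ->
  forall p : 'S_n, p i0 != i0 -> p i0 != i1 -> gs ^ (x ^ ppi p) = gs.
Proof.
move=> hx hs p h0 h1; have h := other_gt2 h0 h1.
have i2i := i20 hn h; have i2j := i21 hn h.
pose r : 'S_n := tperm (Ordinal h) (p i0).
have rs : gs ^ ppi r = gs by apply: s_fix; rewrite tpermD.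
rewrite (ppi_fix (p2 := cyc n * cyc n * r) hx); last by rewrite !permM cyc0 (cyc1 hn h) tpermL.
by rewrite !ppiM (conjgM x (_ * _)) (ppi_V h) -expg2 -{1}rs -conjJg hs rs.
Qed.

(* Reduces a relation for p to the one for p1, where r centralises sigma. *)
Lemma s_conj_base (p p1 r : 'S_n) : r i0 = i0 -> r i1 = i1 ->
  p i0 = r (p1 i0) -> p i1 = r (p1 i1) ->
  gs ^ (gs ^ ppi p) = (gs ^ (gs ^ ppi p1)) ^ ppi r.
Proof.
move=> r0 r1 e0 e1; rewrite (s_ppi (p2 := p1 * r)) ?permM //.
by rewrite ppiM (conjgM gs (ppi p1)) [RHS]conjJg (s_fix r0 r1).
Qed.

(** ** The two copies of SL(2, q) *)

Local Notation phi := (@pres_lift _ rels _ (@gen_val n hn F w)).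

Lemma phi_pr a : phi (pr a) = free_lift (@gen_val n hn F w) a.
Proof. by apply: pres_lift_cls => r; apply: (relators_hold hch hq hF hsym hsigma htau). Qed.

Lemma phiM : {morph phi : x y / x * y}.
Proof. by apply: pres_liftM => r; apply: (relators_hold hch hq hF hsym hsigma htau). Qed.

Lemma triple_word a b c g : gen (fun x => [\/ x = pr a, x = pr b | x = pr c]) g ->
  exists r, g = pr (free_lift (triple a b c) r).
Proof.
elim=> [|x [] ->|x y _ [r1 ->] _ [r2 ->]|x _ [r ->]].
- by exists 1; rewrite free_lift1.
- by exists (letter ord0); rewrite free_lift_letter /triple (tnth_nth 1).
- by exists (letter (Ordinal (erefl : 1 < 3)%N)); rewrite free_lift_letter /triple (tnth_nth 1).
- by exists (letter (Ordinal (erefl : 2 < 3)%N)); rewrite free_lift_letter /triple (tnth_nth 1).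
- by exists (r1 * r2); rewrite gmulfM pres_projM.
- by exists r^-1; rewrite gmulfV prV.
Qed.

(** An element of the kernel is the value of a word that is trivial in SL(2,q), hence
   a consequence of the relators of SL(2,q). *)
Lemma tau_faithful g : gen (fun x => [\/ x = gt, x = gd | x = gz]) g -> phi g = 1 -> g = 1.
Proof.
case/triple_word => r ->; rewrite phi_pr (gen_val_tau hn) => hr.
by apply: closure_pr (@rel_iv n q Rsym Rsigma Rtau) _; apply/htau.
Qed.

Lemma phi_gz2 : ~~ odd q -> phi (gz ^+ 2) = 1.
Proof.
move=> oq; rewrite expg2 phiM phi_pr free_lift_letter /=; apply: spP => v k.
have two0 := two_eq0 hch hq hF oq.
have opp1 (a : F) : (- a = a)%R.
  by apply/eqP; rewrite -subr_eq0 -opprD oppr_eq0 -mulr2n -mulr_natl two0 mul0r.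
by rewrite !actM act1 !zZ eqxx; case: eqP => [->|_]; rewrite ?opp1.
Qed.

Lemma gz_sqr : ~~ odd q -> gz ^+ 2 = 1.
Proof.
move=> oq; apply: tau_faithful; last exact: phi_gz2.
by apply: (subX (gen_sub _)); apply: gen_in; apply: Or33.
Qed.

Lemma pr_Uprime : pr (Uprime_of q (letter (GenU n)) (letter (GenZ n))) = gu * gz ^+ 2.
Proof.
rewrite /Uprime_of; case: ifP => oq; first by rewrite !prE.
by rewrite gz_sqr ?oq // mulg1.
Qed.

Lemma sigma_faithful g :
  gen (fun x => [\/ x = gs, x = Delta_of gu gd | x = gu * gz ^+ 2]) g -> phi g = 1 -> g = 1.
Proof.
have -> : Delta_of gu gd = pr (Delta_of (letter (GenU n)) (letter (GenDelta n))).
  by rewrite /Delta_of !prE.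
rewrite -pr_Uprime; case/triple_word => r ->; rewrite phi_pr gen_val_sigma // => hr.
by apply: closure_pr (@rel_iii n q Rsym Rsigma Rtau) _; apply/hsigma.
Qed.

Lemma gt_ch : gt ^+ ch = 1.
Proof.
apply: tau_faithful.
  by apply: (subX (gen_sub _)); apply: gen_in; apply: Or31.
have phiX m : phi (gt ^+ m) = sp_tau F hn ^+ m.
  by rewrite (homX phiM) phi_pr free_lift_letter.
have tX m : isT i0 (m%:R)%R (sp_tau F hn ^+ m).
  elim: m => [|m IH]; first by move=> v k; rewrite act1 mulr0 mul0r addr0.
  by rewrite expgS mulrS; apply: isTM IH; apply: tT.
rewrite phiX; apply: (isT_eq1 (i := i0)); have := tX ch.
have := card_finPcharP (F := F) (n := e) _ hch; rewrite hF hq => /(_ erefl).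
by rewrite inE => /andP[_ /eqP ->].
Qed.

(** ** Permutations fixing the first index centralise tau *)

Section OddTau.
Hypothesis oq : odd q.

(** For odd q tau^2 is conjugate to a commutator of sigma and sigma^Z. *)
Lemma sqr_tau : gt ^+ 2 = (gs^-1 * gs ^ (gs ^ gz)) ^ (gz * gu)^-1.
Proof.
have := rel_comm (rel_v_e_odd Rsym Rsigma Rtau oq).
rewrite !prE => ->.
by rewrite mulKg conjgK.
Qed.

(** The commutator, and the conjugating element Z U, commute with the stabiliser
   of the first two indices.  With U^V this gives the transpositions of the second
   index and any later one. *)
Lemma sqr_tau_fix (p : 'S_n) : p i0 = i0 -> (gt ^+ 2) ^ ppi p = gt ^+ 2.
Proof.
have fix01 (r : 'S_n) : r i0 = i0 -> r i1 = i1 -> (gt ^+ 2) ^ ppi r = gt ^+ 2.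
  move=> r0 r1; have zu : (gz * gu) ^ ppi r = gz * gu.
    by rewrite [LHS]conjMg z_fix // -ppi_U -ppiJ tpermJ r0 r1.
  rewrite sqr_tau conjJg; congr (_ ^ _); last by rewrite conjVg zu.
  have sr := s_fix r0 r1; have zr := z_fix r0.
  by rewrite conjMg conjVg sr (conjJg gs (gs ^ gz)) (conjJg gs gz) sr zr.
have UV (h : (2 < n)%N) : (gt ^+ 2) ^ ppi (tperm i1 (Ordinal h)) = gt ^+ 2.
  rewrite -(tJc hn h) ppiJ ppi_U (ppi_V h); rewrite [LHS]conjXg; congr (_ ^+ _).
  by have := rel_fix (rel_ii_t_UV q Rsym Rsigma Rtau h); rewrite !prE.
move=> p0; have [p1|p1] := eqVneq (p i1) i1; first exact: fix01.
have p1' : p i1 != i0 by rewrite -[X in _ != X]p0 (inj_eq perm_inj).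
have h := other_gt2 p1' p1.
have U1 : (gt ^+ 2) ^ ppi (tperm i1 (p i1)) = gt ^+ 2.
  have [->|ne] := eqVneq (p i1) (Ordinal h); first exact: UV.
  have -> : tperm i1 (p i1) = tperm i1 (Ordinal h) ^ tperm (Ordinal h) (p i1).
    by rewrite tpermJ tpermL tpermD // eq_sym.
  by apply: (subJ (ppi_fix_sub _)); [apply: UV | apply: fix01; rewrite tpermD].
have -> : p = p * tperm i1 (p i1) * tperm i1 (p i1) by rewrite -mulgA tperm2 mulg1.
apply: (subM (ppi_fix_sub _)) => //; apply: fix01; rewrite permM ?tpermR //.
by rewrite p0 tpermD // eq_sym.
Qed.

Lemma t_fix_odd (p : 'S_n) : p i0 = i0 -> gt ^ ppi p = gt.
Proof.
move=> p0; have och : odd ch by move: oq; rewrite hq oddX => /orP[/eqP e0|//]; move: (finNzRing_gt1 F); rewrite hF hq e0.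
have -> : gt = (gt ^+ 2) ^+ ch.+1./2.
  by rewrite -expgM mul2n halfK /= och subn0 expgS gt_ch mulg1.
by rewrite [LHS]conjXg sqr_tau_fix.
Qed.

End OddTau.

Lemma t_fix (p : 'S_n) : p i0 = i0 -> gt ^ ppi p = gt.
Proof.
case oq : (odd q); first exact: t_fix_odd.
apply: fix_stab0 => [h|h h3].
  by have := rel_fix (rel_ii_t_UV q Rsym Rsigma Rtau h); rewrite !prE.
by have := rel_fix (rel_ii_t_VU Rsym Rsigma Rtau h h3 (negbT oq)); rewrite !prE.
Qed.

(** ** The system *)

Lemma s_a (p p' : 'S_n) : p i0 = i1 -> p i1 != i0 -> p' i0 = i0 -> p' i1 = p i1 ->
  gs ^ (gs ^ ppi p) = gs * gs ^ ppi p'.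
Proof.
move=> p0 p1 p'0 p'1; have p1' : p i1 != i1 by rewrite -[X in _ != X]p0 (inj_eq perm_inj).
have h := other_gt2 p1 p1'; have i2i := i20 hn h; have i2j := i21 hn h.
pose r : 'S_n := tperm (Ordinal h) (p i1).
have r0 : r i0 = i0 by rewrite tpermD.
have r1 : r i1 = i1 by rewrite tpermD.
rewrite (s_conj_base (p1 := cyc n) r0 r1) ?cyc0 ?(cyc1 hn h) ?tpermL ?r1 //.
have := rel_comm (rel_v_a q Rsym Rsigma Rtau h); rewrite !prE -(ppi_V h) => ->.
rewrite conjMg (s_fix r0 r1); congr (_ * _).
rewrite -ppi_U -ppiM -[LHS]conjgM -ppiM; apply: s_ppi.
  by rewrite permM (ct0 hn) r0.
by rewrite permM (ct1 hn h) tpermL p'1.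
Qed.

Lemma s_b (p : 'S_n) : p i0 = i0 -> p i1 != i1 -> gs ^ (gs ^ ppi p) = gs.
Proof.
move=> p0 p1; have p1' : p i1 != i0 by rewrite -[X in _ != X]p0 (inj_eq perm_inj).
have h := other_gt2 p1' p1; have i2i := i20 hn h; have i2j := i21 hn h.
pose r : 'S_n := tperm (Ordinal h) (p i1).
have r0 : r i0 = i0 by rewrite tpermD.
have r1 : r i1 = i1 by rewrite tpermD.
rewrite (s_conj_base (p1 := cyc n * tt) r0 r1) ?(ct0 hn) ?(ct1 hn h) ?tpermL ?r0 //.
have := rel_fix (rel_v_b q Rsym Rsigma Rtau h); rewrite !prE -(ppi_V h) -ppi_U -ppiM => ->.
exact: s_fix.
Qed.

Lemma s_c (p : 'S_n) : p i1 = i1 -> p i0 != i0 -> gs ^ (gs ^ ppi p) = gs.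
Proof.
move=> p1 p0; have p0' : p i0 != i1 by rewrite -[X in _ != X]p1 (inj_eq perm_inj).
have h := other_gt2 p0 p0'; have i2i := i20 hn h; have i2j := i21 hn h.
pose r : 'S_n := tperm (Ordinal h) (p i0).
have r0 : r i0 = i0 by rewrite tpermD.
have r1 : r i1 = i1 by rewrite tpermD.
rewrite (s_conj_base (p1 := tt * cyc n) r0 r1) ?(tc1 hn) ?(tc0 hn h) ?tpermL ?r1 //.
have := rel_fix (rel_v_c q Rsym Rsigma Rtau h); rewrite !prE -(ppi_V h) -ppi_U -ppiM => ->.
exact: s_fix.
Qed.

Lemma s_d4 (p : 'S_n) : [&& p i0 != i0, p i0 != i1, p i1 != i0 & p i1 != i1] ->
  gs ^ (gs ^ ppi p) = gs.
Proof.
case/and4P => p00 p01 p10 p11; have h := other_gt2 p00 p01.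
have i2i := i20 hn h; have i2j := i21 hn h.
have h3 : (3 < n)%N.
  have : (#|[:: i0; i1; p i0; p i1]| <= n)%N by rewrite -[X in (_ <= X)%N]card_ord max_card.
  rewrite (card_uniqP _) //= !inE !negb_or (eq_sym i0 (p i0)) p00 (eq_sym i0 (p i1)) p10.
  by rewrite (eq_sym i1 (p i0)) p01 (eq_sym i1 (p i1)) p11 (inj_eq perm_inj).
pose m := tperm (Ordinal h) (p i0) (Ordinal h3).
have m2 : m != p i0 by rewrite -(tpermL (Ordinal h) (p i0)) (inj_eq perm_inj).
have m0 : m != i0 by rewrite /m; case: tpermP.
have m1 : m != i1 by rewrite /m; case: tpermP.
pose r : 'S_n := tperm (Ordinal h) (p i0) * tperm m (p i1).
have r0 : r i0 = i0 by rewrite permM !tpermD.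
have r1 : r i1 = i1 by rewrite permM !tpermD.
rewrite (s_conj_base (p1 := cyc n ^+ 2) r0 r1).
- have := rel_fix (rel_v_d q Rsym Rsigma Rtau h h3); rewrite !prE.
  by rewrite expg2 ppiM (ppi_V h) -expg2 => ->; apply: s_fix.
- rewrite (cc0 hn h) permM tpermL tpermD //.
  by rewrite (inj_eq perm_inj).
- by rewrite (cc1 hn h h3) permM tpermL.
Qed.

Lemma s_e : gs ^ (gs ^ gz) = gs * (gt ^+ 2) ^ (gz * gu).
Proof.
case oq : (odd q).
  have := rel_comm (rel_v_e_odd Rsym Rsigma Rtau oq).
  by rewrite !prE.
have := rel_fix (rel_v_e_even Rsym Rsigma Rtau (negbT oq)); rewrite !prE => ->.
have -> : gt ^+ 2 = 1; last by rewrite conj1g mulg1.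
have ch2 : ch = 2%N.
  move/negbT: oq; rewrite hq oddX negb_or => /andP[_ och].
  by case: (even_prime hch) => // och'; rewrite och' in och.
by rewrite -{1}ch2 gt_ch.
Qed.

Lemma letters_gen (g : GP) : gen (fun x => (exists p, x = ppi p) \/
  [\/ x = gs, x = gt, x = gd | x = gz]) g.
Proof.
apply: (letters_generate (gen_sub _)) => -[||||| h]; apply: gen_in.
- by right; apply: Or41.
- by right; apply: Or42.
- by right; apply: Or43.
- by right; apply: Or44.
- by left; exists tt; rewrite ppi_U.
- by left; exists (cyc n); rewrite (ppi_V h).
Qed.

Lemma phi_ppi (p : 'S_n) : phi (ppi p) = P p.
Proof. by rewrite -[in RHS](projT2 (cid (sym_word p))) phi_pr gen_val_sym. Qed.

Lemma presented_system : inhabited (sp_system w hn GP).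
Proof.
have rf a b : rels [~ a, b] -> pr a ^ pr b = pr a by exact: rel_fix.
have gU : ppi tt = gu by exact: ppi_U.
have vals x y : gen_val hn w x = y -> phi (Lt x) = y by rewrite phi_pr free_lift_letter.
have zz : gz ^ (gz ^ ppi tt) = gz by rewrite gU -prJ rf //; apply: rel_i_Z_ZU.
have zd : gz ^ (gd ^ ppi tt) = gz by rewrite gU -prJ rf //; apply: rel_i_Z_dU.
have dd : gd ^ (gd ^ ppi tt) = gd by rewrite gU -prJ rf //; apply: rel_i_d_dU.
have szu : gs ^ (gz * ppi tt * gz^-1) = gs.
  by rewrite gU -prV -!pres_projM rf //; apply: rel_ii_s_ZU.
have sdd : gs ^ (gd * gd ^ ppi tt) = gs.
  by rewrite gU -prJ -pres_projM rf //; apply: rel_ii_s_ddU.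
have tz : gt ^ (gz ^ ppi tt) = gt by rewrite gU -prJ rf //; apply: rel_ii_t_ZU.
have td : gt ^ (gd ^ ppi tt) = gt by rewrite gU -prJ rf //; apply: rel_ii_t_dU.
have st : gs ^ gt = gs by apply: rf; apply: rel_v_f.
have tt' : gt ^ (gt ^ ppi tt) = gt by rewrite gU -prJ rf //; apply: rel_v_j.
have stu : gs ^ (gt ^ ppi tt) = gs * (gs ^ (gz ^ ppi tt) * gt^-1).
  by rewrite gU; have := rel_comm (rel_v_g q Rsym Rsigma Rtau); rewrite !prE.
have se : gs ^ (gs ^ gz) = gs * (gt ^+ 2) ^ (gz * ppi tt) by rewrite gU s_e.
have sz (p : 'S_n) : p i0 != i0 -> p i0 != i1 -> gs ^ (gz ^ ppi p) = gs.
  apply: third_fix => [|h]; first exact: z_fix.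
  by have := rel_fix (rel_ii_s_ZV2 q Rsym Rsigma Rtau h); rewrite !prE.
have sd (p : 'S_n) : p i0 != i0 -> p i0 != i1 -> gs ^ (gd ^ ppi p) = gs.
  apply: third_fix => [|h]; first exact: d_fix.
  by have := rel_fix (rel_ii_s_dV2 q Rsym Rsigma Rtau h); rewrite !prE.
have stp (p : 'S_n) : p i0 != i0 -> p i0 != i1 -> gs ^ (gt ^ ppi p) = gs.
  apply: third_fix => [|h]; first exact: t_fix.
  by have := rel_fix (rel_v_h q Rsym Rsigma Rtau h); rewrite !prE.
have fs g : gen (fun x => [\/ x = gs, x = Delta_of (ppi tt) gd | x = ppi tt * gz ^+ 2]) g ->
    phi g = 1 -> g = 1 by rewrite gU; apply: sigma_faithful.
by constructor; exact: (SpSystem (sphi := phi) phiM (spi := ppi) ppiM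
  (vals (GenSigma n) _ erefl) (vals (GenTau n) _ erefl) (vals (GenDelta n) _ erefl)
  (vals (GenZ n) _ erefl) phi_ppi letters_gen
  z_fix d_fix zz zd dd szu s_fix sz sd sdd tz t_fix td fs tau_faithful
  s_a s_b s_c s_d4 se st stu stp tt').
Qed.

End Presentation.

Theorem theorem6p5 (p e q n : nat) (hp : prime p) (he : (1 < e)%N)
    (hq : q = (p ^ e)%N) (hn : (1 < n)%N)
    (F : finFieldType) (hF : #|F| = q)
    (w : {unit F}) (hw : (q.-1.-primitive_root (val w))%R)
    (Rsym : set (free_group (sym_gen n))) (hsym : presents Rsym (sym_perm hn))
    (Rsigma : set (free_group 'I_3)) (hsigma : presents Rsigma (sl2_sigma w hn))
    (Rtau : set (free_group 'I_3)) (htau : presents Rtau (sl2_tau w hn)) :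
  isomorphic (presented (relators q Rsym Rsigma Rtau)) (Sp F n).
Proof.
have [S] := presented_system hp hq hF hsym hsigma htau.
have hw' : (#|F|.-1.-primitive_root (val w))%R by rewrite hF.
pose fM := isMultiplicative.Build _ _ (sphi S) (sphiM S).
pose f : {multiplicative presented (relators q Rsym Rsigma Rtau) -> Sp F n} :=
  HB.pack (sphi S) fM.
by exists f; exact: (sphi_bij hw' S).
Qed.
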